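(* Let $(X,0)$ be a germ of complex spaces such that $\dim_{\mathbb{C}} T^1_{(X,0)} < +\infty$ and let $G$ be a compact complex Lie group acting holomorphically on $(X,0)$. Let $(S,0)$ be the base of the $G$-equivariant semi-universal deformation of $(X,0)$ and let $(S^G,0)\subset(S,0)$ be the subgerm fixed by $G$. If $G$ acts trivially on $T^1_{(X,0)}$ and $(S^G,0)$ is smooth, then the germs $(S,0)$ and $(S^G,0)$ coincide. In particular, for any deformation $(\mathcal{Y},0) \rightarrow (T,0)$ of $(X,0)$, the $G$-action on $(X,0)$ extends to a $G$-action on $(\mathcal{Y},0)$.
   Context: A deformation of $(X,0)$ over a germ $(S,0)$ is a flat morphism of germs of complex spaces $\pi:(\mathcal{X},0)\to(S,0)$ with an identification of $(X,0)$ with $(\pi^{-1}(0),0)$. $T^1_{(X,0)}$ is the $\mathbb{C}$-vector space of isomorphism classes of deformations over the double point $\mathrm{Spec}(\mathbb{C}[\epsilon])$, $\epsilon^2=0$; $G$ acts naturally on it ($g$ changes the identification $\iota$ of $(X,0)$ with the central fibre to $\iota\circ g^{-1}$). A deformation is semi-universal if every deformation $\rho:(\mathcal{Y},0)\to(T,0)$ of $(X,0)$ is isomorphic to its pullback by some morphism $\phi:(T,0)\to(S,0)$ whose differential is unique. A $G$-equivariant deformation of $(X,0)$ is a deformation $\pi:(\mathcal{X},0)\to(S,0)$ with $G$-actions on $(\mathcal{X},0)$ and $(S,0)$ such that $\pi$ is equivariant and the action on $(\mathcal{X},0)$ extends the given one on $(X,0)$. It is $G$-equivariantly semi-universal if it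 is semi-universal and every $G$-equivariant deformation $\rho:(\mathcal{Y},0)\to(T,0)$ is $G$-equivariantly isomorphic to the pullback of $\pi$ by a $G$-equivariant morphism $\phi:(T,0)\to(S,0)$ whose differential is unique. Under the hypotheses $\dim_{\mathbb{C}} T^1_{(X,0)}<+\infty$ and $G$ compact, such a deformation exists, is unique up to $G$-equivariant isomorphism, and has $\dim_{\mathbb{C}} T_0S=\dim_{\mathbb{C}} T^1_{(X,0)}$; the fixed subgerm $(S^G,0)$ is the base of a semi-universal deformation of the pair $((X,0),G)$ (deformations of $(X,0)$ with a $G$-action on the total space extending that on $(X,0)$ and lying over the trivial action on the base), and $T_0S^G\cong(T^1_{(X,0)})^G$. *)

(* Defs.v *)
From HB Require Import structures.
From mathcomp Require Import all_boot all_order all_algebra complex.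
From mathcomp Require Import all_classical all_reals all_analysis.

Set Implicit Arguments.
Unset Strict Implicit.
Unset Printing Implicit Defensive.

Import Order.TTheory GRing.Theory Num.Theory.
Import numFieldNormedType.Exports.

Local Open Scope classical_set_scope.
Local Open Scope ring_scope.

(* The complex numbers as a bare [numClosedFieldType], so that the topology and
   the norm of the library are inferred for C and for C^n. *)
Definition Cplx (R : realType) : numClosedFieldType := R[i].

Section PowerSeries.
Variables (C : numFieldType) (n : nat).
Local Notation mindex := {ffun 'I_n -> nat}.

Definition ps_monomial (z : 'rV[C]_n) (a : mindex) : C := \prod_i z 0 i ^+ a i.

Definition psum (c : mindex -> C) (z : 'rV[C]_n) (N : nat) : C :=
  \sum_(a : {ffun 'I_n -> 'I_N})
    c [ffun i => a i : nat] * ps_monomial z [ffun i => a i : nat].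

(* On the polydisc of radius [r] around [p], [f] is the sum of a power series;
   the bound on the coefficients makes the convergence absolute there, so that
   summing over growing cubes of multi-indices is no restriction. *)
Definition pseries_at (f : 'rV[C]_n -> C) (p : 'rV[C]_n)
    (c : mindex -> C) (r M : C) : Prop :=
  [/\ 0 < r,
      forall a, `|c a| * r ^+ (\sum_i a i)%N <= M
    & forall z : 'rV[C]_n, (forall i, `|z 0 i| < r) ->
        psum c z N @[N --> \oo] --> f (p + z)].

(* Holomorphic in a neighbourhood of [p]; the values of [f] away from [p] are
   irrelevant. *)
Definition hol_at (f : 'rV[C]_n -> C) (p : 'rV[C]_n) : Prop :=
  exists c r M, pseries_at f p c r M.

Lemma pseries_shrink f p c r M (s : C) :
  0 < s -> s <= r -> pseries_at f p c r M -> pseries_at f p c s M.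
Proof.
move=> s0 sr [r0 cM cf]; split=> // [a|z zs].
  apply: le_trans (cM a); apply: ler_wpM2l => //.
  by apply: lerXn2r => //; rewrite nnegrE ltW.
by apply: cf => i; apply: lt_le_trans (zs i) sr.
Qed.

Lemma common_radius (r s : C) : 0 < r -> 0 < s ->
  exists t : C, [/\ 0 < t, t <= r & t <= s].
Proof.
move=> r0 s0; exists (r * s / (r + s)).
have rs0 : 0 < r + s by rewrite addr_gt0.
split; first by rewrite divr_gt0 ?mulr_gt0.
  by rewrite ler_pdivrMr// ler_wpM2l ?ltW// ltrDr.
by rewrite ler_pdivrMr// mulrC ler_wpM2l ?ltW// ltrDl.
Qed.

Lemma hol_cst (k : C) p : hol_at (fun=> k) p.
Proof.
exists (fun a => k * (a == [ffun=> 0%N])%:R), 1, `|k|; split=> // [a|z _].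
  by rewrite expr1n mulr1 normrM ler_piMr// normr_nat lern1 leq_b1.
apply: cvg_near_cst; exists 1%N => // N /= N0.
rewrite /psum (bigD1 [ffun=> Ordinal N0])//= big1 ?addr0 => [|a aN0].
  rewrite /ps_monomial big1 => [|i _]; last by rewrite !ffunE expr0.
  rewrite mulr1 (_ : _ == _) ?mulr1//.
  by apply/eqP/ffunP => i; rewrite !ffunE.
rewrite (_ : (_ == _) = false) ?mulr0 ?mul0r//.
apply: contraNF aN0 => /eqP/ffunP a0.
by apply/eqP/ffunP => i; have := a0 i; rewrite !ffunE => ?; apply/val_inj.
Qed.

Lemma holB f g p : hol_at f p -> hol_at g p -> hol_at (fun z => f z - g z) p.
Proof.
move=> [c [r [M fc]]] [d [s [L gd]]].
have [r0 _ _] := fc; have [s0 _ _] := gd.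
have [t [t0 tr ts]] := common_radius r0 s0.
have [_ cM cf] := pseries_shrink t0 tr fc.
have [_ dL dg] := pseries_shrink t0 ts gd.
exists (fun a => c a - d a), t, (M + L); split=> // [a|z zt].
  apply: le_trans (lerD (cM a) (dL a)).
  by rewrite -mulrDl ler_wpM2r ?ler_normB ?exprn_ge0 ?ltW.
rewrite [X in X @ _](_ : _ = fun N => psum c z N - psum d z N).
  by apply: cvgB; [apply: cf|apply: dg].
by apply/funext => N; rewrite /psum -sumrB; apply: eq_bigr => a _;
  rewrite mulrBl.
Qed.

End PowerSeries.

Section Product.
Variables (C : numFieldType) (n : nat).
Local Notation mindex := {ffun 'I_n -> nat}.
Local Notation h := (2^-1 : C).
Implicit Types (a b g : mindex) (c d : mindex -> C) (z : 'rV[C]_n).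

Let deg a := (\sum_i a i)%N.
Let le a g := [forall i, (a i <= g i)%N].
Let sub g a : mindex := [ffun i => (g i - a i)%N].
Let add a b : mindex := [ffun i => (a i + b i)%N].

Let box N : seq mindex :=
  [seq [ffun i => a i : nat] | a : {ffun 'I_n -> 'I_N}].

Let mem_box N a : (a \in box N) = [forall i, a i < N]%N.
Proof.
apply/fintype.imageP/forallP => [[b _ ->] i|aN]; first by rewrite ffunE.
by exists [ffun i => Ordinal (aN i)] => //; apply/ffunP => i; rewrite !ffunE.
Qed.

Let box_uniq N : uniq (box N).
Proof.
rewrite map_inj_uniq ?enum_uniq// => a b /ffunP ab; apply/ffunP => i.
by have := ab i; rewrite !ffunE => /val_inj.
Qed.

Let psumE c z N : psum c z N = \sum_(a <- box N) c a * ps_monomial z a.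
Proof. by rewrite big_image/=. Qed.

Let deg_add a b : deg (add a b) = (deg a + deg b)%N.
Proof. by rewrite /deg -big_split; apply: eq_bigr => i _; rewrite ffunE. Qed.

Let addK a : {in le a, cancel (sub^~ a) (add a)}.
Proof. by move=> g /forallP ag; apply/ffunP => i; rewrite !ffunE subnKC. Qed.

Let h_gt0 : 0 < h. Proof. by rewrite invr_gt0. Qed.
Let h_le1 : h <= 1. Proof. by rewrite invf_le1// ler1n. Qed.

Let hX_ge0 k : 0 <= h ^+ k. Proof. by rewrite exprn_ge0// ltW. Qed.
Let hX_le i j : (i <= j)%N -> h ^+ j <= h ^+ i.
Proof. by move=> ij; rewrite ler_wiXn2l// ltW. Qed.

Let hsum N : \sum_(a <- box N) h ^+ deg a <= 2 ^+ n.
Proof.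
rewrite big_image/= (_ : \sum_(_ in _) _ =
  \sum_(a : {ffun 'I_n -> 'I_N}) \prod_i h ^+ a i); last first.
  apply: eq_bigr => a _; rewrite -prodrXr.
  by apply: eq_bigr => i _; rewrite ffunE.
rewrite -(bigA_distr_bigA (fun _ (k : 'I_N) => h ^+ k)) prodr_const card_ord.
apply: lerXn2r; rewrite ?nnegrE ?sumr_ge0//.
have -> : \sum_(k < N) h ^+ k = 2 * (1 - h ^+ N).
  elim: N => [|N IH]; first by rewrite big_ord0 expr0 subrr mulr0.
  rewrite big_ord_recr/= IH exprS !mulrBr mulrA mulfV ?pnatr_eq0// mul1r.
  by rewrite [_ * h ^+ N]mulr_natl mulr2n opprD -!addrA addNr addr0.
by rewrite ger_pMr// gerDl oppr_le0.
Qed.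

Let conv c d g : C :=
  \sum_(a <- box (deg g).+1 | le a g) c a * d (sub g a).

Let conv_box c d g N : g \in box N ->
  conv c d g = \sum_(a <- box N | le a g) c a * d (sub g a).
Proof.
rewrite mem_box => /forallP gN; rewrite /conv -big_filter -[RHS]big_filter.
apply: perm_big; apply: uniq_perm; rewrite ?filter_uniq// => a.
rewrite !mem_filter; case: (boolP (le a g)) => //= /forallP ag.
rewrite !mem_box; apply/forallP/forallP => _ i.
  exact: leq_ltn_trans (ag i) (gN i).
by rewrite ltnS (leq_trans (ag i))// /deg (bigD1 i)//= leq_addr.
Qed.

Let ps_monomialD z a b :
  ps_monomial z (add a b) = ps_monomial z a * ps_monomial z b.
Proof.
by rewrite /ps_monomial -big_split; apply: eq_bigr => i _; rewrite ffunE exprD.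
Qed.

Let psum_conv c d z N : psum (conv c d) z N =
  \sum_(a <- box N) \sum_(b <- box N | add a b \in box N)
    (c a * ps_monomial z a) * (d b * ps_monomial z b).
Proof.
transitivity (\sum_(g <- box N) \sum_(a <- box N | le a g)
    c a * d (sub g a) * ps_monomial z g).
  rewrite psumE; apply: eq_big_seq => g gN.
  by rewrite (conv_box _ _ gN) mulr_suml.
rewrite (exchange_big_dep xpredT)//=; apply: eq_bigr => a _.
transitivity (\sum_(b <- [seq sub g a | g <- box N & le a g])
    (c a * ps_monomial z a) * (d b * ps_monomial z b)).
  rewrite [RHS]big_map [RHS]big_filter; apply: eq_bigr => g ag.
  by rewrite -{2}(addK ag) ps_monomialD mulrACA.
rewrite -[RHS]big_filter; apply: perm_big; apply: uniq_perm.
- rewrite map_inj_in_uniq ?filter_uniq// => g g'.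
  rewrite !mem_filter => /andP[ag _] /andP[ag' _] gg'.
  by rewrite -(addK ag) -(addK ag') gg'.
- by rewrite filter_uniq.
move=> b; rewrite mem_filter; apply/mapP/andP => [[g]|[abN bN]].
  rewrite mem_filter => /andP[ag gN] ->; rewrite addK//; split=> //.
  move: gN; rewrite !mem_box => /forallP gN; apply/forallP => i.
  by rewrite ffunE (leq_ltn_trans _ (gN i))// leq_subr.
exists (add a b); first rewrite mem_filter abN andbT.
  by apply/forallP => i; rewrite ffunE leq_addr.
by apply/ffunP => i; rewrite !ffunE addKn.
Qed.

Let psum_conv_dist c d z N (M L : C) : 0 <= M -> 0 <= L ->
  (forall a, `|c a * ps_monomial z a| <= M * h ^+ (deg a + deg a)) ->
  (forall a, `|d a * ps_monomial z a| <= L * h ^+ (deg a + deg a)) ->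
  `|psum c z N * psum d z N - psum (conv c d) z N| <=
    M * L * (2 ^+ n * 2 ^+ n) * h ^+ N.
Proof.
move=> M0 L0 cM dL.
have -> : psum c z N * psum d z N - psum (conv c d) z N =
  \sum_(a <- box N) \sum_(b <- box N | add a b \notin box N)
    (c a * ps_monomial z a) * (d b * ps_monomial z b).
  rewrite psum_conv !psumE mulr_suml -sumrB; apply: eq_bigr => a _.
  rewrite mulr_sumr (bigID (fun b => add a b \in box N))/=.
  by rewrite addrC addrK.
apply: (@le_trans _ _ (\sum_(a <- box N) \sum_(b <- box N)
    (M * L * h ^+ N) * (h ^+ deg a * h ^+ deg b))).
  apply: le_trans (ler_norm_sum _ _ _) _; apply: ler_sum => a _.
  apply: le_trans (ler_norm_sum _ _ _) _.
  rewrite [leLHS]big_mkcond; apply: ler_sum => b _.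
  case: ifPn => [abN|_]; last by rewrite !mulr_ge0.
  rewrite normrM; apply: le_trans (ler_pM _ _ (cM a) (dL b)) _ => //.
  rewrite mulrACA -!mulrA ler_wpM2l// ler_wpM2l// -!exprD hX_le//.
  rewrite addnACA leq_add2r -deg_add.
  move: abN; rewrite mem_box negb_forall => /existsP[k]; rewrite -leqNgt => Nk.
  by rewrite (leq_trans Nk)// /deg [leqRHS](bigD1 k)//= leq_addr.
under eq_bigr do rewrite -mulr_sumr -mulr_sumr.
rewrite -mulr_sumr -mulr_suml mulrAC ler_wpM2r//.
rewrite ler_wpM2l ?mulr_ge0//; apply: ler_pM => //; exact: sumr_ge0.
Qed.

Lemma holM (f k : 'rV[C]_n -> C) p : h ^+ N @[N --> \oo] --> (0 : C) ->
  hol_at f p -> hol_at k p -> hol_at (fun z => f z * k z) p.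
Proof.
move=> h0 [c [r [M fc]]] [d [s [L kd]]].
have [r0 _ _] := fc; have [s0 _ _] := kd.
have [u [u0 ur us]] := common_radius r0 s0.
have [_ cM cf] := pseries_shrink u0 ur fc.
have [_ dL dk] := pseries_shrink u0 us kd.
have M0 : 0 <= M.
  by apply: le_trans (cM [ffun=> 0%N]); rewrite mulr_ge0 ?exprn_ge0 // ltW.
have L0 : 0 <= L.
  by apply: le_trans (dL [ffun=> 0%N]); rewrite mulr_ge0 ?exprn_ge0 // ltW.
have u0' := ltW u0.
have hu : u * h ^+ 2 <= u by rewrite ger_pMr// exprn_ile1// ltW.
have est (e : mindex -> C) (K : C) : (forall a, `|e a| * u ^+ deg a <= K) ->
    forall z : 'rV[C]_n, (forall i, `|z 0 i| < u * h ^+ 2) ->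
    forall a, `|e a * ps_monomial z a| <= K * h ^+ (deg a + deg a).
  move=> eK z zu a; rewrite normrM addnn -mul2n exprM.
  apply: (@le_trans _ _ (`|e a| * (u * h ^+ 2) ^+ deg a)).
    rewrite ler_wpM2l// /ps_monomial normr_prod -prodrXr ler_prod// => i _.
    by rewrite normrX exprn_ge0//= lerXn2r// ?nnegrE ?mulr_ge0// ltW.
  by rewrite exprMn mulrA ler_wpM2r// exprn_ge0.
exists (conv c d), (u * h ^+ 2), (M * L * 2 ^+ n); split.
- by rewrite mulr_gt0// exprn_gt0.
- move=> g; rewrite -/(deg g) exprMn -exprM.
  apply: (@le_trans _ _ (\sum_(a <- box (deg g).+1) M * L * h ^+ deg a)).
    apply: (@le_trans _ _ (\sum_(a <- box (deg g).+1 | le a g)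
      `|c a * d (sub g a)| * (u ^+ deg g * h ^+ (2 * deg g)))).
      by rewrite -mulr_suml ler_wpM2r ?ler_norm_sum ?mulr_ge0 ?exprn_ge0.
    rewrite [leLHS]big_mkcond; apply: ler_sum => a _.
    case: ifPn => [ag|_]; last by rewrite !mulr_ge0.
    have dg : deg g = (deg a + deg (sub g a))%N by rewrite -deg_add addK.
    rewrite mulrA ler_pM ?mulr_ge0 ?exprn_ge0//.
      by rewrite normrM dg exprD mulrACA ler_pM ?mulr_ge0 ?exprn_ge0//.
    by rewrite hX_le// dg mul2n -addnn -addnA leq_addr.
  by rewrite -mulr_sumr ler_wpM2l ?mulr_ge0.
move=> z zu.
have zu' i : `|z 0 i| < u by exact: lt_le_trans (zu i) hu.
set K := M * L * (2 ^+ n * 2 ^+ n).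
have dist N := psum_conv_dist N M0 L0 (est _ _ cM z zu) (est _ _ dL z zu).
rewrite [X in X @ _](_ : _ = fun N => psum c z N * psum d z N -
  (psum c z N * psum d z N - psum (conv c d) z N)); last first.
  by apply/funext => N; rewrite opprB addrC subrK.
rewrite -[X in _ --> X]subr0; apply: cvgB.
  exact: cvgM (cf z zu') (dk z zu').
have K0 : K * h ^+ N @[N --> \oo] --> (0 : C).
  by rewrite -[X in _ --> X](mulr0 K); apply: cvgM h0; exact: cvg_cst.
apply/cvgr0Pnorm_lt => e e0; have /cvgr0Pnorm_lt/(_ _ e0) := K0.
apply: filterS => N; apply: le_lt_trans; apply: le_trans (dist N) _.
by rewrite ger0_norm// !mulr_ge0// exprn_ge0.
Qed.

End Product.

Lemma half_cvg0 (R : realType) :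
  (2^-1 : Cplx R) ^+ N @[N --> \oo] --> (0 : Cplx R).
Proof.
apply/cvgr0Pnorm_lt => -[x y]; rewrite /Cplx ltcE/= => /andP[/eqP -> x0].
have : (2^-1 : R) ^+ N @[N --> \oo] --> (0 : R).
  by apply: cvg_expr; rewrite ger0_norm ?invr_ge0// invf_lt1// ltr1n.
move=> /cvgr0Pnorm_lt/(_ _ x0); apply: filterS => N.
rewrite ger0_norm ?exprn_ge0 ?invr_ge0// => hx.
have -> : (2^-1 : R[i]) ^+ N = ((2^-1 : R) ^+ N)%:C%C.
  by rewrite rmorphXn/= fmorphV rmorph_nat.
rewrite ger0_norm ?ler0c ?exprn_ge0 ?invr_ge0//.
by rewrite ltcE/= eqxx.
Qed.

Section Flatness.
Variables (A B : comNzRingType) (phi : {rmorphism A -> B}).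

(* [B] is seen as an A-module through [phi]. *)
Definition bilinear_over (N P : lmodType A) (t : B -> N -> P) : Prop :=
  [/\ forall b b' n, t (b + b') n = t b n + t b' n,
      forall b n n', t b (n + n') = t b n + t b n',
      forall a b n, t (phi a * b) n = a *: t b n
    & forall a b n, t b (a *: n) = a *: t b n].

Definition is_tensor (N T : lmodType A) (t : B -> N -> T) : Prop :=
  bilinear_over t /\
  forall (P : lmodType A) (s : B -> N -> P), bilinear_over s ->
    (exists h : {linear T -> P}, forall b n, h (t b n) = s b n) /\
    (forall h h' : {linear T -> P},
       (forall b n, h (t b n) = h' (t b n)) -> h =1 h').

Definition flat_algebra : Prop :=
  forall (N N' : lmodType A) (u : {linear N -> N'}), injective u ->
  forall (T T' : lmodType A) (t : B -> N -> T) (t' : B -> N' -> T'),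
    is_tensor t -> is_tensor t' ->
  forall w : {linear T -> T'}, (forall b n, w (t b n) = t' b (u n)) ->
    injective w.
End Flatness.

Set Strict Implicit.

Section HolomorphicFunctions.
Variables (R : realType) (n : nat).
Local Notation C := (Cplx R).

Definition is_hol : {pred ('rV[C]_n -> C)} := fun f => `[< hol_at f 0 >].

Lemma is_hol_subring : subring_closed is_hol.
Proof.
split=> [|f g /asboolP hf /asboolP hg|f g /asboolP hf /asboolP hg].
- by apply/asboolP; exact: hol_cst.
- by apply/asboolP; exact: holB.
- by apply/asboolP; apply: holM => //; exact: half_cvg0.
Qed.

HB.instance Definition _ :=
  GRing.isSubringClosed.Build ('rV[C]_n -> C) is_hol is_hol_subring.

(* The functions on C^n that are holomorphic at 0.  They are not identified
   when they agree near 0; instead, [ideal_gen] contains the functions that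
   vanish near 0. *)
Record hfun := HFun { hval :> 'rV[C]_n -> C; hvalP : hval \in is_hol }.

HB.instance Definition _ := [isSub for hval].
HB.instance Definition _ := [Choice of hfun by <:].
HB.instance Definition _ := [SubChoice_isSubComNzRing of hfun by <:].

Definition ideal_gen (E : set hfun) : set ('rV[C]_n -> C) :=
  [set f | exists k (a e : 'I_k -> hfun), (forall i, E (e i)) /\
             \forall z \near (0 : 'rV[C]_n), f z = \sum_i a i z * e i z].

End HolomorphicFunctions.

(* The germ at 0 of the subspace of C^edim defined by the equations [eqs].
   Infinitely many equations are harmless, convergent power series rings being
   Noetherian. *)
Record germ (R : realType) := Germ {
  edim : nat;
  eqs : set (hfun R edim);
  eqs0 : forall e, eqs e -> e 0 = 0
}.

Section LocalRing.
Variables (R : realType) (X : germ R).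
Local Notation C := (Cplx R).

Definition germ_ideal : set ('rV[C]_(edim X) -> C) := ideal_gen (eqs X).

Definition in_germ_ideal : {pred hfun R (edim X)} :=
  fun f => `[< germ_ideal f >].

Lemma in_germ_ideal_closed : idealr_closed in_germ_ideal.
Proof.
split.
- apply/asboolP; exists 0%N, (fun=> 0), (fun=> 0).
  by split=> [[]//|]; near=> z; rewrite big_ord0.
- apply/negP => /asboolP[k [a [e [eX]]]].
  move=> /nbhs_singleton; rewrite big1 => [|i _]; last first.
    by rewrite (eqs0 _ _ (eX i)) mulr0.
  by move/eqP; rewrite oner_eq0.
- move=> h f g /asboolP[k [a [e [eX fE]]]] /asboolP[l [b [d [dX gE]]]].
  apply/asboolP; exists (k + l)%N.
  exists (fun i =>
    match fintype.split i with inl j => h * a j | inr j => b j end).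
  exists (fun i => match fintype.split i with inl j => e j | inr j => d j end).
  split=> [i|]; first by case: (fintype.split i).
  near=> z; rewrite big_split_ord/=.
  under [X in _ = X + _]eq_bigr => i _.
    by rewrite (unsplitK (inl i)) -[(h * a i) z]/(h z * a i z) -mulrA; over.
  under [X in _ = _ + X]eq_bigr do rewrite (unsplitK (inr _)).
  rewrite -mulr_sumr -[LHS]/(h z * f z + g z).
  by congr (_ * _ + _); [near: z; exact: fE | near: z; exact: gE].
Unshelve. all: by end_near. Qed.

HB.instance Definition _ :=
  isIdealr.Build (hfun R (edim X)) in_germ_ideal in_germ_ideal_closed.

Definition local_ring : comNzRingType := {ideal_quot in_germ_ideal}.

Definition germ_class (f : hfun R (edim X)) : local_ring :=
  (\pi_{ideal_quot in_germ_ideal} f)%qT.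

End LocalRing.

Section Morphisms.
Variable R : realType.
Local Notation C := (Cplx R).
Implicit Types (X Y Z S T : germ R).

Definition hol_map_at n m (F : 'rV[C]_n -> 'rV[C]_m) (p : 'rV[C]_n) : Prop :=
  forall j, hol_at (fun z => F z 0 j) p.

(* [F] is a germ of holomorphic maps of the ambient spaces that pulls the
   ideal of [Y] back into the ideal of [X]. *)
Definition is_mor X Y (F : 'rV[C]_(edim X) -> 'rV[C]_(edim Y)) : Prop :=
  [/\ hol_map_at F 0, F 0 = 0 & forall e, eqs Y e -> germ_ideal X (e \o F)].

(* [F] and [F'] induce the same morphism into any germ in C^m, i.e. the same
   homomorphism of local rings. *)
Definition eq_mor X m (F F' : 'rV[C]_(edim X) -> 'rV[C]_m) : Prop :=
  forall f : hfun R m, germ_ideal X (fun z => f (F z) - f (F' z)).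

Definition is_iso X Y (F : 'rV[C]_(edim X) -> 'rV[C]_(edim Y)) : Prop :=
  is_mor X Y F /\ exists F' : 'rV[C]_(edim Y) -> 'rV[C]_(edim X),
    [/\ is_mor Y X F', eq_mor X (F' \o F) id & eq_mor Y (F \o F') id].

Definition affine (n : nat) : germ R :=
  @Germ R n set0 (fun e (h : set0 e) => False_ind _ h).

Definition smooth X : Prop :=
  exists n (F : 'rV[C]_(edim (affine n)) -> 'rV[C]_(edim X)),
    is_iso (affine n) X F.

Definition is_pullback (P X Y S : germ R)
    (pX : 'rV[C]_(edim P) -> 'rV[C]_(edim X))
    (pY : 'rV[C]_(edim P) -> 'rV[C]_(edim Y))
    (f : 'rV[C]_(edim X) -> 'rV[C]_(edim S))
    (g : 'rV[C]_(edim Y) -> 'rV[C]_(edim S)) : Prop :=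
  [/\ is_mor P X pX, is_mor P Y pY, eq_mor P (f \o pX) (g \o pY)
    & forall Z (u : 'rV[C]_(edim Z) -> 'rV[C]_(edim X))
               (v : 'rV[C]_(edim Z) -> 'rV[C]_(edim Y)),
        is_mor Z X u -> is_mor Z Y v -> eq_mor Z (f \o u) (g \o v) ->
        (exists w : 'rV[C]_(edim Z) -> 'rV[C]_(edim P),
           [/\ is_mor Z P w, eq_mor Z (pX \o w) u & eq_mor Z (pY \o w) v]) /\
        (forall w w' : 'rV[C]_(edim Z) -> 'rV[C]_(edim P),
           is_mor Z P w -> is_mor Z P w' ->
           eq_mor Z (pX \o w) (pX \o w') -> eq_mor Z (pY \o w) (pY \o w') ->
           eq_mor Z w w')].

Definition flat_mor X S (F : 'rV[C]_(edim X) -> 'rV[C]_(edim S)) : Prop :=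
  exists phi : {rmorphism local_ring S -> local_ring X},
    (forall f : hfun R (edim S), exists2 g : hfun R (edim X),
        forall z, g z = f (F z) & phi (germ_class S f) = germ_class X g) /\
    flat_algebra phi.

(* The Zariski tangent space of [X], as a subspace of the ambient C^(edim X);
   the differential of a morphism is the restriction of the differential of the
   ambient map. *)
Definition tangent_space X : set 'rV[C]_(edim X) :=
  [set v | forall e, eqs X e -> 'D_v e 0 = 0].

Definition same_differential T S
    (phi phi' : 'rV[C]_(edim T) -> 'rV[C]_(edim S)) : Prop :=
  forall v, tangent_space T v -> 'D_v phi 0 = 'D_v phi' 0.

End Morphisms.

Section Deformations.
Variable R : realType.
Local Notation C := (Cplx R).
Implicit Types (X S T : germ R).

(* The underlying data of a deformation; see [is_deformation]. *)
Record predeformation X S := Predeformation {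
  total_space : germ R;
  def_proj : 'rV[C]_(edim total_space) -> 'rV[C]_(edim S);
  def_incl : 'rV[C]_(edim X) -> 'rV[C]_(edim total_space)
}.

(* The last clause identifies [X] with the fibre of [def_proj xi] over the
   closed point 0 of [S]. *)
Definition is_deformation X S (xi : predeformation X S) : Prop :=
  [/\ is_mor (total_space xi) S (def_proj xi),
      flat_mor (total_space xi) S (def_proj xi)
    & is_pullback X (total_space xi) (affine R 0) S
        (def_incl xi) (fun=> 0) (def_proj xi) (fun=> 0)].

Definition deformation_iso X S (xi xi' : predeformation X S) : Prop :=
  exists h : 'rV[C]_(edim (total_space xi)) -> 'rV[C]_(edim (total_space xi')),
    [/\ is_iso (total_space xi) (total_space xi') h,
        eq_mor (total_space xi) (def_proj xi' \o h) (def_proj xi)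
      & eq_mor X (h \o def_incl xi) (def_incl xi')].

(* [psi], together with the projection of [rho], identifies [rho] with the
   pullback of [xi] by [phi], compatibly with the inclusions of [X]. *)
Definition pullback_of X S T
    (xi : predeformation X S) (rho : predeformation X T)
    (phi : 'rV[C]_(edim T) -> 'rV[C]_(edim S))
    (psi : 'rV[C]_(edim (total_space rho)) ->
           'rV[C]_(edim (total_space xi))) : Prop :=
  [/\ is_mor T S phi,
      is_pullback (total_space rho) (total_space xi) T S
        psi (def_proj rho) (def_proj xi) phi
    & eq_mor X (psi \o def_incl rho) (def_incl xi)].

Definition induced_by X S T
    (xi : predeformation X S) (rho : predeformation X T)
    (phi : 'rV[C]_(edim T) -> 'rV[C]_(edim S)) : Prop :=
  exists psi, pullback_of xi rho phi psi.

Definition semi_universal X S (xi : predeformation X S) : Prop :=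
  is_deformation xi /\
  forall T (rho : predeformation X T), is_deformation rho ->
    exists phi, induced_by xi rho phi /\
      forall phi', induced_by xi rho phi' -> same_differential T S phi phi'.

(* Spec C[e_1, ..., e_d] / (e_1, ..., e_d)^2 *)
Definition fat_point_eqs (d : nat) : set (hfun R d) :=
  [set h | exists i j, forall z : 'rV[C]_d, h z = z 0 i * z 0 j].

Lemma fat_point_eqs0 d (h : hfun R d) : fat_point_eqs h -> h 0 = 0.
Proof. by move=> [i [j ->]]; rewrite !mxE mul0r. Qed.

Definition fat_point (d : nat) : germ R := 
  @Germ R d (@fat_point_eqs d) (@fat_point_eqs0 d).

Definition double_point : germ R := fat_point 1.

(* Its comorphism sends e_i to c_i e. *)
Definition T1_direction d (c : 'rV[C]_d)
    (t : 'rV[C]_(edim double_point)) : 'rV[C]_(edim (fat_point d)) :=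
  t 0 0 *: c.

(* The vector space structure of T^1.  The deformations over [fat_point d] are
   the d-tuples of deformations over [double_point], by restriction to the
   coordinate directions, and the class of the restriction to the direction
   [c] is the linear combination with coefficients [c]: c = (1, 1) is the
   addition and d = 1 is the multiplication by scalars. *)
Definition T1_lincomb X d (xi : 'I_d -> predeformation X double_point)
    (c : 'rV[C]_d) (eta : predeformation X double_point) : Prop :=
  exists Xi : predeformation X (fat_point d),
    [/\ is_deformation Xi,
        forall i, induced_by Xi (xi i) (T1_direction (delta_mx 0 i))
      & induced_by Xi eta (T1_direction c)].

Definition T1_finite_dim X : Prop :=
  exists d (xi : 'I_d -> predeformation X double_point),
    (forall i, is_deformation (xi i)) /\
    forall eta : predeformation X double_point, is_deformation eta ->
      exists c, T1_lincomb xi c eta.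

End Deformations.

HB.structure Definition TopGroup := {G of Topological G & Group G}.

Section LieGroups.
Variable R : realType.
Local Notation C := (Cplx R).

Record chart (M : topologicalType) (d : nat) := Chart {
  chart_dom : set M;
  chart_map : M -> 'rV[C]_d;
  chart_inv : 'rV[C]_d -> M;
  chart_dom_open : open chart_dom;
  chart_map_open : open (chart_map @` chart_dom);
  chart_mapK : forall x, chart_dom x -> chart_inv (chart_map x) = x;
  chart_map_continuous : forall x, chart_dom x ->
    {for x, continuous chart_map};
  chart_inv_continuous : forall x, chart_dom x ->
    {for chart_map x, continuous chart_inv}
}.

Record complex_lie_group := ComplexLieGroup {
  lie_sort :> TopGroup.type;
  lie_dim : nat;
  atlas : set (chart lie_sort lie_dim);
  lie_hausdorff : hausdorff_space lie_sort;
  atlas_cover : forall x, exists2 k, atlas k & chart_dom k x;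
  atlas_hol : forall k l x, atlas k -> atlas l ->
    chart_dom k x -> chart_dom l x ->
    hol_map_at (chart_map l \o chart_inv k) (chart_map k x);
  mul_continuous :
    continuous (fun p : lie_sort * lie_sort => (p.1 * p.2)%g);
  inv_continuous : continuous (fun x : lie_sort => x^-1%g);
  mul_hol : forall k l m x y, atlas k -> atlas l -> atlas m ->
    chart_dom k x -> chart_dom l y -> chart_dom m (x * y)%g ->
    hol_map_at
      (fun w : 'rV[C]_(lie_dim + lie_dim) =>
         chart_map m (chart_inv k (lsubmx w) * chart_inv l (rsubmx w))%g)
      (row_mx (chart_map k x) (chart_map l y));
  inv_hol : forall k l x, atlas k -> atlas l ->
    chart_dom k x -> chart_dom l x^-1%g ->
    hol_map_at (fun w => chart_map l (chart_inv k w)^-1%g) (chart_map k x)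
}.

(* The product (C^d, 0) x X *)
Definition cylinder_eqs d (X : germ R) : set (hfun R (d + edim X)) :=
  [set h | exists2 e, eqs X e &
    forall w : 'rV[C]_(d + edim X), h w = e (rsubmx w)].

Lemma cylinder_eqs0 d (X : germ R) (h : hfun R (d + edim X)) :
  cylinder_eqs d X h -> h 0 = 0.
Proof. by move=> [e eX ->]; rewrite linear0 (eqs0 _ _ eX). Qed.

Definition cylinder d (X : germ R) : germ R :=
  @Germ R (d + edim X) (@cylinder_eqs d X) (@cylinder_eqs0 d X).

Variable G : complex_lie_group.

(* [act_map_hol]: the maps [act_map g] are the restrictions to the slices
   {g} x X of a morphism G x X -> X along G x {0}; [Phi] is the germ of this
   morphism at (g0, 0), in the chart [k]. *)
Record germ_action (X : germ R) := Action {
  act_map :> G -> 'rV[C]_(edim X) -> 'rV[C]_(edim X);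
  act_map_mor : forall g, is_mor X X (act_map g);
  act_map1 : eq_mor X (act_map 1%g) id;
  act_mapM : forall g h, eq_mor X (act_map (g * h)%g) (act_map g \o act_map h);
  act_map_hol : forall k g0, atlas G k -> chart_dom k g0 ->
    exists Phi : 'rV[C]_(lie_dim G + edim X) -> 'rV[C]_(edim X),
      is_mor (cylinder (lie_dim G) X) X Phi /\
      \forall g \near g0,
        eq_mor X (act_map g)
          (fun z => Phi (row_mx (chart_map k g - chart_map k g0) z))
}.

(* The subgerm fixed by G, cut out by the equations g . z = z. *)
Definition fixed_eqs (X : germ R) (a : germ_action X) : set (hfun R (edim X)) :=
  eqs X `|` [set h | exists g j,
    forall z : 'rV[C]_(edim X), h z = a g z 0 j - z 0 j].

Lemma fixed_eqs0 X (a : germ_action X) (h : hfun R (edim X)) :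
  fixed_eqs a h -> h 0 = 0.
Proof.
move=> [/(eqs0 _ _)//|[g [j ->]]].
by have [_ -> _] := act_map_mor a g; rewrite subrr.
Qed.

Definition fixed_germ (X : germ R) (a : germ_action X) : germ R :=
  @Germ R (edim X) (@fixed_eqs X a) (@fixed_eqs0 X a).

Definition twist (X S : germ R) (a : germ_action X) (g : G)
    (xi : predeformation X S) : predeformation X S :=
  @Predeformation R X S (total_space xi) (def_proj xi)
    (def_incl xi \o a g^-1%g).

Definition trivial_on_T1 (X : germ R) (a : germ_action X) : Prop :=
  forall (xi : predeformation X (double_point R)) (g : G), is_deformation xi ->
    deformation_iso (twist a g xi) xi.

Definition extends_action (X S : germ R) (a : germ_action X)
    (xi : predeformation X S) (b : germ_action (total_space xi)) : Prop :=
  forall g, eq_mor X (b g \o def_incl xi) (def_incl xi \o a g).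

Definition equivariant_deformation (X S : germ R) (a : germ_action X)
    (xi : predeformation X S) (b : germ_action (total_space xi))
    (c : germ_action S) : Prop :=
  [/\ is_deformation xi, extends_action a xi b
    & forall g,
        eq_mor (total_space xi) (def_proj xi \o b g) (c g \o def_proj xi)].

Definition equivariantly_induced_by (X S T : germ R)
    (xi : predeformation X S) (b : germ_action (total_space xi))
    (c : germ_action S)
    (rho : predeformation X T) (b' : germ_action (total_space rho))
    (c' : germ_action T)
    (phi : 'rV[C]_(edim T) -> 'rV[C]_(edim S)) : Prop :=
  (forall g, eq_mor T (phi \o c' g) (c g \o phi)) /\
  exists2 psi, pullback_of xi rho phi psi
    & forall g, eq_mor (total_space rho) (psi \o b' g) (b g \o psi).

Definition equivariantly_semi_universal (X S : germ R) (a : germ_action X)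
    (xi : predeformation X S) (b : germ_action (total_space xi))
    (c : germ_action S) : Prop :=
  [/\ semi_universal xi, equivariant_deformation a xi b c
    & forall T (rho : predeformation X T)
        (b' : germ_action (total_space rho)) (c' : germ_action T),
        equivariant_deformation a rho b' c' ->
        exists phi, equivariantly_induced_by xi b c rho b' c' phi /\
          forall phi', equivariantly_induced_by xi b c rho b' c' phi' ->
            same_differential T S phi phi'].

(* [b] lifts the trivial action on the base. *)
Definition fibrewise_action (X S : germ R) (xi : predeformation X S)
    (b : germ_action (total_space xi)) : Prop :=
  forall g, eq_mor (total_space xi) (def_proj xi \o b g) (def_proj xi).

End LieGroups.

(* Main.v *)
(* Let v be a tangent vector of S at 0.  Pulling xi back to the double point
   along v gives a deformation of X; as G acts trivially on T^1, it is induced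
   both by v and by its image under g, so that the uniqueness of the
   differentials forces dg(v) = v.  Hence S^G and S have the same tangent space.
   Smoothness yields a parametrization F : C^n -> S^G with a left inverse F', so
   the ideal J of S^G in the local ring of S is generated by the finitely many
   functions w_j - F(F'(w))_j; as J lies in m^2, one gets J = m J, and J = 0 by
   Nakayama's lemma.

   So G acts trivially on S, its action on the total space of xi is fibrewise,
   and it lifts to every pullback of xi, i.e. to every deformation.  What has to
   be proved is that the lifted action is again holomorphic in g: a function on
   C^d x Y all of whose slices {s} x Y vanish must vanish.  This follows from the
   Grauert-Hironaka division theorem, applied with s as a parameter: no exponent
   of the remainder is divisible by the leading exponent of an element of the
   ideal of Y, so the slices of the remainder can only belong to this ideal if
   they are zero. *)

(* Germs may be non-reduced, so equality of morphisms is equality modulo an ideal and cannot be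
   tested at points. This shapes the end of the proof: to lift the action holomorphically, the
   universal property of the pullback is applied to a cylinder, over which the required square is
   known to commute only slice by slice.

   The restriction of xi to the direction v must be a genuine deformation, flatness included. A
   nonzero v embeds the double point as a closed subgerm of S; the restriction is then cut out of
   the total space by further equations, and flatness has to be preserved only under base change
   along surjections of rings.

   Exponents are ordered by Goedel numbers because each exponent has finitely many predecessors, so
   that induction is available, and because the order can be read off from the values of the
   monomials at explicit points. Taking such a point as polyradius makes the tails of all divisors
   small at once.

   Series are summed unconditionally over arbitrary index sets, since products, compositions and
   slices of power series all regroup a sum along the fibres of a map. *)
Require Import Defs.
From HB Require Import structures.
From mathcomp Require Import all_boot all_order all_algebra complex.
From mathcomp Require Import all_classical all_reals all_analysis.
From mathcomp Require Import finmap summability.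
From mathcomp Require Import zify.

Set Implicit Arguments.
Unset Strict Implicit.
Unset Printing Implicit Defensive.

Import Order.TTheory GRing.Theory Num.Theory.
Import numFieldNormedType.Exports.

Local Open Scope classical_set_scope.
Local Open Scope ring_scope.

(** * Unconditional sums *)

#[local] Existing Instance totally_filter.

Section Sums.
Variable R : realType.
Local Notation C := (Cplx R).

(* These predicates are records in order to be rigid for conversion. *)
Record has_sum (I : choiceType) (f : I -> C) (v : C) : Prop := HasSum {
  has_sum_cvg : (fun A : {fset I} => \sum_(i <- A) f i) @ totally --> v }.

Record abs_le (I : choiceType) (f : I -> C) (M : C) : Prop := AbsLe {
  abs_leP : forall A : {fset I}, \sum_(i <- A) `|f i| <= M }.

Lemma has_sumP (I : choiceType) (f : I -> C) v : has_sum f v <->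
  forall e : C, 0 < e -> exists A0 : {fset I}, forall A : {fset I},
    (A0 `<=` A)%fset -> `|\sum_(i <- A) f i - v| < e.
Proof.
split=> [[fv] e e0|fv].
  have [A0 _ A0v] := (cvgrPdist_lt _ _).1 fv e e0.
  by exists A0 => A /A0v /=; rewrite distrC.
split; apply/cvgrPdist_lt => e /fv[A0 A0v]; exists A0 => // A /A0v /=.
by rewrite distrC.
Qed.

(** The order of [Cplx R] is only partial, hence the detour through norms, which are comparable: a
    limit of norm above M would force nearby values of norm above M. *)
Lemma cvg_norm_le (T : Type) (F : set_system T) (FF : ProperFilter F)
    (u : T -> C) (v M : C) : u @ F --> v -> (\forall x \near F, `|u x| <= M) ->
  `|v| <= M.
Proof.
move=> uv uM; have [x xM] := filter_ex uM.
have M0 : 0 <= M by apply: le_trans xM.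
rewrite real_leNgt ?ger0_real//; apply/negP => Mv.
have e0 : 0 < `|v| - M by rewrite subr_gt0.
have uve : \forall y \near F, `|v - u y| < `|v| - M.
  by move: e0; move: (`|v| - M); apply/cvgrPdist_lt.
have [y [yM]] := filter_ex (filterI uM uve).
apply/negP; rewrite -real_leNgt ?realB ?ger0_real//.
rewrite lerBlDr -lerBlDl; apply: le_trans yM.
by rewrite lerBlDl -lerBlDr; apply: le_trans (lerB_dist _ _).
Qed.

Lemma big_fset_mask (V : nmodType) (I : choiceType) (A0 A : {fset I})
    (F : I -> V) : (A0 `<=` A)%fset ->
  \sum_(i <- A0) F i = \sum_(i <- A) (if i \in A0 then F i else 0).
Proof.
move=> sA; rewrite -(big_fset_incl _ sA); last first.
  by move=> i _ /negbTE ->.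
by apply: eq_big_seq => i ->.
Qed.

(** The sum is the supremum of the finite partial sums; this is how the completeness of the reals
    enters. *)
Lemma cplx_complete_ge0 (I : choiceType) (f : I -> R) (M : R) :
  (forall i, 0 <= f i) -> (forall A : {fset I}, \sum_(i <- A) f i <= M) ->
  exists v : C, has_sum (fun i => (f i)%:C%C) v.
Proof.
move=> f0 fM; pose S := [set x | exists A : {fset I}, x = \sum_(i <- A) f i].
have hS : has_sup S.
  split; first by exists (\sum_(i <- (fset0 : {fset I})) f i), fset0.
  by exists M => x [A ->].
exists (sup S)%:C%C; apply/has_sumP => -[x y].
rewrite ltcE/= => /andP[/eqP -> x0].
have [_ [A0 ->] A0S] := sup_adherent x0 hS.
exists A0 => A sA; rewrite distrC -rmorph_sum -rmorphB/=.
have leA : \sum_(i <- A0) f i <= \sum_(i <- A) f i.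
  by rewrite (big_fset_mask _ sA) ler_sum// => i _; case: ifP.
have leS : \sum_(i <- A) f i <= sup S.
  by apply: ub_le_sup; [case: hS|exists A].
rewrite ger0_norm; last by rewrite ler0c subr_ge0.
by rewrite ltcR ltrBlDr -ltrBlDl (lt_le_trans A0S).
Qed.

Lemma eq_has_sum (I : choiceType) (f g : I -> C) v :
  f =1 g -> has_sum f v -> has_sum g v.
Proof. by move=> /funext ->. Qed.

Lemma has_sum_unique (I : choiceType) (f : I -> C) v w :
  has_sum f v -> has_sum f w -> v = w.
Proof.
by move=> [fv] [fw]; apply: (cvg_unique _ fv fw); exact: norm_hausdorff.
Qed.

Lemma has_sumD (I : choiceType) (f g : I -> C) v w :
  has_sum f v -> has_sum g w -> has_sum (fun i => f i + g i) (v + w).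
Proof.
move=> [fv] [gw]; split; under eq_fun do rewrite big_split/=.
exact: cvgD fv gw.
Qed.

Lemma has_sumZ (I : choiceType) (f : I -> C) k v :
  has_sum f v -> has_sum (fun i => k * f i) (k * v).
Proof.
move=> [fv]; split; under eq_fun do rewrite -mulr_sumr.
exact: cvgM (cvg_cst k) fv.
Qed.

Lemma has_sumN (I : choiceType) (f : I -> C) v :
  has_sum f v -> has_sum (fun i => - f i) (- v).
Proof.
move=> /(has_sumZ (-1)); rewrite mulN1r.
by apply: eq_has_sum => i; rewrite mulN1r.
Qed.

Lemma has_sum_finite (I : choiceType) (f : I -> C) (A : {fset I}) :
  (forall i, i \notin A -> f i = 0) -> has_sum f (\sum_(i <- A) f i).
Proof.
move=> fA; apply/has_sumP => e e0; exists A => B AB.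
by rewrite (big_fset_incl _ AB) ?subrr ?normr0// => i _; exact: fA.
Qed.

Lemma has_sum_single (I : choiceType) (f : I -> C) i0 :
  (forall i, i != i0 -> f i = 0) -> has_sum f (f i0).
Proof.
move=> fi0; have := @has_sum_finite _ f [fset i0]%fset.
by rewrite big_seq_fset1; apply => i; rewrite inE; exact: fi0.
Qed.

Lemma has_sum0 (I : choiceType) : has_sum (fun=> 0 : C) (0 : C) (I := I).
Proof.
by have := @has_sum_finite I (fun=> 0) fset0; rewrite big1//; apply.
Qed.

Lemma has_sum_norm_le (I : choiceType) (f : I -> C) v M :
  has_sum f v -> abs_le f M -> `|v| <= M.
Proof.
move=> [fv] [fM]; apply: cvg_norm_le fv _.
by apply: nearW => A; exact: le_trans (ler_norm_sum _ _ _) (fM A).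
Qed.

Lemma abs_le_sub (I : choiceType) (f g : I -> C) M :
  (forall i, `|g i| <= `|f i|) -> abs_le f M -> abs_le g M.
Proof. by move=> gf [fM]; split=> A; apply: le_trans (fM A); apply: ler_sum. Qed.

Lemma abs_le_ge0 (I : choiceType) (f : I -> C) M : abs_le f M -> 0 <= M.
Proof. by move=> [/(_ fset0)]; rewrite big_seq_fset0. Qed.

Lemma abs_le_trans (I : choiceType) (f : I -> C) M L :
  M <= L -> abs_le f M -> abs_le f L.
Proof. by move=> ML [fM]; split=> A; exact: le_trans (fM A) ML. Qed.

Lemma abs_le_term (I : choiceType) (f : I -> C) M i : abs_le f M -> `|f i| <= M.
Proof. by move=> [/(_ [fset i]%fset)]; rewrite big_seq_fset1. Qed.

Lemma abs_leD (I : choiceType) (f g : I -> C) M L :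
  abs_le f M -> abs_le g L -> abs_le (fun i => f i + g i) (M + L).
Proof.
move=> [fM] [gL]; split=> A; apply: le_trans (lerD (fM A) (gL A)).
by rewrite -big_split/=; apply: ler_sum => i _; exact: ler_normD.
Qed.

Lemma abs_leZ (I : choiceType) (f : I -> C) k M :
  abs_le f M -> abs_le (fun i => k * f i) (`|k| * M).
Proof.
move=> [fM]; split=> A; under eq_bigr do rewrite normrM.
by rewrite -mulr_sumr ler_wpM2l.
Qed.

Lemma abs_le_seq (I : choiceType) (f : I -> C) M (s : seq I) :
  abs_le f M -> uniq s -> \sum_(i <- s) `|f i| <= M.
Proof.
move=> [fM] us; apply: le_trans (fM [fset i in s]%fset).
rewrite le_eqVlt; apply/orP; left; apply/eqP; apply: perm_big.
by apply: uniq_perm => // i; rewrite in_fset_/=.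
Qed.

(** The real and imaginary parts of f are split into positive and negative parts, each dominated by
    the norm of f and therefore summable. *)
Lemma has_sum_ex (I : choiceType) (f : I -> C) M :
  abs_le f M -> exists v, has_sum f v.
Proof.
move=> [fM].
have part (g : I -> R) : (forall i, 0 <= g i) ->
    (forall i, (g i)%:C%C <= `|f i|) ->
    exists v : C, has_sum (fun i => (g i)%:C%C) v.
  move=> g0 gf; apply: (@cplx_complete_ge0 _ _ (complex.Re M)) => // A.
  have := le_trans (ler_sum _ (fun i _ => gf i)) (fM A).
  by rewrite -rmorph_sum/= lecE/= => /andP[].
have Rf i : (`|complex.Re (f i)|)%:C%C <= `|f i| by exact: normc_ge_Re.
have If i : (`|complex.Im (f i)|)%:C%C <= `|f i|.
  have := @normc_ge_Re _ (f i * 'i%C).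
  rewrite ReiNIm normrN normrM (_ : `|'i%C| = 1 :> R[i]) ?mulr1//.
  by rewrite normc_def/= expr0n expr1n add0r sqrtr1.
have half (h : I -> R) : (forall i, (`|h i|)%:C%C <= `|f i|) ->
    exists v : C, has_sum (fun i => (h i)%:C%C) v.
  move=> hf.
  have [||v hv] := part (fun i => Num.max (h i) 0).
  - by move=> i; rewrite le_max lexx orbT.
  - move=> i; apply: le_trans (hf i); rewrite lecR ge_max normr_ge0 andbT.
    exact: ler_norm.
  have [||w hw] := part (fun i => Num.max (- h i) 0).
  - by move=> i; rewrite le_max lexx orbT.
  - move=> i; apply: le_trans (hf i); rewrite lecR ge_max normr_ge0 andbT.
    by rewrite -normrN ler_norm.
  exists (v - w); apply: eq_has_sum (has_sumD hv (has_sumN hw)) => i /=.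
  rewrite -rmorphB/=; congr (_%:C%C); case: (leP 0 (h i)) => h0.
    by rewrite max_r ?oppr_le0// subr0.
  by rewrite max_l ?oppr_ge0 ?ltW// sub0r opprK.
have [v hv] := half _ Rf; have [w hw] := half _ If.
exists (v + 'i%C * w); apply: eq_has_sum (has_sumD hv (has_sumZ ('i%C) hw)) => i.
by rewrite [RHS]complexE.
Qed.

Lemma cvg_sum_seq (T : Type) (F : set_system T) (FF : Filter F) (U : Type)
    (s : seq U) (u : U -> T -> C) (v : U -> C) :
  (forall i, u i @ F --> v i) ->
  (fun x => \sum_(i <- s) u i x) @ F --> \sum_(i <- s) v i.
Proof.
move=> uv; elim: s => [|i s IH].
  rewrite big_nil; under eq_fun do rewrite big_nil; exact: cvg_cst.
rewrite big_cons; under eq_fun do rewrite big_cons.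
exact: cvgD (uv i) IH.
Qed.

Lemma sum_fibres (V : nmodType) (I U : choiceType) (p : I -> U) (f : I -> V)
    (A : seq I) (B : seq U) : uniq B ->
  \sum_(u <- B) \sum_(i <- A) (if p i == u then f i else 0) =
  \sum_(i <- A) (if p i \in B then f i else 0).
Proof.
move=> uB; rewrite exchange_big/=; apply: eq_bigr => i _.
rewrite -big_mkcond/=; case: ifPn => iB.
  rewrite (eq_bigl (pred1 (p i))); last by move=> u; rewrite /= eq_sym.
  by rewrite -big_filter filter_pred1_uniq// big_seq1.
rewrite big1_seq// => u /andP[/eqP piu uB'].
by rewrite piu uB' in iB.
Qed.

(** Summation along the fibres of p. Once the finite set B contains the image of a good set A0, the
    sum of g over B is a limit of sums of f over finite sets containing A0, namely the parts of A
    lying over B. Passing to the limit only preserves a weak inequality, whence e / 2. *)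
Lemma has_sum_sigma (I U : choiceType) (p : I -> U) (f : I -> C) v
    (g : U -> C) :
  has_sum f v ->
  (forall u, has_sum (fun i => if p i == u then f i else 0) (g u)) ->
  has_sum g v.
Proof.
move=> /has_sumP fv fg; apply/has_sumP => e e0.
have e20 : 0 < e / 2 by rewrite divr_gt0.
have [A0 A0v] := fv _ e20.
exists [fset p i | i in A0]%fset => B sB.
apply: (@le_lt_trans _ _ (e / 2)); last by rewrite ltr_pdivrMr// ltr_pMr// ltr1n.
apply: (@cvg_norm_le _ totally _ (fun A : {fset I} =>
  \sum_(u <- B) \sum_(i <- A) (if p i == u then f i else 0) - v)).
  apply: cvgB; last exact: cvg_cst.
  by apply: cvg_sum_seq => u; case: (fg u).
exists A0 => // A /= sA; rewrite sum_fibres ?fset_uniq//.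
rewrite (_ : \sum_(i <- A) _ = \sum_(i <- [fset i in A | p i \in B]%fset) f i).
  apply/ltW/A0v/fsubsetP => i iA0; rewrite !inE/= (fsubsetP sA)//=.
  by apply/(fsubsetP sB)/imfsetP; exists i.
have sAA : ([fset i in A | p i \in B] `<=` A)%fset.
  by apply/fsubsetP => i; rewrite !inE => /andP[].
rewrite (big_fset_mask _ sAA); apply: eq_big_seq => i iA.
by rewrite !inE iA.
Qed.

Lemma abs_le_sigma (I U : choiceType) (p : I -> U) (f : I -> C) M
    (g : U -> C) :
  abs_le f M ->
  (forall u, has_sum (fun i => if p i == u then f i else 0) (g u)) ->
  abs_le g M.
Proof.
move=> [fM] fg; split=> B; rewrite -[leLHS]ger0_norm ?sumr_ge0//.
apply: (@cvg_norm_le _ totally _ (fun A : {fset I} =>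
  \sum_(u <- B) `|\sum_(i <- A) (if p i == u then f i else 0)|)).
  by apply: cvg_sum_seq => u; apply: cvg_norm; case: (fg u).
apply: nearW => A; rewrite ger0_norm ?sumr_ge0//.
apply: le_trans (fM A).
apply: (@le_trans _ _ (\sum_(u <- B) \sum_(i <- A)
   (if p i == u then `|f i| else 0))).
  apply: ler_sum => u _; apply: le_trans (ler_norm_sum _ _ _) _.
  by apply: ler_sum => i _; case: ifP; rewrite ?normr0.
by rewrite sum_fibres ?fset_uniq//; apply: ler_sum => i _; case: ifP.
Qed.

(** Reindexing is the case of regrouping in which every fibre has at most one element. *)
Lemma has_sum_fibre_inj (I J : choiceType) (e : J -> I) (f : I -> C) i :
  injective e -> (forall i, (forall j, e j != i) -> f i = 0) ->
  has_sum (fun j => if e j == i then f (e j) else 0) (f i).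
Proof.
move=> e_inj f0; have [[j eji]|nj] := pselect (exists j, e j = i).
  rewrite -eji.
  have := @has_sum_single _ (fun j' => if e j' == e j then f (e j') else 0) j.
  rewrite eqxx; apply=> j' j'j.
  by rewrite ifN// (inj_eq e_inj).
have ne j : e j != i by apply/eqP => eji; apply: nj; exists j.
rewrite (f0 i ne); apply: eq_has_sum (@has_sum0 J) => j.
by rewrite (negbTE (ne j)).
Qed.

Lemma has_sum_reindex (I J : choiceType) (e : J -> I) (f : I -> C) v :
  injective e -> (forall i, (forall j, e j != i) -> f i = 0) ->
  has_sum (f \o e) v -> has_sum f v.
Proof.
move=> e_inj f0 fv; apply: (has_sum_sigma (p := e) fv) => i.
exact: has_sum_fibre_inj.
Qed.

Lemma abs_le_extend (I J : choiceType) (e : J -> I) (f : I -> C) M :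
  injective e -> (forall i, (forall j, e j != i) -> f i = 0) ->
  abs_le (f \o e) M -> abs_le f M.
Proof.
move=> e_inj f0 fM; apply: (abs_le_sigma (p := e) fM) => i.
exact: has_sum_fibre_inj.
Qed.

Lemma abs_le_reindex (I J : choiceType) (e : J -> I) (f : I -> C) M :
  injective e -> abs_le f M -> abs_le (f \o e) M.
Proof.
move=> e_inj fM; split=> A; rewrite -(big_map e xpredT (fun i => `|f i|)).
by apply: abs_le_seq => //; rewrite map_inj_uniq.
Qed.

(** Summation by rows, where the bound may vary with the row. This is the form needed for
    compositions, whose rows are the powers of the inner series, and for sums of geometrically
    decreasing series. *)
Lemma abs_le_dep (I J : choiceType) (F : I -> J -> C) (m : I -> C) M :
  (forall i, abs_le (F i) (m i)) -> abs_le m M ->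
  abs_le (fun p : I * J => F p.1 p.2) M.
Proof.
move=> Fm [mM]; split=> A; apply: le_trans (mM [fset p.1 | p in A]%fset).
rewrite (eq_big_seq (fun p : I * J =>
  if p.1 \in [fset p.1 | p in A]%fset then `|F p.1 p.2| else 0)); last first.
  by move=> p pA; rewrite ifT//; apply/imfsetP; exists p.
rewrite -(sum_fibres (fun p => p.1)) ?fset_uniq//; apply: ler_sum => i _.
rewrite ger0_norm ?(abs_le_ge0 (Fm i))//.
rewrite -big_mkcond/= -big_filter.
rewrite (eq_big_seq (fun p : I * J => `|F i p.2|)); last first.
  by move=> p; rewrite mem_filter => /andP[/eqP <-].
rewrite -(big_map snd xpredT (fun j => `|F i j|)).
apply: abs_le_seq => //; rewrite map_inj_in_uniq ?filter_uniq ?fset_uniq//.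
move=> [i1 j1] [i2 j2]; rewrite !mem_filter/=.
by move=> /andP[/eqP -> _] /andP[/eqP -> _] ->.
Qed.

Lemma abs_le_prod (I J : choiceType) (f : I -> C) (g : J -> C) M L :
  abs_le f M -> abs_le g L -> abs_le (fun p : I * J => f p.1 * g p.2) (M * L).
Proof.
move=> fM gL.
apply: (@abs_le_dep _ _ (fun i j => f i * g j) (fun i => `|f i| * L)).
  by move=> i; exact: abs_leZ.
have L0 := abs_le_ge0 gL; case: fM => fM; split=> A.
under eq_bigr do rewrite normrM normr_id (ger0_norm L0).
by rewrite -mulr_suml ler_wpM2r.
Qed.

Lemma has_sum_fst (I J : choiceType) (F : I * J -> C) i v :
  has_sum (fun j => F (i, j)) v ->
  has_sum (fun p => if p.1 == i then F p else 0) v.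
Proof.
move=> Fv; apply: (@has_sum_reindex _ _ (fun j => (i, j))).
- by move=> j j' [].
- by move=> [i' j'] /(_ j')/eqP ne; case: eqP => // /= i'i; case: ne; rewrite i'i.
- by apply: eq_has_sum Fv => j /=; rewrite eqxx.
Qed.

Lemma has_sum_snd (I J : choiceType) (F : I * J -> C) j v :
  has_sum (fun i => F (i, j)) v ->
  has_sum (fun p => if p.2 == j then F p else 0) v.
Proof.
move=> Fv; apply: (@has_sum_reindex _ _ (fun i => (i, j))).
- by move=> i i' [].
- by move=> [i' j'] /(_ i')/eqP ne; case: eqP => // /= i'i; case: ne; rewrite i'i.
- by apply: eq_has_sum Fv => i /=; rewrite eqxx.
Qed.

(** Absolute convergence provides some sum x of the double family; regrouping it by rows identifies
    x with the product. *)
Lemma has_sum_prod (I J : choiceType) (f : I -> C) (g : J -> C) M L v w :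
  abs_le f M -> abs_le g L -> has_sum f v -> has_sum g w ->
  has_sum (fun p : I * J => f p.1 * g p.2) (v * w).
Proof.
move=> fM gL fv gw; have [x fgx] := has_sum_ex (abs_le_prod fM gL).
suff <- : x = v * w by [].
rewrite [RHS]mulrC; apply: (@has_sum_unique _ (fun i => w * f i)); last exact: has_sumZ fv.
apply: (has_sum_sigma (p := fst) fgx) => i; rewrite [w * _]mulrC.
have := has_sumZ (f i) gw.
exact: (@has_sum_fst I J (fun p => f p.1 * g p.2) i).
Qed.

Lemma expr_cvg0 (x : R) : 0 <= x -> x < 1 ->
  (x%:C%C : C) ^+ N @[N --> \oo] --> (0 : C).
Proof.
move=> x0 x1; apply/cvgr0Pnorm_lt => -[e y].
rewrite /Cplx ltcE/= => /andP[/eqP -> e0].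
have : x ^+ N @[N --> \oo] --> (0 : R) by apply: cvg_expr; rewrite ger0_norm.
move=> /cvgr0Pnorm_lt/(_ _ e0); apply: filterS => N.
rewrite ger0_norm ?exprn_ge0// => hx.
rewrite -rmorphXn/= ger0_norm ?ler0c ?exprn_ge0//.
by rewrite ltcE/= eqxx.
Qed.

End Sums.

(* keeps unification from unfolding the field structure of R[i] *)
Opaque Cplx.

(** * Power series *)

Notation mindex n := {ffun 'I_n -> nat}.

Section MultiIndices.
Variable n : nat.
Implicit Types a b g : mindex n.

Definition mi0 : mindex n := [ffun=> 0%N].
Definition miD a b : mindex n := [ffun i => (a i + b i)%N].
Definition miB a b : mindex n := [ffun i => (a i - b i)%N].
Definition mile a b := [forall i, (a i <= b i)%N].
Definition deg a := (\sum_i a i)%N.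
Definition mi1 (i : 'I_n) : mindex n := [ffun j => (j == i : nat)].

(** The exponents over which [psum] runs. Boxes are cofinal among the finite sets of exponents,
    which ties unconditional sums to the limits in [hol_at]. *)
Definition box N : {fset mindex n} :=
  [fset [ffun i => a i : nat] | a : {ffun 'I_n -> 'I_N} in predT]%fset.

Lemma mem_box N a : (a \in box N) = [forall i, a i < N]%N.
Proof.
apply/imfsetP/forallP => [[b _ ->] i|aN]; first by rewrite ffunE.
by exists [ffun i => Ordinal (aN i)] => //; apply/ffunP => i; rewrite !ffunE.
Qed.

Lemma box_cover (A : {fset mindex n}) : exists N, (A `<=` box N)%fset.
Proof.
exists (\sum_(a <- A) deg a).+1; apply/fsubsetP => a aA.
rewrite mem_box; apply/forallP => i; rewrite ltnS.
rewrite (big_fsetD1 a)//= (leq_trans _ (leq_addr _ _))//.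
by rewrite /deg (bigD1 i)//= leq_addr.
Qed.

Lemma box_mono N P : (N <= P)%N -> (box N `<=` box P)%fset.
Proof.
move=> NP; apply/fsubsetP => a; rewrite !mem_box => /forallP aN.
by apply/forallP => i; exact: leq_trans (aN i) NP.
Qed.

Lemma miD_inj d : injective (fun a => miD a d).
Proof.
move=> a b /ffunP ab; apply/ffunP => i.
by have := ab i; rewrite !ffunE => /addIn.
Qed.

Lemma miDK a d : miB (miD a d) d = a.
Proof. by apply/ffunP => i; rewrite !ffunE addnK. Qed.

Lemma miBK a d : mile d a -> miD (miB a d) d = a.
Proof. by move=> /forallP da; apply/ffunP => i; rewrite !ffunE subnK. Qed.

Lemma mileD a d : mile d (miD a d).
Proof. by apply/forallP => i; rewrite ffunE leq_addl. Qed.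

Lemma deg_eq0 a : (deg a == 0%N) = (a == mi0).
Proof.
rewrite /deg sum_nat_eq0; apply/forallP/eqP => [a0|-> i].
  by apply/ffunP => i; rewrite ffunE; apply/eqP; exact: (a0 i).
by rewrite ffunE.
Qed.

Lemma mi1_le a i : mile (mi1 i) a = (0 < a i)%N.
Proof.
apply/forallP/idP => [/(_ i)|ai j]; rewrite ffunE ?eqxx//.
by case: eqP => // ->.
Qed.

End MultiIndices.
Arguments mi0 {n}.

Section Monomials.
Variables (R : realType) (n : nat).
Local Notation C := (Cplx R).
Local Notation mon := (@ps_monomial C n).
Implicit Types (a b : mindex n) (z w : 'rV[C]_n).

Lemma mon0 z : mon z mi0 = 1.
Proof. by rewrite /ps_monomial big1// => i _; rewrite ffunE expr0. Qed.

Lemma monD z a b : mon z (miD a b) = mon z a * mon z b.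
Proof.
by rewrite /ps_monomial -big_split; apply: eq_bigr => i _; rewrite ffunE exprD.
Qed.

Lemma mon1 z i : mon z (mi1 i) = z 0 i.
Proof.
rewrite /ps_monomial (bigD1 i)//= ffunE eqxx expr1 big1 ?mulr1// => j ji.
by rewrite ffunE (negbTE ji) expr0.
Qed.

Lemma mon_le z w a : (forall i, `|z 0 i| <= `|w 0 i|) -> `|mon z a| <= `|mon w a|.
Proof.
move=> zw; rewrite /ps_monomial !normr_prod; apply: ler_prod => i _.
by rewrite normr_ge0/= !normrX lerXn2r ?nnegrE.
Qed.

Lemma mon_const (r : C) a : mon (const_mx r) a = r ^+ deg a.
Proof.
rewrite /ps_monomial /deg -prodrXr; apply: eq_bigr => i _.
by rewrite mxE.
Qed.

Lemma mon_at0 a : mon 0 a = (a == mi0)%:R.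
Proof.
rewrite (_ : 0 = const_mx 0); last by apply/rowP => i; rewrite !mxE.
by rewrite mon_const expr0n deg_eq0.
Qed.

(** M bounds the weighted l^1 norm of c. The polyradius is given by a point, because the division
    uses unequal radii. *)
Record nrm (c : mindex n -> C) z M : Prop :=
  Nrm { nrm_abs : abs_le (fun a => c a * mon z a) M }.

Lemma nrm_mono c z w M :
  (forall i, `|z 0 i| <= `|w 0 i|) -> nrm c w M -> nrm c z M.
Proof.
move=> zw [cM]; split; apply: abs_le_sub cM => a; rewrite !normrM ler_wpM2l//.
exact: mon_le.
Qed.

Lemma nrm_sub c d z M : (forall a, `|d a| <= `|c a|) -> nrm c z M -> nrm d z M.
Proof.
by move=> dc [cM]; split; apply: abs_le_sub cM => a; rewrite !normrM ler_wpM2r.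
Qed.

Lemma const_mx_le (r s : C) : 0 <= r -> r <= s ->
  forall i, `|(const_mx r : 'rV[C]_n) 0 i| <= `|(const_mx s : 'rV[C]_n) 0 i|.
Proof. by move=> r0 rs i; rewrite !mxE !ger0_norm// (le_trans r0). Qed.

Lemma lt_const_mx z (r : C) : (forall i, `|z 0 i| < r) ->
  forall i, `|z 0 i| <= `|(const_mx r : 'rV[C]_n) 0 i|.
Proof.
move=> zr i; rewrite mxE [leRHS]ger0_norm ?ltW//.
by apply: le_lt_trans (zr i).
Qed.

Lemma half_nrm N :
  \sum_(a <- box n N) (2^-1 : C) ^+ deg a <= 2 ^+ n.
Proof.
rewrite big_imfset/=; last first.
  move=> a b _ _ /ffunP ab; apply/ffunP => i.
  by have := ab i; rewrite !ffunE => /val_inj.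
rewrite big_enum/= (_ : \sum_(_ in _) _ =
  \sum_(a : {ffun 'I_n -> 'I_N}) \prod_i (2^-1 : C) ^+ a i); last first.
  apply: eq_bigr => a _; rewrite -prodrXr.
  by apply: eq_bigr => i _; rewrite ffunE.
rewrite -(bigA_distr_bigA (fun _ (k : 'I_N) => (2^-1 : C) ^+ k)).
rewrite prodr_const card_ord.
have h0 : 0 <= (2^-1 : C) by rewrite invr_ge0.
apply: lerXn2r; rewrite ?nnegrE ?sumr_ge0//; try by move=> i _; exact: exprn_ge0.
have -> : \sum_(k < N) (2^-1 : C) ^+ k = 2 * (1 - 2^-1 ^+ N).
  elim: N => [|N IH]; first by rewrite big_ord0 expr0 subrr mulr0.
  rewrite big_ord_recr/= IH exprS !mulrBr mulrA mulfV ?pnatr_eq0// mul1r.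
  by rewrite [_ * 2^-1 ^+ N]mulr_natl mulr2n opprD -!addrA addNr addr0.
by rewrite ger_pMr// gerDl oppr_le0 exprn_ge0.
Qed.

(** Halving the radius turns a uniform bound into an l^1 bound: the powers of 1/2 of exponents
    [deg a] add up to at most 2^n. *)
Lemma nrm_of_sup c (r M : C) : 0 < r -> (forall a, `|c a| * r ^+ deg a <= M) ->
  nrm c (const_mx (r / 2)) (M * 2 ^+ n).
Proof.
move=> r0 cM; split; split=> A; have [N AN] := box_cover A.
have M0 : 0 <= M by apply: le_trans (cM mi0); rewrite mulr_ge0 ?exprn_ge0// ltW.
have h0 a : 0 <= (2^-1 : C) ^+ deg a by rewrite exprn_ge0// invr_ge0.
apply: (@le_trans _ _ (M * \sum_(a <- box n N) (2^-1 : C) ^+ deg a)); last first.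
  by rewrite ler_wpM2l// half_nrm.
rewrite mulr_sumr (big_fset_mask _ AN); apply: ler_sum => a _.
case: ifP => _; last by rewrite mulr_ge0.
rewrite mon_const exprMn normrM [ `|r ^+ _ * _|]ger0_norm; last first.
  by rewrite mulr_ge0// exprn_ge0 ?ltW.
by rewrite mulrA ler_wpM2r.
Qed.

Lemma has_sum_psum c z v : has_sum (fun a => c a * mon z a) v ->
  psum c z N @[N --> \oo] --> v.
Proof.
move=> /has_sumP cv; apply/cvgrPdist_lt => e e0.
have [A0 A0v] := cv e e0; have [N0 AN0] := box_cover A0.
exists N0 => // N /= N0N; rewrite distrC.
have := A0v (box n N) (fsubset_trans AN0 (box_mono _ N0N)).
rewrite big_imfset/=; first by rewrite big_enum.
move=> a b _ _ /ffunP ab; apply/ffunP => i.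
by have := ab i; rewrite !ffunE => /val_inj.
Qed.

Lemma near0P (P : 'rV[C]_n -> Prop) : (\forall z \near (0 : 'rV[C]_n), P z) <->
  exists2 r : C, 0 < r & forall z, (forall i, `|z 0 i| < r) -> P z.
Proof.
split=> [/nbhs_ballP[r/= r0 rP]|[r r0 rP]].
  exists r => // z zr; apply: rP; split=> // i j.
  by rewrite ord1 mxE -ball_normE/= sub0r normrN.
apply/nbhs_ballP; exists r => //= z [_ zr]; apply: rP => i.
by have := zr 0 i; rewrite mxE -ball_normE/= sub0r normrN.
Qed.

End Monomials.

(** * Goedel numbers of exponents *)

Section Goedel.

Fixpoint prime_seq (k : nat) : nat :=
  if k is j.+1 then s2val (prime_above (prime_seq j)) else 2%N.

Arguments prime_seq : simpl never.

Lemma prime_seqP k : prime (prime_seq k).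
Proof. by case: k => // k; rewrite /prime_seq -/prime_seq; case: prime_above. Qed.

Lemma prime_seq_lt j k : (j < k)%N -> (prime_seq j < prime_seq k)%N.
Proof.
elim: k => // k IH; rewrite ltnS leq_eqVlt => /predU1P[->|/IH jk];
  rewrite [X in (_ < X)%N]/prime_seq -/prime_seq;
  case: prime_above => //= p kp _; exact: ltn_trans jk kp.
Qed.

Lemma prime_seqX_gt0 j k : (0 < prime_seq j ^ k)%N.
Proof. by rewrite expn_gt0 prime_gt0// prime_seqP. Qed.

Lemma prime_seq_inj : injective prime_seq.
Proof.
move=> j k jk; case: (ltngtP j k) => // /prime_seq_lt lt_jk.
  by have := ltn_eqF lt_jk; rewrite jk eqxx.
by have := ltn_eqF lt_jk; rewrite jk eqxx.
Qed.

Variable n : nat.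

(* Goedel numbers order the monomials, and their powers [goedel a ^- k] are the
   values of the monomials at points tending to 0. *)
Definition goedel (a : mindex n) : nat := (\prod_(i < n) prime_seq i ^ a i)%N.

Lemma goedel_gt0 a : (0 < goedel a)%N.
Proof. by apply: prodn_gt0 => i; exact: prime_seqX_gt0. Qed.

(** Unique factorization: the entries of a are the valuations of its Goedel number at distinct
    primes. *)
Lemma goedel_inj : injective goedel.
Proof.
have logE a (i : 'I_n) : logn (prime_seq i) (goedel a) = a i.
  rewrite /goedel (bigD1 i)//= lognM ?prime_seqX_gt0//; last first.
    by apply: prodn_cond_gt0 => j _; exact: prime_seqX_gt0.
  rewrite lognX logn_prime ?prime_seqP// eqxx muln1.
  rewrite (_ : logn _ _ = 0%N) ?addn0//.
  elim/big_rec: _ => [|j x ji IH]; first by rewrite logn1.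
  have [->|x0] := posnP x; first by rewrite muln0 logn0.
  rewrite lognM ?prime_seqX_gt0// IH addn0 lognX.
  rewrite logn_prime ?prime_seqP// (inj_eq prime_seq_inj).
  by rewrite (inj_eq val_inj) eq_sym (negbTE ji) muln0.
by move=> a b ab; apply/ffunP => i; rewrite -!logE ab.
Qed.

End Goedel.

(** * Convergent power series and the identity theorem *)

Section Series.
Variables (R : realType).
Local Notation C := (Cplx R).

Lemma seq_unique (u : nat -> C) (v w : C) :
  u N @[N --> \oo] --> v -> u N @[N --> \oo] --> w -> v = w.
Proof. by move=> fv fw; apply: (cvg_unique _ fv fw); exact: norm_hausdorff. Qed.

Section Def.
Variable n : nat.
Local Notation mon := (@ps_monomial C n).
Implicit Types (a b : mindex n) (c d : mindex n -> C) (f g : 'rV[C]_n -> C) (z : 'rV[C]_n).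

(** In contrast to [pseries_at], the bound is an l^1 bound and the sum is unconditional; passing
    from one notion to the other costs only a smaller radius. *)
Definition has_ser f c := exists r M : C,
  [/\ 0 < r, nrm c (const_mx r) M
    & forall z, (forall i, `|z 0 i| < r) ->
        has_sum (fun a => c a * mon z a) (f z)].

Lemma hol0P f : hol_at f 0 <-> exists c, has_ser f c.
Proof.
split=> [[c [r [M [r0 cM cf]]]]|[c [r [M [r0 cM cf]]]]].
  exists c, (r / 2), (M * 2 ^+ n); split; [by rewrite divr_gt0| exact: nrm_of_sup|].
  move=> z zr.
  have [v cv] := has_sum_ex (nrm_abs (nrm_mono (lt_const_mx zr) (nrm_of_sup r0 cM))).
  rewrite (_ : f z = v)//.
  have zr' i : `|z 0 i| < r.
    by apply: lt_trans (zr i) _; rewrite ltr_pdivrMr// ltr_pMr// ltr1n.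
  have := cf z zr'; rewrite add0r => cf'.
  exact: seq_unique cf' (has_sum_psum cv).
exists c, r, M; split=> [|a|z zr]; first exact: r0.
  have := abs_le_term a (nrm_abs cM); rewrite normrM mon_const.
  by rewrite [X in _ * X]ger0_norm// exprn_ge0 ?ltW.
by rewrite add0r; apply: has_sum_psum; exact: cf.
Qed.

Lemma has_ser_shrink f c (s : C) : has_ser f c -> 0 < s ->
  exists r M : C, [/\ 0 < r, r <= s, nrm c (const_mx r) M
    & forall z, (forall i, `|z 0 i| < r) ->
        has_sum (fun a => c a * mon z a) (f z)].
Proof.
move=> [r [M [r0 cM cf]]] s0; have [t [t0 tr ts]] := common_radius r0 s0.
exists t, M; split=> //; first by apply: nrm_mono cM; apply: const_mx_le => //; exact: ltW.
by move=> z zt; apply: cf => i; exact: lt_le_trans (zt i) tr.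
Qed.

Lemma has_ser_near f g c : (\forall z \near (0 : 'rV[C]_n), f z = g z) ->
  has_ser f c -> has_ser g c.
Proof.
move=> /near0P[s s0 fg] fc; have [r [M [r0 rs cM cf]]] := has_ser_shrink fc s0.
exists r, M; split=> // z zr; rewrite -fg; first exact: cf.
by move=> i; exact: lt_le_trans (zr i) rs.
Qed.

Lemma has_ser0 f c : has_ser f c -> f 0 = c mi0.
Proof.
move=> [r [M [r0 cM cf]]].
have /cf f0 : forall i, `|(0 : 'rV[C]_n) 0 i| < r by move=> i; rewrite mxE normr0.
apply: (has_sum_unique f0); have := @has_sum_single _ _ (fun a => c a * mon 0 a) mi0.
by rewrite mon0 mulr1; apply=> a a0; rewrite mon_at0 (negbTE a0) mulr0.
Qed.

Lemma has_serZ f c k : has_ser f c ->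
  has_ser (fun z => k * f z) (fun a => k * c a).
Proof.
move=> [r [M [r0 cM cf]]]; exists r, (`|k| * M); split=> // [|z zr].
  split; split=> A; have := abs_leP (abs_leZ (k) (nrm_abs cM)) A.
  by under eq_bigr do rewrite mulrA; exact.
by have := has_sumZ (k) (cf z zr); apply: eq_has_sum => a; rewrite mulrA.
Qed.

Definition convs c := exists r M : C, 0 < r /\ nrm c (const_mx r) M.

Lemma has_ser_convs f c : has_ser f c -> convs c.
Proof. by move=> [r [M [r0 cM _]]]; exists r, M. Qed.

Lemma convs_sub c d : (forall a, `|d a| <= `|c a|) -> convs c -> convs d.
Proof. by move=> dc [r [M [r0 cM]]]; exists r, M; split => //; exact: nrm_sub cM. Qed.

Lemma convs_shift c (d : mindex n) : convs c -> convs (fun a => c (miD a d)).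
Proof.
move=> [r [M [r0 cM]]]; exists r, (`|(r ^+ deg d)^-1| * M); split=> //; split; split=> A.
have cM' := abs_le_reindex (@miD_inj _ d) (nrm_abs cM).
apply: le_trans (abs_leP (abs_leZ ((r ^+ deg d)^-1) cM') A); apply: ler_sum => a _ /=.
rewrite monD (mon_const r d) [X in _ <= `|X|]mulrC -!mulrA mulfV ?mulr1//.
by rewrite expf_neq0// gt_eqF.
Qed.

Lemma ser_fun c : convs c -> exists f, has_ser f c.
Proof.
move=> [r [M [r0 cM]]].
have ex z : exists v, (forall i, `|z 0 i| < r) -> has_sum (fun a => c a * mon z a) v.
  have [zr|nzr] := pselect (forall i, `|z 0 i| < r); last by exists 0 => /nzr.
  by have [v cv] := has_sum_ex (nrm_abs (nrm_mono (lt_const_mx zr) cM)); exists v.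
by have [f fP] := choice ex; exists f, r, M.
Qed.

Definition gpt (k : nat) : 'rV[C]_n := \row_i ((prime_seq i)%:R ^- k).

Lemma mon_gpt k a : mon (gpt k) a = (goedel a)%:R ^- k.
Proof.
rewrite /ps_monomial /goedel natr_prod -exprVn -prodfV -prodrXl.
apply: eq_bigr => i _; rewrite mxE natrX -!exprVn -!exprM.
by rewrite mulnC.
Qed.

Lemma gpt_lt (r : C) : 0 < r -> exists k0, forall k, (k0 <= k)%N ->
  forall i, `|gpt k 0 i| < r.
Proof.
move=> r0; have /cvgr0Pnorm_lt/(_ _ r0)[k0 _ k0P] := @half_cvg0 R.
exists k0 => k /k0P /=; move=> h i; apply: le_lt_trans h.
rewrite mxE -exprVn !normrX lerXn2r ?nnegrE//.
rewrite !ger0_norm ?invr_ge0// lef_pV2 ?posrE ?ltr0n ?prime_gt0 ?prime_seqP//.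
by rewrite ler_nat prime_gt1 ?prime_seqP.
Qed.

(* The leading term, in the order of the Goedel numbers, dominates the others at
   the points [gpt k] for k large: the terms of index a are multiplied by
   (goedel al / goedel a)^l when k increases by l. *)
Lemma goedel_tail c al : convs c ->
  (forall a, (goedel a < goedel al)%N -> c a = 0) ->
  forall e : C, 0 < e -> exists k0, forall k, (k0 <= k)%N ->
  nrm (fun a => if a == al then 0 else c a) (gpt k) (e * mon (gpt k) al).
Proof.
move=> [r [M [r0 cM]]] cal e e0.
have [k1 k1r] := gpt_lt r0.
have cM1 : nrm c (gpt k1) M.
  by apply: nrm_mono cM; apply: lt_const_mx; exact: k1r.
pose N0 := goedel al; have N00 : (0 < N0)%N by exact: goedel_gt0.
(* Any other exponent with a nonzero coefficient has Goedel number at least N0 + 1, so each increase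
   of k by one shrinks its term by the factor q relative to the leading monomial. *)
pose q : C := N0%:R / N0.+1%:R.
have q0 : 0 <= q by rewrite divr_ge0.
have M0 := abs_le_ge0 (nrm_abs cM1).
(* The factor N0^k1 expresses M as a multiple of the leading monomial at [gpt k1]; adding 1 makes M'
   invertible. *)
pose M' := M * N0%:R ^+ k1 + 1.
have M'0 : 0 < M' by rewrite ltr_wpDl// mulr_ge0 ?exprn_ge0.
have [l0 l0P] : exists l0, forall l, (l0 <= l)%N -> q ^+ l * M' <= e.
  have em0 : 0 < e / M' by rewrite divr_gt0.
  have qx : q = ((N0%:R / N0.+1%:R : R)%:C)%C :> C.
    by rewrite rmorphM/= fmorphV/= !rmorph_nat.
  have x0 : (0 : R) <= N0%:R / N0.+1%:R by rewrite divr_ge0.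
  have x1 : N0%:R / N0.+1%:R < (1 : R) by rewrite ltr_pdivrMr// mul1r ltr_nat.
  have /cvgr0Pnorm_lt/(_ _ em0)[l0 _ l0P] := expr_cvg0 x0 x1.
  exists l0 => l /l0P /=; rewrite -qx ger0_norm ?exprn_ge0// => h.
  by rewrite -ler_pdivlMr// ltW.
exists (k1 + l0)%N => k k1k; pose l := (k - k1)%N.
have -> : k = (k1 + l)%N by rewrite /l; lia.
have l0l : (l0 <= l)%N by rewrite /l; lia.
split; split=> A; have qe := l0P l l0l; have ql0 : 0 <= q ^+ l by rewrite exprn_ge0.
rewrite mon_gpt -/N0.
apply: (@le_trans _ _ (\sum_(a <- A) `|c a * mon (gpt k1) a| * (q ^+ l * N0%:R ^- l))).
  apply: ler_sum => a _; case: eqP => [_|/eqP aal].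
    by rewrite mul0r normr0 mulr_ge0// mulr_ge0// invr_ge0 exprn_ge0.
  have [aN|Na] := ltnP (goedel a) N0.
    by rewrite cal// !mul0r normr0 mul0r.
  rewrite [leLHS]normrM [ `|_ * _|]normrM -mulrA ler_wpM2l ?normr_ge0//.
  rewrite !mon_gpt exprD invfM normrM ler_wpM2l ?normr_ge0//.
  rewrite /q exprMn mulrAC mulfV ?expf_neq0 ?pnatr_eq0 -?lt0n// mul1r.
  rewrite -exprVn normrX lerXn2r ?nnegrE ?invr_ge0//.
  rewrite normfV normr_nat lef_pV2 ?posrE ?ltr0n ?goedel_gt0//.
  rewrite ler_nat ltn_neqAle Na andbT; apply: contra aal => /eqP/goedel_inj ->.
  exact: eqxx.
rewrite -mulr_suml.
apply: (@le_trans _ _ (M * (q ^+ l * N0%:R ^- l))).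
  by rewrite ler_wpM2r// ?mulr_ge0// ?invr_ge0 ?exprn_ge0//; exact: abs_leP (nrm_abs cM1) A.
rewrite exprD invfM !mulrA.
rewrite ler_wpM2r ?invr_ge0 ?exprn_ge0//.
rewrite ler_pdivlMr ?exprn_gt0 ?ltr0n//; apply: le_trans qe.
by rewrite mulrAC [leRHS]mulrC ler_wpM2r// /M' lerDl.
Qed.

(** Identity theorem. If c a were the nonzero coefficient of least Goedel number, then at [gpt k]
    its term would be minus the sum of the others, which is at most half as large. *)
Lemma has_ser_eq0 f c : has_ser f c -> (\forall z \near (0 : 'rV[C]_n), f z = 0) ->
  forall a, c a = 0.
Proof.
move=> fc f0 a; have [m] := ubnP (goedel a); elim: m a => // m IH a.
rewrite ltnS => am; apply/eqP/negPn/negP => ca0.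
have ca b : (goedel b < goedel a)%N -> c b = 0.
  by move=> ba; apply: IH; exact: leq_trans ba am.
have [s s0 f0s] := (near0P _).1 f0.
have [r [M [r0 rs cM cf]]] := has_ser_shrink fc s0.
have e0 : 0 < `|c a| / 2 by rewrite divr_gt0 ?normr_gt0.
have [k0 k0P] := goedel_tail (has_ser_convs fc) ca e0.
have [k1 k1P] := gpt_lt r0.
pose k := maxn k0 k1; have /k0P tail : (k0 <= k)%N by rewrite leq_maxl.
have gr : forall i, `|gpt k 0 i| < r by apply: k1P; rewrite leq_maxr.
have := cf _ gr; rewrite f0s; last by move=> i; exact: lt_le_trans (gr i) rs.
have hs := @has_sum_single _ _ (fun b => if b == a then - (c a * mon (gpt k) a) else 0) a.
rewrite eqxx in hs; have {}hs := hs (fun i ia => ifN _ _ ia).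
move=> /has_sumD/(_ hs); rewrite add0r => hs'.
have hs2 : has_sum (fun b => (if b == a then 0 else c b) * mon (gpt k) b)
   (- (c a * mon (gpt k) a)).
  apply: eq_has_sum hs' => b; case: eqP => [->|_]; last by rewrite addr0.
  by rewrite mul0r subrr.
have := has_sum_norm_le hs2 (nrm_abs tail); rewrite normrN normrM.
have gp : 0 < mon (gpt k) a by rewrite mon_gpt invr_gt0 exprn_gt0// ltr0n goedel_gt0.
rewrite [ `|mon _ _|]gtr0_norm// ler_pM2r//.
rewrite ler_pdivlMr// ger_pMr ?normr_gt0//.
by rewrite lern1.
Qed.

End Def.
End Series.

(** * Products of power series *)

Section Convolution.
Variables (R : realType) (n : nat).
Local Notation C := (Cplx R).
Local Notation mon := (@ps_monomial C n).
Implicit Types (a b g : mindex n) (c d : mindex n -> C) (z w : 'rV[C]_n).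

Definition pairs g : {fset mindex n * mindex n} :=
  [fset p in (box n (deg g).+1 `*` box n (deg g).+1)%fset | miD p.1 p.2 == g]%fset.

Lemma mem_pairs g p : (p \in pairs g) = (miD p.1 p.2 == g).
Proof.
rewrite !inE /=; apply/andP/idP => [[]//|pg]; split=> //.
have gle i : (g i <= deg g)%N by rewrite /deg (bigD1 i)//= leq_addr.
rewrite !mem_box; apply/andP; split; apply/forallP => i; rewrite ltnS;
  apply: leq_trans (gle i); rewrite -(eqP pg) ffunE ?leq_addr//.
by rewrite leq_addl.
Qed.

Definition sconv c d g : C := \sum_(p <- pairs g) c p.1 * d p.2.

Lemma has_sum_conv c d g :
  has_sum (fun p => if miD p.1 p.2 == g then c p.1 * d p.2 else 0) (sconv c d g).
Proof.
rewrite /sconv (eq_big_seq (fun p => if miD p.1 p.2 == g then c p.1 * d p.2 else 0)).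
  by apply: has_sum_finite => p; rewrite mem_pairs => /negbTE ->.
by move=> p; rewrite mem_pairs => ->.
Qed.

Lemma has_sum_conv_mon c d z g :
  has_sum (fun p => if miD p.1 p.2 == g then
    (c p.1 * mon z p.1) * (d p.2 * mon z p.2) else 0) (sconv c d g * mon z g).
Proof.
have := has_sumZ (mon z g) (has_sum_conv c d g); rewrite mulrC.
apply: eq_has_sum => p; case: eqP => [<-|_]; last by rewrite mulr0.
by rewrite monD mulrC mulrACA.
Qed.

Lemma nrm_conv c d z M L : nrm c z M -> nrm d z L -> nrm (sconv c d) z (M * L).
Proof.
move=> [cM] [dL]; split; apply: abs_le_sigma (abs_le_prod cM dL) _.
exact: has_sum_conv_mon.
Qed.

Lemma has_sum_convM c d w z M L v u : (forall i, `|z 0 i| <= `|w 0 i|) ->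
  nrm c w M -> nrm d w L ->
  has_sum (fun a => c a * mon z a) v -> has_sum (fun a => d a * mon z a) u ->
  has_sum (fun a => sconv c d a * mon z a) (v * u).
Proof.
move=> zw cM dL cv du.
have [cM'] := nrm_mono zw cM; have [dL'] := nrm_mono zw dL.
apply: has_sum_sigma (has_sum_prod cM' dL' cv du) _.
exact: has_sum_conv_mon.
Qed.

(** Without constant term every monomial has degree at least one and gains a factor t. This makes
    the inner series of a composition small. *)
Lemma nrm_scale d (r M t : C) : 0 <= t -> t <= 1 -> d mi0 = 0 ->
  nrm d (const_mx r) M -> nrm d (const_mx (t * r)) (t * M).
Proof.
move=> t0 t1 d0 [dM]; split; have [] := abs_leZ t dM; rewrite ger0_norm// => dtM.
split=> A; apply: le_trans (dtM A); apply: ler_sum => a _.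
have [->|a0] := eqVneq a mi0; first by rewrite d0 !mul0r mulr0.
rewrite !mon_const exprMn mulrCA normrM [leRHS]normrM ler_wpM2r//.
rewrite -deg_eq0 in a0.
rewrite normrX ger0_norm// -[leRHS]expr1 ler_wiXn2l// lt0n //.
Qed.

End Convolution.

(** * Composition of power series *)

Section Composition.
Variable R : realType.
Local Notation C := (Cplx R).

(** The inverse of s stands in for a minimum, as s is at least the inverse of each radius; the
    summand 1 keeps s positive when m = 0. *)
Lemma common_radius_fin (m : nat) (P : 'I_m -> C -> Prop) :
  (forall j r s, 0 < s -> s <= r -> P j r -> P j s) ->
  (forall j, exists r : C, 0 < r /\ P j r) ->
  exists2 r : C, 0 < r & forall j, P j r.
Proof.
move=> Pd exr; have [r rP] := choice exr; have r0 j : 0 < (r j)^-1 by rewrite invr_gt0; case: (rP j).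
pose s := 1 + \sum_j (r j)^-1.
have s0 : 0 < s by rewrite ltr_wpDr// sumr_ge0// => j _; rewrite ltW.
exists s^-1; first by rewrite invr_gt0.
move=> j; have [rj Pj] := rP j.
apply: Pd Pj; rewrite ?invr_gt0// -[r j]invrK lef_pV2 ?posrE//.
rewrite /s (bigD1 j)//= addrCA lerDl addr_ge0// sumr_ge0// => k _.
by rewrite ltW.
Qed.

Variables (n m : nat).
Implicit Types z : 'rV[C]_n.

(** The norm is submultiplicative under convolution, so a bound r for every coordinate of F becomes
    r^|a| for the monomial of exponent a. *)
Lemma mon_comp (F : 'rV[C]_n -> 'rV[C]_m) (d : 'I_m -> mindex n -> C) (s r : C) :
  (forall j, nrm (d j) (const_mx s) r) ->
  (forall j z, (forall i, `|z 0 i| < s) ->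
     has_sum (fun a => d j a * ps_monomial z a) (F z 0 j)) ->
  forall a : mindex m, exists e, nrm e (const_mx s) (r ^+ deg a) /\
    forall z, (forall i, `|z 0 i| < s) ->
     has_sum (fun b => e b * ps_monomial z b) (ps_monomial (F z) a).
Proof.
move=> dr dF a.
pose P (v : 'rV[C]_n -> C) L := exists e, nrm e (const_mx s) L /\
  forall z, (forall i, `|z 0 i| < s) -> has_sum (fun b => e b * ps_monomial z b) (v z).
have PM v L v' L' : P v L -> P v' L' -> P (fun z => v z * v' z) (L * L').
  move=> [e [eL ev]] [e' [eL' ev']]; exists (sconv e e'); split.
    exact: nrm_conv.
  by move=> z zs; exact: has_sum_convM (lt_const_mx zs) eL eL' (ev z zs) (ev' z zs).
have P1 : P (fun=> 1) 1.
  exists (fun b => (b == mi0)%:R).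
  have one z : has_sum (fun b => (b == mi0)%:R * ps_monomial z b) (1 : C).
    have := @has_sum_single _ _ (fun b => (b == mi0)%:R * @ps_monomial C n z b) mi0.
    rewrite eqxx mon0 mulr1; apply=> b /negbTE ->.
    by rewrite mul0r.
  split=> [|z _]; last exact: one.
  split; split=> A; apply: (@le_trans _ _ (\sum_(b <- A) (b == mi0)%:R)).
    apply: ler_sum => b _; case: eqP => [->|_]; last by rewrite mul0r normr0.
    by rewrite mon0 mulr1 normr1.
  have [iA|niA] := boolP (mi0 \in A).
    rewrite (big_fsetD1 mi0)//= big1_seq ?eqxx ?addr0// => b /=.
    by rewrite !inE => /andP[/negbTE ->].
  rewrite big1_seq ?ler01// => b /= bA; case: eqP => // b0.
  by rewrite b0 (negbTE niA) in bA.
have -> : r ^+ deg a = \prod_j r ^+ a j by rewrite prodrXr.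
suff : P (fun z => ps_monomial (F z) a) (\prod_j r ^+ a j) by [].
rewrite /ps_monomial; elim: (index_enum _) => [|j l IH].
  rewrite big_nil; under [X in P X _]eq_fun do rewrite big_nil; exact: P1.
rewrite big_cons; under [X in P X _]eq_fun do rewrite big_cons.
apply: (PM) IH; elim: (a j) => [|k IHk].
  by rewrite expr0; under [X in P X _]eq_fun do rewrite expr0; exact: P1.
rewrite exprS; under [X in P X _]eq_fun do rewrite exprS.
apply: PM IHk; exists (d j); split; [exact: dr|exact: dF].
Qed.

(** As F vanishes at 0, a small radius brings the norms of its coordinates below r / 2. The double
    series obtained by expanding the monomials of F then converges absolutely: summed by rows it
    gives f (F z), and by columns a power series in z. *)
Lemma hol_comp (f : 'rV[C]_m -> C) (F : 'rV[C]_n -> 'rV[C]_m) :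
  hol_at f 0 -> hol_map_at F 0 -> F 0 = 0 -> hol_at (f \o F) 0.
Proof.
move=> /hol0P[c [r [M [r0 [cM] cf]]]] hF F0.
have r20 : 0 < r / 2 by rewrite divr_gt0.
have r2r : r / 2 < r by rewrite ltr_pdivrMr// ltr_pMr// ltr1n.
have /choice[d dF] : forall j, exists d, has_ser (fun z => F z 0 j) d.
  by move=> j; exact/hol0P.
have [s s0 sP] : exists2 s : C, 0 < s & forall j, nrm (d j) (const_mx s) (r / 2) /\
    forall z, (forall i, `|z 0 i| < s) ->
     has_sum (fun a => d j a * ps_monomial z a) (F z 0 j).
  apply: (@common_radius_fin _ (fun j s => nrm (d j) (const_mx s) (r / 2) /\
    forall z, (forall i, `|z 0 i| < s) ->
     has_sum (fun a => d j a * ps_monomial z a) (F z 0 j))).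
    move=> j u v v0 vu [dj djv]; split.
      by apply: nrm_mono dj; apply: const_mx_le => //; exact: ltW.
    by move=> z zv; apply: djv => i; exact: lt_le_trans (zv i) vu.
  move=> j; have [u [L [u0 dL du]]] := dF j.
  have L0 : 0 <= L by exact: abs_le_ge0 (nrm_abs dL).
  have L10 : 0 < L + 1 by rewrite ltr_wpDl.
  (* The bound t <= 1 is required by [nrm_scale], and L + 1 is invertible even if L = 0. *)
  have [t [t0 t1 tL]] := @common_radius _ 1 (r / 2 / (L + 1)) ltr01 (divr_gt0 r20 L10).
  have tu : t * u <= u by rewrite ler_piMl// ltW.
  exists (t * u); split; first by rewrite mulr_gt0.
  split; last by move=> z zt; apply: du => i; exact: lt_le_trans (zt i) tu.
  have d0 : d j mi0 = 0 by rewrite -(has_ser0 (dF j)) F0 mxE.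
  have [dn] := nrm_scale (ltW t0) t1 d0 dL; split; apply: abs_le_trans dn.
  apply: (@le_trans _ _ (t * (L + 1))); last by rewrite -ler_pdivlMr.
  by rewrite ler_wpM2l ?ltW// ltrDl.
have [e eP] := choice (mon_comp (fun j => (sP j).1) (fun j => (sP j).2)).
have Fr z : (forall i, `|z 0 i| < s) -> forall j, `|F z 0 j| < r.
  move=> zs j; apply: le_lt_trans r2r.
  have [dj dv] := sP j.
  exact: has_sum_norm_le (dv z zs) (nrm_abs (nrm_mono (lt_const_mx zs) dj)).
have fam (w : 'rV[C]_n) : (forall i, `|w 0 i| <= `|(const_mx s : 'rV[C]_n) 0 i|) ->
    abs_le (fun p => c p.1 * e p.1 p.2 * ps_monomial w p.2) M.
  move=> ws; apply: (@abs_le_dep _ _ _ (fun a b => c a * e a b * ps_monomial w b)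
    (fun a => `|c a| * (r / 2) ^+ deg a)).
    move=> a; have [ea _] := eP a.
    have -> : (fun b => c a * e a b * ps_monomial w b) =
      (fun b => c a * (e a b * ps_monomial w b)).
      by apply/funext => b; rewrite mulrA.
    exact: abs_leZ (nrm_abs (nrm_mono ws ea)).
  apply: abs_le_sub cM => a; rewrite normrM normr_id normrM ler_wpM2l//.
  by rewrite mon_const !normrX lerXn2r ?nnegrE// !gtr0_norm// ltW.
have fam_s := fam _ (fun i => lexx _).
have /choice[u uP] : forall b, exists v, has_sum (fun a => c a * e a b) v.
  move=> b; have sb0 : s ^+ deg b != 0 by rewrite expf_neq0// gt_eqF.
  have pair_inj : injective (fun a : mindex m => (a, b)) by move=> a a' [].
  have := abs_leZ (s ^+ deg b)^-1 (abs_le_reindex pair_inj fam_s).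
  move=> /has_sum_ex[v]; rewrite (_ : (fun _ => _) = (fun a => c a * e a b)).
    by exists v.
  by apply/funext => a /=; rewrite mon_const mulrC mulfK.
have us w b : has_sum
    (fun p : mindex m * mindex n => if p.2 == b then c p.1 * e p.1 p.2 * ps_monomial w p.2 else 0)
    (u b * ps_monomial w b).
  apply: (@has_sum_snd _ _ _ (fun p => c p.1 * e p.1 p.2 * ps_monomial w p.2)) => /=.
  rewrite mulrC; have := has_sumZ (ps_monomial w b) (uP b).
  by apply: eq_has_sum => a; rewrite mulrC.
apply/hol0P; exists u, s, M; split; first exact: s0.
  by split; exact: abs_le_sigma fam_s (us _).
move=> z zs; have [x famx] := has_sum_ex (fam z (lt_const_mx zs)).
have -> : (f \o F) z = x; last exact: has_sum_sigma famx (us z).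
apply: has_sum_unique (cf (F z) (Fr z zs)) _.
apply: (has_sum_sigma (p := fst) famx) => a.
apply: (@has_sum_fst _ _ _ (fun p => c p.1 * e p.1 p.2 * ps_monomial z p.2)) => /=.
have := has_sumZ (c a) ((eP a).2 z zs).
by apply: eq_has_sum => b; rewrite mulrA.
Qed.

End Composition.

(** * Calculus of germs of holomorphic functions *)

Section HolCalculus.
Variable R : realType.
Local Notation C := (Cplx R).

Lemma near0W n (P : 'rV[C]_n -> Prop) : (forall z, P z) ->
  \forall z \near (0 : 'rV[C]_n), P z.
Proof. by move=> hP; apply/near0P; exists 1 => // _ _; exact: hP. Qed.

Lemma near0S n (P Q : 'rV[C]_n -> Prop) : (forall z, P z -> Q z) ->
  (\forall z \near (0 : 'rV[C]_n), P z) -> \forall z \near (0 : 'rV[C]_n), Q z.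
Proof. by move=> PQ; apply: filterS. Qed.

Lemma near0S2 n (P Q S : 'rV[C]_n -> Prop) : (forall z, P z -> Q z -> S z) ->
  (\forall z \near (0 : 'rV[C]_n), P z) -> (\forall z \near (0 : 'rV[C]_n), Q z) ->
  \forall z \near (0 : 'rV[C]_n), S z.
Proof. by move=> PQ; apply: filterS2. Qed.

Section OneGerm.
Variable n : nat.
Implicit Types (f g : 'rV[C]_n -> C) (z : 'rV[C]_n) (a b : mindex n).

Lemma hol_near f g : (\forall z \near (0 : 'rV[C]_n), f z = g z) ->
  hol_at f 0 -> hol_at g 0.
Proof.
by move=> fg /hol0P[c fc]; apply/hol0P; exists c; exact: has_ser_near fg fc.
Qed.

Lemma holN f : hol_at f 0 -> hol_at (fun z => - f z) 0.
Proof.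
move=> hf; have := holB (hol_cst 0 _) hf.
by under eq_fun do rewrite sub0r.
Qed.

Lemma holD f g : hol_at f 0 -> hol_at g 0 -> hol_at (fun z => f z + g z) 0.
Proof.
move=> hf hg; have := holB hf (holN hg).
by under eq_fun do rewrite opprK.
Qed.

Lemma holMr f g : hol_at f 0 -> hol_at g 0 -> hol_at (fun z => f z * g z) 0.
Proof. by move=> hf hg; apply: holM => //; exact: half_cvg0. Qed.

Lemma hol_sum (I : Type) (s : seq I) (P : pred I) (F : I -> 'rV[C]_n -> C) :
  (forall i, P i -> hol_at (F i) 0) -> hol_at (fun z => \sum_(i <- s | P i) F i z) 0.
Proof.
move=> hF; elim: s => [|i s IH].
  by under eq_fun do rewrite big_nil; exact: hol_cst.
under eq_fun do rewrite big_cons; have [Pi|//] := boolP (P i).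
by apply: holD IH; exact: hF.
Qed.

Lemma hol_prod (I : Type) (s : seq I) (P : pred I) (F : I -> 'rV[C]_n -> C) :
  (forall i, P i -> hol_at (F i) 0) -> hol_at (fun z => \prod_(i <- s | P i) F i z) 0.
Proof.
move=> hF; elim: s => [|i s IH].
  by under eq_fun do rewrite big_nil; exact: hol_cst.
under eq_fun do rewrite big_cons; have [Pi|//] := boolP (P i).
by apply: holMr IH; exact: hF.
Qed.

Lemma has_ser_coord (j : 'I_n) : has_ser (fun z : 'rV[C]_n => z 0 j)
  (fun a => (a == mi1 j)%:R).
Proof.
exists 1, 1; split=> [||z _]; first exact: ltr01.
  split; split=> A.
  apply: (@le_trans _ _ (\sum_(a <- A) (a == mi1 j)%:R)).
    apply: ler_sum => a _; case: eqP => [->|_]; last by rewrite mul0r normr0.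
    by rewrite mul1r mon_const expr1n normr1.
  have [iA|niA] := boolP (mi1 j \in A).
    rewrite (big_fsetD1 (mi1 j))//= big1_seq ?eqxx ?addr0// => b /=.
    by rewrite !inE => /andP[/negbTE ->].
  rewrite big1_seq ?ler01// => b /= bA; case: eqP => // b0.
  by rewrite b0 (negbTE niA) in bA.
have := @has_sum_single _ _ (fun a => (a == mi1 j)%:R * ps_monomial z a) (mi1 j).
rewrite eqxx mon1 mul1r; apply=> a /negbTE ->.
by rewrite mul0r.
Qed.

Lemma hol_coord (j : 'I_n) : hol_at (fun z : 'rV[C]_n => z 0 j) 0.
Proof. by apply/hol0P; eexists; exact: has_ser_coord. Qed.

Lemma hol_bounded f : hol_at f 0 ->
  exists2 M : C, 0 < M & \forall z \near (0 : 'rV[C]_n), `|f z| <= M.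
Proof.
move=> /hol0P[c [r [M [r0 cM cf]]]]; exists (M + 1).
  by rewrite ltr_wpDl// (abs_le_ge0 (nrm_abs cM)).
apply/near0P; exists r => // z zr.
apply: (@le_trans _ _ M); last by rewrite lerDl.
exact: has_sum_norm_le (cf z zr) (nrm_abs (nrm_mono (lt_const_mx zr) cM)).
Qed.

Definition kill (Q : pred 'I_n) z : 'rV[C]_n := \row_i (if Q i then 0 else z 0 i).

(** By the identity theorem, applied to the restriction of f along [kill Q], every monomial of f
    contains a variable in Q. [S] picks one for each exponent, and q i collects the monomials
    assigned to i, divided by the i-th variable. *)
Lemma hol_vanish (Q : pred 'I_n) f : hol_at f 0 ->
  (\forall z \near (0 : 'rV[C]_n), f (kill Q z) = 0) ->
  exists q : 'I_n -> 'rV[C]_n -> C, (forall i, hol_at (q i) 0) /\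
    \forall z \near (0 : 'rV[C]_n), f z = \sum_(i | Q i) z 0 i * q i z.
Proof.
move=> /hol0P[c fc] f0.
pose S a := [pick i | Q i && (0 < a i)%N].
have cS a : S a = None -> c a = 0.
  move=> Sa.
  have hk : has_ser (f \o kill Q) (fun a => if S a is None then c a else 0).
    have [r [M [r0 cM cf]]] := fc; exists r, M; split; [exact: r0| |].
      apply: nrm_sub cM => b; case: (S b) => //.
      by move=> _; rewrite normr0.
    move=> z zr; have zr' i : `|kill Q z 0 i| < r.
      by rewrite mxE; case: ifP; rewrite ?normr0.
    apply: eq_has_sum (cf _ zr') => b; rewrite /S; case: pickP => [i /andP[Qi bi]|nQ].
      rewrite mul0r /ps_monomial (bigD1 i)//= mxE Qi expr0n eqn0Ngt bi mul0r.
      by rewrite mulr0.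
    congr (_ * _); apply: eq_bigr => i _; rewrite mxE; case: ifP => // Qi.
    by have := nQ i; rewrite Qi/= lt0n => /negbFE/eqP ->; rewrite !expr0.
  by have := has_ser_eq0 hk f0 a; rewrite Sa.
pose ci (i : 'I_n) a := if S a == Some i then c a else 0.
have /choice[q qP] : forall i, exists q, has_ser q (fun a => ci i (miD a (mi1 i))).
  move=> i; apply: ser_fun; apply: convs_shift; apply: convs_sub (has_ser_convs fc).
  by move=> a; rewrite /ci; case: ifP; rewrite ?normr0.
exists q; split=> [i|]; first by apply/hol0P; eexists; exact: qP.
have [r [M [r0 cM cf]]] := fc.
have [s s0 sP] : exists2 s : C, 0 < s & forall i, forall z, (forall j, `|z 0 j| < s) ->
    has_sum (fun a => ci i (miD a (mi1 i)) * ps_monomial z a) (q i z).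
  apply: (@common_radius_fin _ _ (fun i s => forall z, (forall j, `|z 0 j| < s) ->
    has_sum (fun a => ci i (miD a (mi1 i)) * ps_monomial z a) (q i z))).
    by move=> i u v v0 vu qu z zv; apply: qu => j; exact: lt_le_trans (zv j) vu.
  by move=> i; have [u [L [u0 _ Lu]]] := qP i; exists u.
have [t [t0 tr ts]] := common_radius r0 s0.
apply/near0P; exists t => // z zt.
apply: (@has_sum_unique _ _ (fun a => c a * ps_monomial z a)).
  by apply: cf => i; exact: lt_le_trans (zt i) tr.
have hi i : has_sum (fun a => ci i a * ps_monomial z a) (z 0 i * q i z).
  apply: (has_sum_reindex (e := fun a => miD a (mi1 i))); first exact: miD_inj.
    move=> a na; rewrite /ci; case: eqP => [Sa|_]; last by rewrite mul0r.
    have : mile (mi1 i) a.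
      by rewrite mi1_le; move: Sa; rewrite /S; case: pickP => // j /andP[_ aj] [<-].
    by move/miBK => ab; have := na (miB a (mi1 i)); rewrite ab eqxx.
  have zs j : `|z 0 j| < s by exact: lt_le_trans (zt j) ts.
  have := has_sumZ (z 0 i) (sP i z zs).
  by apply: eq_has_sum => a /=; rewrite monD mon1 [LHS]mulrC mulrA.
have hs (l : seq 'I_n) : has_sum (fun a => \sum_(i <- l | Q i) ci i a * ps_monomial z a)
    (\sum_(i <- l | Q i) z 0 i * q i z).
  elim: l => [|i l IH].
    by rewrite big_nil; under eq_fun do rewrite big_nil; exact: has_sum0.
  rewrite big_cons; under eq_fun do rewrite big_cons.
  by case: ifP => // _; exact: has_sumD.
apply: eq_has_sum (hs _) => a; rewrite -mulr_suml; congr (_ * _).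
case Sa : (S a) => [i|]; last by rewrite cS// big1// => i _; rewrite /ci Sa.
have Qi : Q i by move: Sa; rewrite /S; case: pickP => // j /andP[Qj _] [<-].
rewrite (bigD1 i)//= {1}/ci Sa eqxx big1 ?addr0// => j /andP[_ ji].
by rewrite /ci Sa ifN//; apply: contra ji => /eqP[->].
Qed.

Lemma hol_vanish0 f : hol_at f 0 -> f 0 = 0 ->
  exists q : 'I_n -> 'rV[C]_n -> C, (forall i, hol_at (q i) 0) /\
    \forall z \near (0 : 'rV[C]_n), f z = \sum_i z 0 i * q i z.
Proof.
move=> hf f0; apply: (hol_vanish (Q := xpredT) hf).
apply: near0W.
by move=> z; rewrite -[RHS]f0; congr f; apply/rowP => i; rewrite !mxE.
Qed.

Lemma hol_cont f : hol_at f 0 -> forall e : C, 0 < e ->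
  \forall z \near (0 : 'rV[C]_n), `|f z - f 0| < e.
Proof.
move=> hf e e0.
have [||q [hq fq]] := @hol_vanish0 (fun z => f z - f 0).
- by apply: holB hf _; exact: hol_cst.
- exact: subrr.
have [s s0 sP] : exists2 s : C, 0 < s & forall i, forall z, (forall j, `|z 0 j| < s) ->
    `|z 0 i * q i z| <= e / n.+1%:R.
  apply: (@common_radius_fin _ _ (fun i s => forall z, (forall j, `|z 0 j| < s) ->
    `|z 0 i * q i z| <= e / n.+1%:R)).
    by move=> i u v v0 vu qu z zv; apply: qu => j; exact: lt_le_trans (zv j) vu.
  move=> i; have [M M0 /near0P[u u0 qM]] := hol_bounded (hq i).
  have d0 : 0 < e / n.+1%:R / M by rewrite !divr_gt0.
  have [t [t0 tu td]] := common_radius u0 d0.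
  exists t; split=> // z zt; rewrite normrM.
  apply: (@le_trans _ _ (e / n.+1%:R / M * M)); last by rewrite divfK// gt_eqF.
  apply: ler_pM => //; first by apply/ltW/(lt_le_trans (zt i)).
  by apply: qM => j; exact: lt_le_trans (zt j) tu.
have := fq; apply: filterS2; last by apply/near0P; exists s; [exact: s0|move=> z zs; exact: zs].
move=> z /= zs -> .
apply: (@le_lt_trans _ _ (\sum_(i < n) e / n.+1%:R)).
  by apply: le_trans (ler_norm_sum _ _ _) _; apply: ler_sum => i _; exact: sP.
rewrite sumr_const card_ord -[X in X < _]mulr_natr mulrAC ltr_pdivrMr//.
by rewrite ltr_pM2l// ltr_nat.
Qed.

End OneGerm.

Lemma near_comp n m (F : 'rV[C]_n -> 'rV[C]_m) (P : 'rV[C]_m -> Prop) :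
  hol_map_at F 0 -> F 0 = 0 -> (\forall w \near (0 : 'rV[C]_m), P w) ->
  \forall z \near (0 : 'rV[C]_n), P (F z).
Proof.
move=> hF F0 /near0P[r r0 rP].
have [s s0 sP] : exists2 s : C, 0 < s & forall j, forall z : 'rV[C]_n, (forall i, `|z 0 i| < s) ->
    `|F z 0 j| < r.
  apply: (@common_radius_fin _ _ (fun j s => forall z : 'rV[C]_n, (forall i, `|z 0 i| < s) ->
    `|F z 0 j| < r)).
    by move=> i u v v0 vu qu z zv; apply: qu => j; exact: lt_le_trans (zv j) vu.
  move=> j; have /near0P[s s0 sP] := hol_cont (hF j) r0.
  by exists s; split=> // z /sP; rewrite F0 mxE subr0.
by apply/near0P; exists s => // z zs; apply: rP => j; exact: sP.
Qed.

Lemma hol_map_comp n m k (F : 'rV[C]_n -> 'rV[C]_m) (G : 'rV[C]_m -> 'rV[C]_k) :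
  hol_map_at G 0 -> hol_map_at F 0 -> F 0 = 0 -> hol_map_at (G \o F) 0.
Proof. by move=> hG hF F0 j; exact: (hol_comp (hG j) hF F0). Qed.

Lemma hol_row_mx n m k (F : 'rV[C]_n -> 'rV[C]_m) (G : 'rV[C]_n -> 'rV[C]_k) :
  hol_map_at F 0 -> hol_map_at G 0 -> hol_map_at (fun z => row_mx (F z) (G z)) 0.
Proof.
move=> hF hG j; case: (fintype.splitP j) => i ji.
  have -> : j = lshift k i by exact/val_inj.
  by under eq_fun do rewrite row_mxEl; exact: hF.
have -> : j = rshift m i by exact/val_inj.
by under eq_fun do rewrite row_mxEr; exact: hG.
Qed.

Lemma hol_lsubmx n m : hol_map_at (fun z : 'rV[C]_(n + m) => lsubmx z) 0.
Proof. by move=> j; under eq_fun do rewrite mxE; exact: hol_coord. Qed.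

Lemma hol_rsubmx n m : hol_map_at (fun z : 'rV[C]_(n + m) => rsubmx z) 0.
Proof. by move=> j; under eq_fun do rewrite mxE; exact: hol_coord. Qed.

Lemma hol_id n : hol_map_at (id : 'rV[C]_n -> 'rV[C]_n) 0.
Proof. by move=> j; exact: hol_coord. Qed.

(** The two blocks of variables are the base point and the increment; the difference of the values
    of f vanishes where the increment does, so [hol_vanish] applies. *)
Lemma hadamard m (f : 'rV[C]_m -> C) : hol_at f 0 ->
  exists q : 'I_m -> 'rV[C]_(m + m) -> C, (forall j, hol_at (q j) 0) /\
    \forall x \near (0 : 'rV[C]_(m + m)),
      f (lsubmx x + rsubmx x) - f (lsubmx x) = \sum_j rsubmx x 0 j * q j x.
Proof.
move=> hf; pose Q (i : 'I_(m + m)) := (m <= i)%N.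
have hl := @hol_lsubmx m m; have hr := @hol_rsubmx m m.
have hlr : hol_map_at (fun x : 'rV[C]_(m + m) => lsubmx x + rsubmx x) 0.
  by move=> j; under eq_fun do rewrite mxE; apply: holD; [exact: hl|exact: hr].
have [||q [hq qP]] := @hol_vanish _ Q (fun x => f (lsubmx x + rsubmx x) - f (lsubmx x)).
- apply: holB; first by apply: (hol_comp hf hlr); rewrite !linear0 addr0.
  by apply: (hol_comp hf hl); rewrite linear0.
- apply: near0W => x; rewrite (_ : rsubmx _ = 0) ?addr0 ?subrr//.
  by apply/rowP => j; rewrite !mxE /Q /= leq_addr.
exists (fun j => q (rshift m j)); split=> [j|]; first exact: hq.
apply: filterS qP => x ->; rewrite big_split_ord/= big1 ?add0r; last first.
  by move=> i; rewrite /Q/= leqNgt ltn_ord.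
rewrite big_mkcond; apply: eq_bigr => j _.
by rewrite /Q/= leq_addr mxE.
Qed.

End HolCalculus.

(** * Ideals and morphisms of germs *)

Section Ideals.
Variable R : realType.
Local Notation C := (Cplx R).
Implicit Types X Y Z S T : germ R.

Definition mkh n (f : 'rV[C]_n -> C) (hf : hol_at f 0) : hfun R n :=
  @HFun R n f (asboolT hf).

Lemma hfun_hol n (f : hfun R n) : hol_at f 0.
Proof. by case: f => f fP; exact: asboolW fP. Qed.

Section OneIdeal.
Variable X : germ R.
Local Notation n := (edim X).
Local Notation I := (germ_ideal X).
Implicit Types (f g a : 'rV[C]_n -> C).

Lemma ideal_near f g : (\forall z \near (0 : 'rV[C]_n), f z = g z) -> I f -> I g.
Proof.
move=> fg [k [a [e [eX fE]]]]; exists k, a, e; split=> //.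
by apply: near0S2 fg fE => z ->.
Qed.

Lemma ideal_hol f : I f -> hol_at f 0.
Proof.
move=> [k [a [e [eX fE]]]].
apply: (@hol_near _ _ (fun z => \sum_i a i z * e i z)).
  by apply: near0S fE => z ->.
by apply: hol_sum => i _; apply: holMr; exact: hfun_hol.
Qed.

Lemma ideal_eqs e : eqs X e -> I e.
Proof.
move=> eX; exists 1%N, (fun=> 1), (fun=> e); split=> //.
by apply: near0W => z; rewrite big_ord1 mul1r.
Qed.

Lemma idealMD a f g : hol_at a 0 -> I f -> I g -> I (fun z => a z * f z + g z).
Proof.
move=> ha If Ig; have [_ _ cl] := @in_germ_ideal_closed R X.
have := cl (mkh ha) (mkh (ideal_hol If)) (mkh (ideal_hol Ig)).
by move=> /(_ (asboolT If) (asboolT Ig))/asboolP.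
Qed.

Lemma ideal0 : I (fun=> 0).
Proof. by have [/asboolP] := @in_germ_ideal_closed R X. Qed.

Lemma idealM a f : hol_at a 0 -> I f -> I (fun z => a z * f z).
Proof.
move=> ha If; have := idealMD ha If ideal0.
by under eq_fun do rewrite addr0.
Qed.

Lemma idealD f g : I f -> I g -> I (fun z => f z + g z).
Proof.
move=> If Ig; have := idealMD (hol_cst 1 _) If Ig.
by under eq_fun do rewrite mul1r.
Qed.

Lemma idealN f : I f -> I (fun z => - f z).
Proof.
move=> If; have := idealM (hol_cst (-1) _) If.
by under eq_fun do rewrite mulN1r.
Qed.

Lemma idealB f g : I f -> I g -> I (fun z => f z - g z).
Proof. by move=> If Ig; exact: idealD If (idealN Ig). Qed.

Lemma ideal_sum (K : Type) (s : seq K) (P : pred K) (F : K -> 'rV[C]_n -> C) :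
  (forall i, P i -> I (F i)) -> I (fun z => \sum_(i <- s | P i) F i z).
Proof.
move=> hF; elim: s => [|i s IH].
  by under eq_fun do rewrite big_nil; exact: ideal0.
under eq_fun do rewrite big_cons; have [Pi|//] := boolP (P i).
by apply: idealD IH; exact: hF.
Qed.

Lemma ideal_at0 f : I f -> f 0 = 0.
Proof.
move=> [k [a [e [eX /nbhs_singleton ->]]]].
by rewrite big1// => i _; rewrite (eqs0 _ _ (eX i)) mulr0.
Qed.

Lemma ideal_ind (J : set ('rV[C]_n -> C)) :
  (forall f g, (\forall z \near (0 : 'rV[C]_n), f z = g z) -> J f -> J g) ->
  J (fun=> 0) -> (forall f g, J f -> J g -> J (fun z => f z + g z)) ->
  (forall a e, hol_at a 0 -> eqs X e -> J (fun z => a z * e z)) ->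
  I `<=` J.
Proof.
move=> Jn J0 JD JM f [k [a [e [eX fE]]]].
apply: (Jn (fun z => \sum_i a i z * e i z)); first by apply: near0S fE => z ->.
elim: (index_enum _) => [|i s IH]; first by under eq_fun do rewrite big_nil.
under eq_fun do rewrite big_cons; apply: JD IH; apply: JM => //.
exact: hfun_hol.
Qed.

End OneIdeal.

Section Morphisms.

Lemma ideal_comp X Y (F : 'rV[C]_(edim X) -> 'rV[C]_(edim Y)) f :
  is_mor X Y F -> germ_ideal Y f -> germ_ideal X (f \o F).
Proof.
move=> [hF F0 FI]; move: f; apply: ideal_ind => [f g fg|| f g|a e ha eY].
- by apply: ideal_near; exact: (near_comp hF F0 fg).
- exact: ideal0.
- exact: idealD.
- by apply: idealM; [exact: hol_comp ha hF F0|exact: FI].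
Qed.

Lemma is_mor_id X : is_mor X X id.
Proof. by split=> [||e eX]; [exact: hol_id|by []|exact: ideal_eqs]. Qed.

Lemma is_mor_comp X Y Z (F : 'rV[C]_(edim X) -> 'rV[C]_(edim Y))
    (G : 'rV[C]_(edim Y) -> 'rV[C]_(edim Z)) :
  is_mor X Y F -> is_mor Y Z G -> is_mor X Z (G \o F).
Proof.
move=> mF [hG G0 GI]; have [hF F0 _] := mF; split.
- exact: hol_map_comp.
- by rewrite /= F0 G0.
- by move=> e /GI h; exact: (ideal_comp mF h).
Qed.

Lemma eq_mor_refl X m (F : 'rV[C]_(edim X) -> 'rV[C]_m) : eq_mor X F F.
Proof. by move=> f; under eq_fun do rewrite subrr; exact: ideal0. Qed.

Lemma eq_mor_sym X m (F G : 'rV[C]_(edim X) -> 'rV[C]_m) :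
  eq_mor X F G -> eq_mor X G F.
Proof. by move=> FG f; have := idealN (FG f); under eq_fun do rewrite opprB. Qed.

Lemma eq_mor_trans X m (F G H : 'rV[C]_(edim X) -> 'rV[C]_m) :
  eq_mor X F G -> eq_mor X G H -> eq_mor X F H.
Proof.
move=> FG GH f; have := idealD (FG f) (GH f).
by under eq_fun do rewrite addrA subrK.
Qed.

Lemma eq_mor_pre X Z m (F G : 'rV[C]_(edim X) -> 'rV[C]_m)
    (w : 'rV[C]_(edim Z) -> 'rV[C]_(edim X)) :
  is_mor Z X w -> eq_mor X F G -> eq_mor Z (F \o w) (G \o w).
Proof. by move=> mw FG f; exact: (ideal_comp mw (FG f)). Qed.

Lemma eq_mor_post X m k (F G : 'rV[C]_(edim X) -> 'rV[C]_m)
    (H : 'rV[C]_m -> 'rV[C]_k) :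
  hol_map_at H 0 -> H 0 = 0 -> eq_mor X F G -> eq_mor X (H \o F) (H \o G).
Proof. by move=> hH H0 FG f; exact: (FG (mkh (hol_comp (hfun_hol f) hH H0))). Qed.

Lemma eq_mor_coord X m (F G : 'rV[C]_(edim X) -> 'rV[C]_m) j :
  eq_mor X F G -> germ_ideal X (fun z => F z 0 j - G z 0 j).
Proof. by move/(_ (mkh (@hol_coord R m j))). Qed.

Lemma eq_mor_hol X m (F G : 'rV[C]_(edim X) -> 'rV[C]_m) :
  eq_mor X F G -> hol_map_at F 0 -> F 0 = 0 -> hol_map_at G 0 /\ G 0 = 0.
Proof.
move=> FG hF F0; split=> [j|].
  have := holB (hF j) (ideal_hol (eq_mor_coord j FG)).
  by under eq_fun do rewrite opprB addrCA subrr addr0.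
apply/rowP => j; have := ideal_at0 (eq_mor_coord j FG).
by rewrite F0 => /eqP; rewrite subr_eq0 => /eqP.
Qed.

(** By Hadamard's lemma the difference of f along F and G is a combination of the differences of
    their coordinates, so equality of morphisms can be tested on coordinates. *)
Lemma coord_eq_mor X m (F G : 'rV[C]_(edim X) -> 'rV[C]_m) :
  hol_map_at F 0 -> F 0 = 0 -> hol_map_at G 0 -> G 0 = 0 ->
  (forall j, germ_ideal X (fun z => F z 0 j - G z 0 j)) -> eq_mor X F G.
Proof.
move=> hF F0 hG G0 FG f; have [q [hq qP]] := hadamard (hfun_hol f).
pose H z := row_mx (G z) (F z - G z).
have hFG : hol_map_at (fun z => F z - G z) 0.
  by move=> j; under eq_fun do rewrite !mxE; apply: holB; [exact: hF|exact: hG].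
have hH : hol_map_at H 0 by exact: hol_row_mx.
have H0 : H 0 = 0 by rewrite /H F0 G0 subrr row_mx0.
apply: (@ideal_near _ (fun z => \sum_j q j (H z) * (F z 0 j - G z 0 j))).
  apply: near0S (near_comp hH H0 qP) => z.
  rewrite row_mxKl row_mxKr [G z + _]addrC subrK => ->; apply: eq_bigr => j _.
  by rewrite !mxE mulrC.
apply: ideal_sum => j _; apply: idealM => //; exact: (hol_comp (hq j) hH H0).
Qed.

End Morphisms.
End Ideals.

(** * Flat base change *)

Section FlatBaseChange.
Variables (A A' : comNzRingType) (p : {rmorphism A -> A'}).

Section Restriction.
Variable N : lmodType A'.

(** Restriction of scalars along p, on a copy of N, so that the two module structures do not
    compete. *)
Definition restr : Type := N.

HB.instance Definition _ := GRing.Zmodule.on restr.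

Let scale (a : A) (x : restr) : restr := p a *: (x : N).

Let scaleA a b v : scale a (scale b v) = scale (a * b) v.
Proof. by rewrite /scale scalerA rmorphM. Qed.
Let scale1 : left_id 1 scale.
Proof. by move=> v; rewrite /scale rmorph1 scale1r. Qed.
Let scaleDr : right_distributive scale +%R.
Proof. by move=> a u v; rewrite /scale scalerDr. Qed.
Let scaleDl v : {morph scale^~ v : a b / a + b}.
Proof. by move=> a b; rewrite /scale rmorphD scalerDl. Qed.

HB.instance Definition _ := GRing.Zmodule_isLmodule.Build A restr
  scaleA scale1 scaleDr scaleDl.

Lemma restr_scale a (x : restr) : a *: x = p a *: (x : N).
Proof. by []. Qed.

End Restriction.

Section Torsion.
Variable P : lmodType A.

(* An A-linear map between an A'-module and P takes its values in this
   submodule, which is an A'-module; it is what allows to test universal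
   properties over A' against arbitrary A-modules. *)
Definition tors : {pred P} := fun x => `[< forall a, p a = 0 -> a *: x = 0 >].

Lemma tors_closed : zmod_closed tors.
Proof.
split=> [|x y /asboolP xt /asboolP yt]; apply/asboolP => a pa.
  by rewrite scaler0.
by rewrite scalerBr xt// yt// subr0.
Qed.

HB.instance Definition _ := GRing.isZmodClosed.Build P tors tors_closed.

Record torsion := Torsion { tval :> P; tvalP : tval \in tors }.

HB.instance Definition _ := [isSub for tval].
HB.instance Definition _ := [Choice of torsion by <:].
HB.instance Definition _ := [SubChoice_isSubZmodule of torsion by <:].

Variables (p' : A' -> A) (pK : cancel p' p).

(** The argument records in the type the section p' of p, which is a mere map of sets; on [tors] the
    choice of lifts does not affect the scalar multiplication, by [tors_congr]. *)
Definition torsmod (_ : cancel p' p) : Type := torsion.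
Local Notation M := (torsmod pK).

HB.instance Definition _ := GRing.Zmodule.on M.

Lemma tors_scale a (x : P) : x \in tors -> a *: x \in tors.
Proof.
move=> /asboolP xt; apply/asboolP => b pb.
by rewrite scalerA mulrC -scalerA xt// scaler0.
Qed.

Lemma tors_congr a b (x : P) : x \in tors -> p a = p b -> a *: x = b *: x.
Proof.
move=> /asboolP xt pab; apply/eqP; rewrite -subr_eq0 -scalerBl.
by rewrite xt// rmorphB pab subrr.
Qed.

Let scale (a : A') (x : M) : M := Torsion (tors_scale (p' a) (tvalP x)).

Let scaleA a b v : scale a (scale b v) = scale (a * b) v.
Proof.
apply: val_inj => /=; rewrite scalerA; apply: tors_congr (tvalP v) _.
by rewrite rmorphM !pK.
Qed.
Let scale1 : left_id 1 scale.
Proof.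
move=> v; apply: val_inj => /=; rewrite -[RHS]scale1r.
by apply: tors_congr (tvalP v) _; rewrite rmorph1 pK.
Qed.
Let scaleDr : right_distributive scale +%R.
Proof. by move=> a u v; apply: val_inj; rewrite /= scalerDr. Qed.
Let scaleDl v : {morph scale^~ v : a b / a + b}.
Proof.
move=> a b; apply: val_inj; rewrite /= -scalerDl.
by apply: tors_congr (tvalP v) _; rewrite rmorphD !pK.
Qed.

HB.instance Definition _ := GRing.Zmodule_isLmodule.Build A' M
  scaleA scale1 scaleDr scaleDl.

Lemma tval_scale a (x : M) : tval (a *: x) = p' a *: tval x.
Proof. by []. Qed.

Lemma tval_add (x y : M) : tval (x + y) = tval x + tval y.
Proof. by []. Qed.

End Torsion.

Definition mkLin (K : comNzRingType) (V W : lmodType K) (f : V -> W)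
    (hf : linear f) : {linear V -> W} :=
  HB.pack f (GRing.isLinear.Build K V W *:%R f hf).

Variables (B B' : comNzRingType) (q : {rmorphism B -> B'}).
Variables (phi : {rmorphism A -> B}) (phi' : {rmorphism A' -> B'}).
Hypothesis p_surj : forall a', exists a, p a = a'.
Hypothesis q_surj : forall b', exists b, q b = b'.
Hypothesis sq : forall a, phi' (p a) = q (phi a).
Hypothesis kerq : forall b, q b = 0 -> exists k (c : 'I_k -> B) (a : 'I_k -> A),
  (forall i, p (a i) = 0) /\ b = \sum_i c i * phi (a i).

(** The hypotheses say that A' is a quotient of A and that B' is the base change of B to A'. So an
    A-bilinear map s on B and N vanishes on the kernel of q and takes its values in [tors]: it
    descends to an A'-bilinear map, to which the universal property over A' applies. *)
Lemma tensor_restr (N T : lmodType A') (t : B' -> N -> T) :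
  is_tensor phi' t -> @is_tensor A B phi (restr N) (restr T) (fun b n => t (q b) n).
Proof.
have [p' pK] := choice p_surj; have [q' qK] := choice q_surj.
move=> [[tDl tDr tZl tZr] t_univ]; split.
  split=> [b b' n|b n n'|a b n|a b n].
  - by rewrite rmorphD tDl.
  - exact: tDr.
  - by rewrite rmorphM -sq tZl.
  - by rewrite !restr_scale tZr.
move=> P s [sDl sDr sZl sZr].
have sB b b' n : s (b - b') n = s b n - s b' n.
  by apply/eqP; rewrite eq_sym subr_eq -sDl subrK.
have s0n b : s b 0 = 0 by apply: (addrI (s b 0)); rewrite -sDr !addr0.
have s0b n : s 0 n = 0 by apply: (addrI (s 0 n)); rewrite -sDl !addr0.
have st b n : s b n \in @tors P.
  apply/asboolP => a pa; rewrite -sZr.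
  by rewrite (_ : a *: n = 0)// restr_scale pa scale0r.
have s_ker b n : q b = 0 -> s b n = 0.
  move=> /kerq[k [c [a [pa ->]]]].
  elim: (index_enum _) => [|i l IH]; first by rewrite big_nil.
  rewrite big_cons sDl IH addr0 mulrC sZl -sZr.
  by rewrite restr_scale pa scale0r.
have s_congr b b' n : q b = q b' -> s b n = s b' n.
  by move=> qbb'; apply/eqP; rewrite -subr_eq0 -sB s_ker// rmorphB qbb' subrr.
pose s' (b : B') (n : N) : torsmod P pK := Torsion (st (q' b) n).
have s'_bil : bilinear_over phi' s'.
  split=> [b b' n|b n n'|a b n|a b n]; apply: val_inj => /=.
  - by rewrite -sDl; apply: s_congr; rewrite rmorphD !qK.
  - exact: sDr.
  - by rewrite -sZl; apply: s_congr; rewrite rmorphM -sq !qK pK.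
  - by rewrite -sZr restr_scale pK.
have [[h hE] h_uniq] := t_univ _ s' s'_bil.
split.
  have hlin : linear (fun x : restr T => tval (h x) : P).
    move=> a x y; rewrite restr_scale linearP tval_add tval_scale.
    congr (_ + _); apply: tors_congr (tvalP _) _.
    by rewrite pK.
  exists (mkLin hlin) => b n /=; rewrite hE /=.
  by apply: s_congr; rewrite qK.
move=> h1 h2 h12.
have ht (g : {linear restr T -> P}) x : g x \in @tors P.
  apply/asboolP => a pa; rewrite -linearZ/=.
  by rewrite restr_scale pa scale0r linear0.
have glin (g : {linear restr T -> P}) :
    linear (fun x : T => Torsion (ht g x) : torsmod P pK).
  move=> a x y; apply: val_inj => /=; rewrite -linearZ/= restr_scale pK.
  exact: (raddfD g).
pose G g := mkLin (glin g).
have GG : forall b n, G h1 (t b n) = G h2 (t b n).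
  by move=> b n; apply: val_inj; rewrite /= -(qK b) h12.
have G12 := h_uniq (G h1) (G h2) GG.
by move=> x; have := congr1 (@tval P) (G12 x).
Qed.

(** Tensor products over A' are tensor products over A of the restricted modules, and restriction
    preserves injectivity. *)
Lemma flat_base_change : flat_algebra phi -> flat_algebra phi'.
Proof.
move=> flat N N' u u_inj T T' t t' tT tT' w wt.
have ulin : linear (u : restr N -> restr N').
  by move=> a x y; rewrite restr_scale linearP.
have wlin : linear (w : restr T -> restr T').
  by move=> a x y; rewrite restr_scale linearP.
apply: (flat _ _ (mkLin ulin) u_inj _ _ _ _ (tensor_restr tT) (tensor_restr tT')
  (mkLin wlin)).
by move=> b n; exact: wt.
Qed.

End FlatBaseChange.

(** * Derivatives and comorphisms *)

Section Derivatives.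
Variable R : realType.
Local Notation C := (Cplx R).

Lemma dnbhs0P (P : C -> Prop) :
  (exists d : C, 0 < d /\ forall h, h != 0 -> `|h| < d -> P h) ->
  \forall h \near (0 : C)^', P h.
Proof.
move=> [d [d0 dP]]; apply/nbhs_ballP; exists d => //= h.
rewrite -ball_normE/= sub0r normrN => hd h0; exact: dP.
Qed.

Lemma scale_small n (v : 'rV[C]_n) (r : C) : 0 < r ->
  exists d : C, 0 < d /\ forall h : C, `|h| < d -> forall i, `|(h *: v) 0 i| < r.
Proof.
move=> r0; pose s := 1 + \sum_i `|v 0 i|.
have s0 : 0 < s by rewrite ltr_wpDr ?sumr_ge0.
exists (r / s); split; first exact: divr_gt0.
move=> h hd i; rewrite mxE normrM.
apply: (@le_lt_trans _ _ (`|h| * s)); last by rewrite -ltr_pdivlMr.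
rewrite ler_wpM2l// /s (bigD1 i)//= addrCA lerDl addr_ge0// sumr_ge0//.
Qed.

(** The difference quotient along v is exactly the value at h v of the germ [g] built from the q i,
    which is continuous at 0. *)
Lemma quotient_lim n (f : 'rV[C]_n -> C) (q : 'I_n -> 'rV[C]_n -> C)
    (v : 'rV[C]_n) (e : C) :
  (forall i, hol_at (q i) 0) ->
  (\forall z \near (0 : 'rV[C]_n), f z = f 0 + \sum_i z 0 i * q i z) ->
  0 < e -> exists d : C, 0 < d /\ forall h, h != 0 -> `|h| < d ->
      `|\sum_i v 0 i * q i 0 - h^-1 * (f (h *: v + 0) - f 0)| < e.
Proof.
move=> hq fq e0; pose g (z : 'rV[C]_n) := \sum_i v 0 i * q i z.
have hg : hol_at g 0.
  by apply: hol_sum => i _; apply: holMr; [exact: hol_cst|exact: hq].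
have /near0P[r r0 rP] := near0S2 (fun z a b => conj a b) fq (hol_cont hg e0).
have [d [d0 dP]] := scale_small v r0.
exists d; split=> // h h0 hd; have [fE gz] := rP _ (dP h hd).
rewrite addr0 fE [f 0 + _]addrC addrK (_ : h^-1 * _ = g (h *: v)); first by rewrite distrC.
rewrite mulr_sumr; apply: eq_bigr => i _.
by rewrite mxE !mulrA mulVf// mul1r.
Qed.

Lemma hol_expand n (f : 'rV[C]_n -> C) : hol_at f 0 ->
  exists q : 'I_n -> 'rV[C]_n -> C, (forall i, hol_at (q i) 0) /\
    \forall z \near (0 : 'rV[C]_n), f z = f 0 + \sum_i z 0 i * q i z.
Proof.
move=> hf.
have [||q [hq fq]] := @hol_vanish0 _ _ (fun z => f z - f 0).
- by apply: holB hf _; exact: hol_cst.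
- exact: subrr.
exists q; split; [exact: hq|by apply: near0S fq => z <-; rewrite addrC subrK].
Qed.

Lemma derive_expand n (f : 'rV[C]_n -> C) (q : 'I_n -> 'rV[C]_n -> C) v :
  (forall i, hol_at (q i) 0) ->
  (\forall z \near (0 : 'rV[C]_n), f z = f 0 + \sum_i z 0 i * q i z) ->
  'D_v f 0 = \sum_i v 0 i * q i 0.
Proof.
move=> hq fq; rewrite /derive; apply: cvg_lim; first exact: norm_hausdorff.
apply/cvgrPdist_lt => e e0; apply: dnbhs0P.
have [d [d0 dP]] := quotient_lim v hq fq e0.
by exists d; split=> // h h0 hd; exact: dP.
Qed.

Lemma derive_near n (f g : 'rV[C]_n -> C) v : hol_at f 0 ->
  (\forall z \near (0 : 'rV[C]_n), f z = g z) -> 'D_v f 0 = 'D_v g 0.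
Proof.
move=> /hol_expand[q [hq fq]] fg; rewrite (derive_expand v hq fq).
apply/esym/derive_expand => //; have fg0 := nbhs_singleton fg.
by apply: near0S2 fq fg => z; rewrite fg0 => -> ->.
Qed.

Lemma derive_add n (f g : 'rV[C]_n -> C) v : hol_at f 0 -> hol_at g 0 ->
  'D_v (fun z => f z + g z) 0 = 'D_v f 0 + 'D_v g 0.
Proof.
move=> /hol_expand[q [hq fq]] /hol_expand[r [hr gr]].
rewrite (derive_expand v hq fq) (derive_expand v hr gr) -big_split/=.
rewrite (derive_expand (q := fun i z => q i z + r i z)).
- by apply: eq_bigr => i _; rewrite mulrDr.
- by move=> i; exact: holD (hq i) (hr i).
apply: near0S2 fq gr => z -> ->; rewrite addrACA -big_split/=.
by congr (_ + _); apply: eq_bigr => i _; rewrite mulrDr.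
Qed.

Lemma derive_mul0 n (a f : 'rV[C]_n -> C) v : hol_at a 0 -> hol_at f 0 ->
  f 0 = 0 -> 'D_v (fun z => a z * f z) 0 = a 0 * 'D_v f 0.
Proof.
move=> ha /hol_expand[q [hq fq]] f0; rewrite (derive_expand v hq fq).
rewrite (derive_expand (q := fun i z => a z * q i z)).
- by rewrite mulr_sumr; apply: eq_bigr => i _ /=; rewrite mulrCA.
- by move=> i; exact: holMr ha (hq i).
apply: near0S fq => z ->; rewrite f0 mulr0 !add0r mulr_sumr.
by apply: eq_bigr => i _; rewrite mulrCA.
Qed.

Lemma hol_derive_sum n k (f : 'I_k -> 'rV[C]_n -> C) v : (forall i, hol_at (f i) 0) ->
  'D_v (fun z => \sum_i f i z) 0 = \sum_i 'D_v (f i) 0.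
Proof.
move=> hf; elim: (index_enum _) => [|i s IH].
  rewrite big_nil; under eq_fun do rewrite big_nil.
  rewrite (derive_expand (q := fun _ _ => 0)).
  - by rewrite big1// => i _; rewrite mulr0.
  - by move=> i; exact: hol_cst.
  by apply: near0W => z; rewrite big1 ?addr0// => i _; rewrite mulr0.
rewrite big_cons; under eq_fun do rewrite big_cons.
by rewrite derive_add ?IH//; exact: hol_sum.
Qed.

Lemma derive_row n m (F : 'rV[C]_n -> 'rV[C]_m) v : hol_map_at F 0 ->
  forall j, ('D_v F 0) 0 j = 'D_v (fun z => F z 0 j) 0.
Proof.
move=> hF.
have [L LP] : exists L : 'rV[C]_m, forall j e, 0 < e -> exists d : C, 0 < d /\
      forall h, h != 0 -> `|h| < d ->
      `|L 0 j - h^-1 * (F (h *: v + 0) 0 j - F 0 0 j)| < e.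
  have /choice[q qP] := fun j => hol_expand (hF j).
  exists (\row_j \sum_i v 0 i * q j i 0) => j e e0; rewrite mxE.
  by have [hq fq] := qP j; exact: (quotient_lim v hq fq e0).
have -> : 'D_v F 0 = L.
  rewrite /derive; apply: cvg_lim; first exact: norm_hausdorff.
  apply/cvg_ballP => e e0; apply: dnbhs0P.
  have [d d0 dP] : exists2 d : C, 0 < d & forall j, forall h, h != 0 -> `|h| < d ->
      `|L 0 j - h^-1 * (F (h *: v + 0) 0 j - F 0 0 j)| < e.
    apply: (@common_radius_fin _ _ (fun j d => forall h, h != 0 -> `|h| < d ->
      `|L 0 j - h^-1 * (F (h *: v + 0) 0 j - F 0 0 j)| < e)).
      by move=> j r s s0 sr rP h h0 hs; apply: rP => //; exact: lt_le_trans hs sr.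
    by move=> j; exact: LP.
  exists d; split=> // h h0 hd; split=> // i j.
  by rewrite ord1 -ball_normE/= !mxE; exact: dP.
move=> j; rewrite /derive; apply/esym/cvg_lim; first exact: norm_hausdorff.
apply/cvgrPdist_lt => e e0; apply: dnbhs0P; have [d [d0 dP]] := LP j e e0.
by exists d; split=> // h h0 hd; exact: dP.
Qed.

End Derivatives.

Section Comorphisms.
Variable R : realType.
Local Notation C := (Cplx R).
Implicit Types X Y : germ R.

Lemma germ_classP X (f g : hfun R (edim X)) :
  germ_class X f = germ_class X g <-> germ_ideal X (fun z => f z - g z).
Proof.
rewrite /germ_class; split=> [/eqP|fg].
  by rewrite -Quotient.idealrBE => /asboolP.
by apply/eqP; rewrite -Quotient.idealrBE; apply/asboolP.
Qed.

Lemma germ_classE X (x : local_ring X) : exists f, x = germ_class X f.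
Proof. by exists (repr x); rewrite /germ_class reprK. Qed.

Lemma germ_classB X (f g : hfun R (edim X)) :
  germ_class X (f - g) = germ_class X f - germ_class X g.
Proof. exact: rmorphB. Qed.

Lemma germ_classM X (f g : hfun R (edim X)) :
  germ_class X (f * g) = germ_class X f * germ_class X g.
Proof. exact: rmorphM. Qed.

Lemma germ_class1 X : germ_class X 1 = 1.
Proof. exact: rmorph1. Qed.

Lemma germ_class0 X : germ_class X 0 = 0.
Proof. exact: rmorph0. Qed.

Lemma germ_class_sum X k (f : 'I_k -> hfun R (edim X)) :
  germ_class X (\sum_i f i) = \sum_i germ_class X (f i).
Proof. exact: rmorph_sum. Qed.

Section Comorphism.
Variables (X Y : germ R) (F : 'rV[C]_(edim X) -> 'rV[C]_(edim Y)).
Hypothesis mF : is_mor X Y F.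

Let pull_hol (f : hfun R (edim Y)) : hol_at (f \o F) 0.
Proof. by have [hF F0 _] := mF; exact: hol_comp (hfun_hol f) hF F0. Qed.

Definition pull f : hfun R (edim X) := mkh (pull_hol f).

Definition comorph_of (x : local_ring Y) : local_ring X :=
  germ_class X (pull (repr x)).

Lemma comorph_class f : comorph_of (germ_class Y f) = germ_class X (pull f).
Proof.
apply/germ_classP.
have /germ_classP h : germ_class Y (repr (germ_class Y f)) = germ_class Y f.
  by rewrite /germ_class reprK.
exact: (ideal_comp mF h).
Qed.

Lemma comorph_zmod : zmod_morphism comorph_of.
Proof.
move=> x y; have [f ->] := germ_classE x; have [g ->] := germ_classE y.
rewrite -germ_classB !comorph_class -germ_classB; congr germ_class.
exact: val_inj.
Qed.

Lemma comorph_monoid : monoid_morphism comorph_of.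
Proof.
split=> [|x y].
  rewrite -(germ_class1 Y) comorph_class -(germ_class1 X); congr germ_class.
  exact: val_inj.
have [f ->] := germ_classE x; have [g ->] := germ_classE y.
rewrite -germ_classM !comorph_class -germ_classM; congr germ_class.
exact: val_inj.
Qed.

HB.instance Definition _ := GRing.isZmodMorphism.Build _ _ comorph_of comorph_zmod.
HB.instance Definition _ := GRing.isMonoidMorphism.Build _ _ comorph_of comorph_monoid.

Definition comorph : {rmorphism local_ring Y -> local_ring X} := comorph_of.

End Comorphism.

End Comorphisms.

(** * Restriction of a deformation to a tangent direction *)

Section ZeroMorphism.
Variable R : realType.
Local Notation C := (Cplx R).
Implicit Types X Y Z S T : germ R.

Lemma is_mor0 X Y : is_mor X Y (fun=> 0).
Proof.
split=> [j||e eY]; [exact: hol_cst|by []|].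
apply: ideal_near (ideal0 X); apply: near0W => z /=.
by rewrite (eqs0 _ _ eY).
Qed.

Lemma hfun_sumE n k (f : 'I_k -> hfun R n) z : (\sum_i f i) z = \sum_i f i z.
Proof. by apply: (big_morph (fun h : hfun R n => h z)). Qed.

End ZeroMorphism.

Section TangentDeformation.
Variable R : realType.
Local Notation C := (Cplx R).
Local Notation D := (double_point R).
Variables (X S : germ R) (xi : predeformation X S).
Local Notation m := (edim S).
Local Notation XX := (total_space xi).
Local Notation pr := (def_proj xi).
Local Notation inc := (def_incl xi).
Hypothesis def_xi : is_deformation xi.
Variables (v : 'rV[C]_m) (j0 : 'I_m).
Hypotheses (vT : tangent_space S v) (vj0 : v 0 j0 != 0).

Let pr_mor : is_mor XX S pr. Proof. by case: def_xi. Qed.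

Definition tangent_map (t : 'rV[C]_(edim D)) : 'rV[C]_m := t 0 0 *: v.

(** Since e and its derivative along v vanish at 0, the germ e (t v) is divisible by t^2, which
    generates the ideal of the double point. *)
Lemma tangent_map_mor : is_mor D S tangent_map.
Proof.
have ht : hol_map_at tangent_map 0.
  move=> j; under eq_fun do rewrite mxE.
  by apply: holMr; [exact: (@hol_coord R 1)|exact: hol_cst].
have t0 : tangent_map 0 = 0 by rewrite /tangent_map mxE scale0r.
split=> // e eS; have [q [hq eq]] := hol_expand (hfun_hol e).
have De v' := derive_expand v' hq eq.
pose g (t : 'rV[C]_1) := \sum_i v 0 i * q i (tangent_map t).
have hg : hol_at g 0.
  apply: hol_sum => i _; apply: holMr; [exact: hol_cst|].
  exact: hol_comp (hq i) ht t0.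
have g0 : g 0 = 0 by rewrite /g t0 -De; exact: vT.
have [r [hr gr]] := hol_vanish0 hg g0.
have hsq : hol_at (fun t : 'rV[C]_1 => t 0 0 * t 0 0) 0.
  by apply: holMr; exact: hol_coord.
have sqI : germ_ideal D (fun t => t 0 0 * t 0 0).
  apply: (ideal_eqs (X := D) (e := mkh hsq)).
  by exists 0, 0.
apply: (@ideal_near _ D (fun t => r 0 t * (t 0 0 * t 0 0))); last first.
  by apply: idealM sqI; exact: hr.
apply: near0S2 gr (near_comp ht t0 eq) => t gt /= ->.
rewrite (eqs0 _ _ eS) add0r.
rewrite (_ : \sum_i _ = t 0 0 * g t).
  by rewrite gt big_ord1 mulrCA [RHS]mulrC mulrA mulrC.
rewrite /g mulr_sumr; apply: eq_bigr => i _.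
by rewrite mxE mulrA.
Qed.

(** A linear form with value 1 at v. It provides a retraction of [tangent_map], which is therefore a
    closed embedding; this is what the coordinate j0 is for. *)
Definition lam (w : 'rV[C]_m) : C := w 0 j0 / v 0 j0.

Lemma hol_lam : hol_at lam 0.
Proof. by apply: holMr; [exact: hol_coord|exact: hol_cst]. Qed.

Lemma lam_tangent t : lam (tangent_map t) = t 0 0.
Proof. by rewrite /lam mxE mulfK. Qed.

(* equations, in S, of the image of the double point under [tangent_map] *)
Definition gen (i : 'I_m.+1) (w : 'rV[C]_m) : C :=
  if unlift ord0 i is Some j then lam w * v 0 j - w 0 j else lam w * lam w.

Lemma hol_gen i : hol_at (gen i) 0.
Proof.
rewrite /gen; case: (unlift ord0 i) => [j|]; last exact: holMr hol_lam hol_lam.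
apply: holB; last exact: hol_coord.
by apply: holMr hol_lam _; exact: hol_cst.
Qed.

Lemma gen0 i : gen i 0 = 0.
Proof.
rewrite /gen /lam; case: (unlift ord0 i) => [j|]; rewrite !mxE !mul0r//.
by rewrite subrr.
Qed.

Lemma gen_tangent i : germ_ideal D (gen i \o tangent_map).
Proof.
rewrite /gen; case: (unlift ord0 i) => [j|].
  apply: ideal_near (ideal0 D); apply: near0W => t /=.
  by rewrite lam_tangent !mxE subrr.
have hsq : hol_at (fun t : 'rV[C]_1 => t 0 0 * t 0 0) 0.
  by apply: holMr; exact: hol_coord.
have sqI : germ_ideal D (fun t => t 0 0 * t 0 0).
  apply: (ideal_eqs (X := D) (e := mkh hsq)).
  by exists 0, 0.
by apply: ideal_near sqI; apply: near0W => t /=; rewrite lam_tangent.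
Qed.

(** The double point being a closed subgerm of S, its fibre product with the total space needs no
    new variables: the projection to the total space is the identity of the ambient space. *)
Definition restr_eqs : set (hfun R (edim XX)) :=
  eqs XX `|` [set h | exists i, forall z, h z = gen i (pr z)].

Lemma restr_eqs0 e : restr_eqs e -> e 0 = 0.
Proof.
move=> [/eqs0//|[i ->]]; have [_ -> _] := pr_mor; exact: gen0.
Qed.

Definition restr_germ : germ R := @Germ R (edim XX) restr_eqs restr_eqs0.
Local Notation P := restr_germ.

Definition restr_proj (z : 'rV[C]_(edim P)) : 'rV[C]_(edim D) := const_mx (lam (pr z)).

Lemma restr_gen i : germ_ideal P (gen i \o pr).
Proof.
have [hp p0 _] := pr_mor.
apply: (ideal_eqs (X := P) (e := mkh (hol_comp (hol_gen i) hp p0))).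
by right; exists i.
Qed.

Lemma restr_id_mor : is_mor P XX id.
Proof.
split=> [||e eX]; [exact: hol_id|by []|].
by apply: (ideal_eqs (X := P)); left.
Qed.

Lemma restr_proj_mor : is_mor P D restr_proj.
Proof.
have [hp p0 _] := pr_mor.
split=> [j||e [i [j eE]]].
- under eq_fun do rewrite mxE.
  exact: hol_comp hol_lam hp p0.
- by rewrite /restr_proj p0 /lam; apply/rowP => j; rewrite !mxE mul0r.
apply: ideal_near (restr_gen ord0); apply: near0W => z /=.
by rewrite eE !mxE /gen unlift_none.
Qed.

Lemma restr_square : eq_mor P (pr \o id) (tangent_map \o restr_proj).
Proof.
have [hp p0 _] := pr_mor; have [ht t0 _] := tangent_map_mor.
have [hr r0 _] := restr_proj_mor.
apply: coord_eq_mor.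
- exact: hp.
- exact: p0.
- exact: hol_map_comp ht hr r0.
- by rewrite /= r0.
move=> j; have := idealN (restr_gen (lift ord0 j)); apply: ideal_near; apply: near0W => z /=.
by rewrite /gen liftK opprB !mxE.
Qed.

Lemma restr_factor Z (u : 'rV[C]_(edim Z) -> 'rV[C]_(edim XX))
    (w : 'rV[C]_(edim Z) -> 'rV[C]_(edim D)) :
  is_mor Z XX u -> is_mor Z D w -> eq_mor Z (pr \o u) (tangent_map \o w) ->
  is_mor Z P u /\ eq_mor Z (restr_proj \o u) w.
Proof.
move=> mu mw uw; have [hu u0 uI] := mu.
split.
  split=> // e [/uI//|[i eE]].
  have gw : germ_ideal Z (gen i \o (tangent_map \o w)).
    exact: (ideal_comp mw (gen_tangent i)).
  have := idealD (uw (mkh (hol_gen i))) gw.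
  by apply: ideal_near; apply: near0W => z /=; rewrite subrK eE.
have hl : hol_map_at (fun x : 'rV[C]_m => const_mx (lam x) : 'rV[C]_1) 0.
  by move=> j; under eq_fun do rewrite mxE; exact: hol_lam.
have l0 : const_mx (lam 0) = 0 :> 'rV[C]_1.
  by apply/rowP => j; rewrite !mxE /lam mxE mul0r.
apply: eq_mor_trans (eq_mor_post hl l0 uw) _.
have -> : (fun x : 'rV[C]_m => const_mx (lam x) : 'rV[C]_1) \o (tangent_map \o w) = w.
  by apply/funext => z /=; apply/rowP => j; rewrite mxE lam_tangent ord1.
exact: eq_mor_refl.
Qed.

Lemma restr_pullback : is_pullback P XX D S id restr_proj pr tangent_map.
Proof.
split; [exact: restr_id_mor|exact: restr_proj_mor|exact: restr_square|].
move=> Z u w mu mw uw; have [muP ru] := restr_factor mu mw uw.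
split; first by exists u; split=> //; exact: eq_mor_refl.
by move=> w1 w2 _ _ w12 _.
Qed.

(** Functions on the double point extend to S through [lam], so its local ring is a quotient of that
    of S; the local ring of P is the corresponding quotient of that of the total space. *)
Lemma restr_flat : flat_mor P D restr_proj.
Proof.
have [_ [phi [phiE phi_flat]] _] := def_xi.
have mp := restr_proj_mor.
exists (comorph mp); split.
  move=> f; exists (pull mp f) => //; exact: comorph_class.
have phi_class f : phi (germ_class S f) = germ_class XX (pull pr_mor f).
  have [g gE ->] := phiE f; congr germ_class; apply: val_inj.
  by apply/funext => z /=; rewrite gE.
apply: (flat_base_change (p := comorph tangent_map_mor) (q := comorph restr_id_mor)
  (phi := phi)) => //.
- move=> x; have [f ->] := germ_classE x.
  have hl : hol_map_at (fun x : 'rV[C]_m => const_mx (lam x) : 'rV[C]_1) 0.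
    by move=> j; under eq_fun do rewrite mxE; exact: hol_lam.
  have l0 : const_mx (lam 0) = 0 :> 'rV[C]_1.
    by apply/rowP => j; rewrite !mxE /lam mxE mul0r.
  exists (germ_class S (mkh (hol_comp (hfun_hol f) hl l0))).
  rewrite [LHS]comorph_class; congr germ_class; apply: val_inj.
  apply/funext => t /=; congr (f _); apply/rowP => j.
  by rewrite mxE lam_tangent ord1.
- move=> x; have [f ->] := germ_classE x; exists (germ_class XX f).
  rewrite [LHS]comorph_class; congr germ_class; exact: val_inj.
- move=> x; have [f ->] := germ_classE x.
  rewrite phi_class [comorph tangent_map_mor _]comorph_class [LHS]comorph_class.
  rewrite [RHS]comorph_class; apply/germ_classP.
  exact: (eq_mor_sym restr_square f).
move=> x; have [f ->] := germ_classE x.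
rewrite [comorph _ _]comorph_class => f0.
have fP : germ_ideal P f.
  have : germ_class P (pull restr_id_mor f) = germ_class P 0.
    by rewrite germ_class0.
  move=> /germ_classP; apply: ideal_near; apply: near0W => z /=.
  by rewrite -[LHS]/(f z - 0) subr0.
(* Modulo the ideal of the total space, a member of the ideal of P is a combination of the
   [gen i \o pr]. These are pulled back from functions on S that vanish on the double point, as the
   kernel condition of the base change demands. *)
have [c cE] : exists c : 'I_m.+1 -> hfun R (edim XX),
    germ_ideal XX (fun z => f z - \sum_i c i z * gen i (pr z)).
  pose J (f : 'rV[C]_(edim P) -> C) := exists c : 'I_m.+1 -> hfun R (edim XX),
    germ_ideal XX (fun z => f z - \sum_i c i z * gen i (pr z)).
  have Jsub := @ideal_ind R P J; apply: Jsub fP.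
  - move=> g h gh [c cI]; exists c; apply: ideal_near cI.
    by apply: near0S gh => z ->.
  - exists (fun=> 0); apply: ideal_near (ideal0 XX); apply: near0W => z.
    by rewrite big1 ?subr0// => i _; rewrite -[LHS]/(0 * gen i (pr z)) mul0r.
  - move=> g h [c cI] [d dI]; exists (fun i => c i + d i).
    apply: ideal_near (idealD cI dI); apply: near0W => z.
    rewrite addrACA -opprD -big_split/=; congr (_ - _).
    by apply: eq_bigr => i _; rewrite -mulrDl.
  move=> a e ha [eX|[i0 eE]].
    have aeI : germ_ideal XX (fun z => a z * e z).
      exact: (idealM (X := XX) ha (ideal_eqs (X := XX) eX)).
    exists (fun=> 0); apply: (@ideal_near R XX) aeI; apply: near0W => z.
    by rewrite big1 ?subr0// => i _; rewrite -[LHS]/(0 * gen i (pr z)) mul0r.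
  exists (fun i => if i == i0 then mkh ha else 0).
  apply: ideal_near (ideal0 XX); apply: near0W => z.
  rewrite (bigD1 i0)//= eqxx big1 ?addr0 ?eE ?subrr// => i /negbTE ->.
  by rewrite -[LHS]/(0 * gen i (pr z)) mul0r.
exists m.+1, (fun i => germ_class XX (c i)), (fun i => germ_class S (mkh (hol_gen i))).
split=> [i|].
  rewrite [LHS]comorph_class -germ_class0; apply/germ_classP.
  apply: ideal_near (gen_tangent i); apply: near0W => t.
  by rewrite -[RHS]/(gen i (tangent_map t) - 0) subr0.
under eq_bigr do rewrite phi_class -germ_classM.
rewrite -germ_class_sum; apply/germ_classP; apply: ideal_near cE.
by apply: near0W => z; rewrite hfun_sumE.
Qed.

Definition restr_def : predeformation X D :=
  @Predeformation R X D P restr_proj inc.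

Lemma restr_deformation : is_deformation restr_def.
Proof.
have [_ _ [inc_mor z_mor inc0 univ]] := def_xi.
have tw Z (u : 'rV[C]_(edim Z) -> 'rV[C]_(edim D)) : eq_mor Z u (fun=> 0) ->
    eq_mor Z (tangent_map \o u) (fun=> 0).
  move=> u0; have [ht t0 _] := tangent_map_mor.
  have := eq_mor_post ht t0 u0.
  by rewrite (_ : tangent_map \o (fun=> 0) = fun=> 0)//; apply/funext => z /=.
have inc_sq : eq_mor X (pr \o inc) (tangent_map \o (fun=> 0)).
  rewrite (_ : tangent_map \o _ = fun=> 0) //.
  by have [_ t0 _] := tangent_map_mor; apply/funext => z /=.
have [incP incP0] := restr_factor inc_mor (is_mor0 X D) inc_sq.
split; [exact: restr_proj_mor|exact: restr_flat|split => //].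
move=> Z u w mu mw uw.
have muX : is_mor Z XX u by exact: (is_mor_comp mu restr_id_mor).
have uw' : eq_mor Z (pr \o u) (fun=> 0).
  exact: eq_mor_trans (eq_mor_pre mu restr_square) (tw _ _ uw).
have [[h [h1 h2 h3]] h_uniq] := univ Z u w muX mw uw'.
split; first by exists h.
exact: h_uniq.
Qed.

Lemma restr_pullback_of :
  pullback_of (S := S) xi restr_def tangent_map id.
Proof.
split; [exact: tangent_map_mor|exact: restr_pullback|exact: eq_mor_refl].
Qed.

End TangentDeformation.

(** * Transport of pullback squares along automorphisms *)

Section Pullbacks.
Variable R : realType.
Local Notation C := (Cplx R).
Variables P X D S : germ R.
Variables (pX : 'rV[C]_(edim P) -> 'rV[C]_(edim X)).
Variables (pD : 'rV[C]_(edim P) -> 'rV[C]_(edim D)).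
Variables (f : 'rV[C]_(edim X) -> 'rV[C]_(edim S)).
Variables (t : 'rV[C]_(edim D) -> 'rV[C]_(edim S)).
Variables (h h' : 'rV[C]_(edim P) -> 'rV[C]_(edim P)).
Variables (b b' : 'rV[C]_(edim X) -> 'rV[C]_(edim X)).
Variables (c c' : 'rV[C]_(edim S) -> 'rV[C]_(edim S)).

(** The square is moved by the automorphism b of X lying over the automorphism c of S, and by an
    automorphism h of P over D. Inverses are supplied as separate maps, being inverses only modulo
    the ideals. *)
Lemma is_pullback_transport :
  is_mor X S f -> is_mor D S t ->
  is_mor P P h -> is_mor P P h' -> eq_mor P (h' \o h) id -> eq_mor P (h \o h') id ->
  is_mor X X b -> is_mor X X b' -> eq_mor X (b' \o b) id -> eq_mor X (b \o b') id ->
  is_mor S S c -> is_mor S S c' -> eq_mor S (c' \o c) id ->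
  eq_mor P (pD \o h) pD -> eq_mor X (f \o b) (c \o f) ->
  eq_mor X (f \o b') (c' \o f) ->
  is_pullback P X D S pX pD f t -> is_pullback P X D S (b \o pX \o h) pD f (c \o t).
Proof.
move=> mf mt mh mh' h'h hh' mb mb' b'b bb' mc mc' c'c pDh fb fb'.
move=> [mpX mpD sq univ].
have [hb b0 _] := mb; have [hb' b'0 _] := mb'; have [hc c0 _] := mc.
have [hc' c'0 _] := mc'; have [hh'1 h'0 _] := mh'.
have [hpX pX0 _] := mpX.
have hpXb : is_mor P X (b \o pX \o h) by exact: is_mor_comp mh (is_mor_comp mpX mb).
split; [exact: hpXb|exact: mpD| |].
  have e1 : eq_mor P (f \o b \o (pX \o h)) (c \o f \o (pX \o h)).
    exact: eq_mor_pre (is_mor_comp mh mpX) fb.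
  apply: (eq_mor_trans e1).
  have e2 : eq_mor P (c \o (f \o pX) \o h) (c \o (t \o pD) \o h).
    exact: eq_mor_pre mh (eq_mor_post hc c0 sq).
  apply: (eq_mor_trans e2).
  have [htt t0 _] := mt.
  have hct : hol_map_at (c \o t) 0 by exact: hol_map_comp hc htt t0.
  have ct0 : (c \o t) 0 = 0 by rewrite /= t0.
  exact: (eq_mor_post hct ct0 pDh).
move=> Z u w mu mw uw.
have pDh' : eq_mor P (pD \o h') pD.
  have e1 := eq_mor_pre mh' pDh.
  have [hD D0 _] := mpD.
  have e2 := eq_mor_post hD D0 hh'.
  exact: eq_mor_trans (eq_mor_sym e1) e2.
have sq' : eq_mor Z (f \o (b' \o u)) (t \o w).
  have e1 : eq_mor Z (f \o (b' \o u)) (c' \o f \o u) by exact: eq_mor_pre mu fb'.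
  have e2 : eq_mor Z (c' \o (f \o u)) (c' \o (c \o t \o w)).
    exact: eq_mor_post hc' c'0 uw.
  have e3 : eq_mor Z (c' \o c \o (t \o w)) (id \o (t \o w)).
    exact: eq_mor_pre (is_mor_comp mw mt) c'c.
  exact: eq_mor_trans e1 (eq_mor_trans e2 e3).
have [[r [mr r1 r2]] _] := univ Z (b' \o u) w (is_mor_comp mu mb') mw sq'.
split.
  exists (h' \o r); split.
  - exact: is_mor_comp mr mh'.
  - have e1 : eq_mor Z (b \o pX \o (h \o h' \o r)) (b \o pX \o (id \o r)).
      have hbp : hol_map_at (b \o pX) 0 by exact: hol_map_comp hb hpX pX0.
      have bp0 : (b \o pX) 0 = 0 by rewrite /= pX0.
      exact: (eq_mor_post hbp bp0 (eq_mor_pre mr hh')).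
    have e2 : eq_mor Z (b \o (pX \o r)) (b \o (b' \o u)) by exact: eq_mor_post hb b0 r1.
    have e3 : eq_mor Z (b \o b' \o u) (id \o u) by exact: eq_mor_pre mu bb'.
    exact: eq_mor_trans e1 (eq_mor_trans e2 e3).
  - exact: eq_mor_trans (eq_mor_pre mr pDh') r2.
move=> w1 w2 mw1 mw2 e1 e2.
have hbK w0 : is_mor Z P w0 ->
    eq_mor Z (b' \o (b \o pX \o h \o w0)) (pX \o (h \o w0)).
  move=> mr1; apply: (@eq_mor_pre _ X Z _ (b' \o b) id (pX \o (h \o w0)) _ b'b).
  exact: is_mor_comp (is_mor_comp mr1 mh) mpX.
have mhw1 := is_mor_comp mw1 mh; have mhw2 := is_mor_comp mw2 mh.
have hw : eq_mor Z (h \o w1) (h \o w2).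
  have [_ wu] := univ Z _ _ (is_mor_comp mhw1 mpX) (is_mor_comp mhw1 mpD)
    (eq_mor_pre mhw1 sq).
  apply: wu mhw1 mhw2 _ _.
    have e3 := eq_mor_post hb' b'0 e1.
    exact: eq_mor_trans (eq_mor_sym (hbK _ mw1)) (eq_mor_trans e3 (hbK _ mw2)).
  have e3 := eq_mor_pre mw1 pDh; have e4 := eq_mor_pre mw2 pDh.
  exact: eq_mor_trans e3 (eq_mor_trans e2 (eq_mor_sym e4)).
have e3 := eq_mor_post hh'1 h'0 hw.
have e4 := eq_mor_pre mw1 h'h; have e5 := eq_mor_pre mw2 h'h.
exact: eq_mor_trans (eq_mor_sym e4) (eq_mor_trans e3 e5).
Qed.

End Pullbacks.

(** * Triviality of the action on the tangent space of the base *)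

Section TangentAction.
Variables (R : realType) (X : germ R) (G : complex_lie_group R).
Local Notation C := (Cplx R).
Local Notation D := (double_point R).
Variables (a : germ_action G X) (S : germ R) (xi : predeformation X S).
Variables (b : germ_action G (total_space xi)) (c : germ_action G S).

Lemma act_invr Y (k : germ_action G Y) g : eq_mor Y (k g \o k g^-1%g) id.
Proof.
have := eq_mor_sym (act_mapM k g g^-1%g); rewrite mulgV => e.
exact: eq_mor_trans e (act_map1 k).
Qed.

Lemma act_invl Y (k : germ_action G Y) g : eq_mor Y (k g^-1%g \o k g) id.
Proof. by have := act_invr k g^-1%g; rewrite invgK. Qed.

Lemma tangent_double_point (u : 'rV[C]_(edim D)) : tangent_space D u.
Proof.
move=> e [i [j eE]].
rewrite (derive_expand (q := fun k z => (k == i)%:R * z 0 j)).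
- by rewrite big1// => k _; rewrite mxE !mulr0.
- move=> k; apply: holMr; [exact: hol_cst|exact: hol_coord].
apply: near0W => z; rewrite !eE mxE mul0r add0r (bigD1 i)//= eqxx mul1r.
by rewrite big1 ?addr0// => k /negbTE ->; rewrite mul0r mulr0.
Qed.

Hypothesis hxi : equivariantly_semi_universal a xi b c.
Hypothesis htriv : trivial_on_T1 a.

Lemma act_tangent (v : 'rV[C]_(edim S)) g j : tangent_space S v ->
  'D_v (fun z => c g z 0 j - z 0 j) 0 = 0.
Proof.
move=> vT; have [[def_xi univ] [_ ext equi] _] := hxi.
have hcg : hol_map_at (c g) 0 by have [] := act_map_mor c g.
have hcoord : hol_at (fun z : 'rV[C]_(edim S) => - z 0 j) 0.
  exact: holN (@hol_coord R _ j).
have hcj := hcg j.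
rewrite (derive_add v hcj hcoord).
suff Dv : 'D_v (fun z => c g z 0 j) 0 = 'D_v (fun z : 'rV[C]_(edim S) => z 0 j) 0.
  rewrite Dv -(derive_add v (@hol_coord R _ j) hcoord).
  rewrite (derive_expand (q := fun _ _ => 0)).
  - by rewrite big1// => i _; rewrite mulr0.
  - by move=> i; exact: hol_cst.
  by apply: near0W => z; rewrite !subrr big1 ?addr0// => i _; rewrite mulr0.
(* The double point embeds in the direction v only if v is nonzero; for v = 0 both derivatives
   vanish. *)
have [->|v0] := eqVneq v 0.
  have [q [hq fq]] := hol_expand hcj; have [r [hr fr]] := hol_expand (@hol_coord R _ j).
  rewrite (derive_expand 0 hq fq) (derive_expand 0 hr fr) !big1// => i _;
    by rewrite mxE mul0r.
have [j0 vj0] : exists j0, v 0 j0 != 0.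
  apply: contrapT => nv; case/eqP: v0; apply/rowP => i; rewrite mxE.
  by apply/eqP/negPn/negP => vi; apply: nv; exists i.
pose eta := restr_def def_xi v j0; pose tau := @tangent_map R S v.
have def_eta : is_deformation eta by exact: restr_deformation.
have eta_tau : pullback_of xi eta tau id by exact: restr_pullback_of.
have [h [mh_iso hpr hinc]] := htriv g^-1%g def_eta.
have {mh_iso}[mh [h' [mh' h'h hh']]] := mh_iso.
rewrite /= invgK in hinc.
have [mtau pb einc] := eta_tau.
have [mpr _ _] := def_xi.
(* On X, the map [b g] restricts to [a g] and h restricts to [a g^-1]. So [b g \o h] is compatible
   with the untwisted inclusion of X and exhibits eta itself, not a twist of it, as a pullback by
   [c g \o tau]. *)
have eta_ctau : pullback_of xi eta (c g \o tau) (b g \o h).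
  split; first exact: is_mor_comp mtau (act_map_mor c g).
    apply: (is_pullback_transport (h' := h') (b' := b g^-1%g) (c' := c g^-1%g)
       mpr mtau mh mh' h'h hh' (act_map_mor b g) (act_map_mor b _)
       (act_invl b g) (act_invr b g) (act_map_mor c g) (act_map_mor c _)
       (act_invl c g) hpr (equi g) (equi _) pb).
  have [hbg bg0 _] := act_map_mor b g.
  have [_ _ [minc _ _ _]] := def_xi.
  have e1 : eq_mor X (h \o def_incl eta) (def_incl xi \o a g^-1%g).
    have e2 := eq_mor_pre (act_map_mor a g^-1%g) hinc.
    have [_ _ [mince _ _ _]] := def_eta.
    have [hh1 h10 _] := is_mor_comp mince mh.
    have e3 := eq_mor_post hh1 h10 (act_invr a g).
    exact: eq_mor_trans (eq_mor_sym e3) e2.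
  have e4 := eq_mor_post hbg bg0 e1.
  apply: (eq_mor_trans e4).
  have e5 := eq_mor_pre (act_map_mor a g^-1%g) (ext g).
  apply: (eq_mor_trans e5).
  have [hi i0 _] := minc.
  exact: (eq_mor_post hi i0 (act_invr a g)).
have [phi [_ phi_uniq]] := univ _ _ def_eta.
have s1 := phi_uniq tau (ex_intro _ _ eta_tau).
have s2 := phi_uniq (c g \o tau) (ex_intro _ _ eta_ctau).
(* The tangent vector 1 of the double point is sent to v by tau; evaluated there, the equality of
   differentials is the claim. *)
pose u : 'rV[C]_(edim D) := const_mx 1.
have Du := tangent_double_point u.
have htau : hol_map_at tau 0 by have [] := mtau.
have tau0 : tau 0 = 0 by have [] := mtau.
have Ej : 'D_u tau 0 = 'D_u (c g \o tau) 0 by rewrite -(s1 u Du) (s2 u Du).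
have row1 := derive_row u htau j.
have row2 := derive_row u (hol_map_comp hcg htau tau0) j.
have chain (f : 'rV[C]_(edim S) -> C) : 'D_u (f \o tau) 0 = 'D_v f 0.
  have E : (fun k : C => k^-1 *: (((f \o tau) \o shift 0) (k *: u) - (f \o tau) 0)) =
      (fun k : C => k^-1 *: ((f \o shift 0) (k *: v) - f 0)).
    apply/funext => k; rewrite /= tau0 !addr0; congr (_ *: (f _ - _)).
    by rewrite /tau /tangent_map !mxE mulr1.
  exact: (congr1 (fun F : C -> C => lim (F k @[k --> (0 : C)^'])) E).
have ch1 := chain (fun z => z 0 j); have ch2 := chain (fun z => c g z 0 j).
apply: etrans (esym ch2) _; apply: etrans (esym row2) _.
have Ej' : ('D_u tau 0) 0 j = ('D_u (c g \o tau) 0) 0 j by rewrite Ej.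
exact: etrans (esym Ej') (etrans row1 ch1).
Qed.

End TangentAction.

(** * Smooth subgerms with full tangent space *)

Section Gradients.
Variable R : realType.
Local Notation C := (Cplx R).

Lemma gradient n (f : 'rV[C]_n -> C) : hol_at f 0 ->
  exists g : 'rV[C]_n, forall v, 'D_v f 0 = (v *m g^T) 0 0.
Proof.
move=> /hol_expand[q [hq fq]]; exists (\row_i q i 0) => v.
by rewrite (derive_expand v hq fq) mxE; apply: eq_bigr => i _; rewrite !mxE.
Qed.

(** A possibly infinite set of equations has finitely many gradients spanning all of them: rows
    outside the span are added one by one, and d bounds the rank still missing. *)
Lemma spanning_rows n (E : set 'rV[C]_n) : exists k (B : 'M[C]_(k, n)),
  (forall i, E (row i B)) /\ forall e, E e -> (e <= B)%MS.
Proof.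
suff H d : forall k (B : 'M[C]_(k, n)), (forall i, E (row i B)) ->
    (n - \rank B <= d)%N -> exists k (B : 'M[C]_(k, n)),
      (forall i, E (row i B)) /\ forall e, E e -> (e <= B)%MS.
  by apply: (H n 0%N 0) => [[]//|]; rewrite mxrank0 subn0.
elim: d => [|d IH] k B EB rB.
  exists k, B; split=> // e _; apply: submx_full.
  by rewrite /row_full eqn_leq rank_leq_col -subn_eq0 -leqn0.
have [BE|nBE] := pselect (forall e, E e -> (e <= B)%MS); first by exists k, B.
have [e [Ee neB]] : exists e, E e /\ ~~ (e <= B)%MS.
  apply: contrapT => nex; apply: nBE => e Ee; apply/negPn/negP => neB.
  by apply: nex; exists e.
apply: (IH (k + 1)%N (col_mx B e)).
  move=> i; case: (split_ordP i) => j ->; first by rewrite rowKu.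
  by rewrite rowKd (_ : row j e = e)//; apply/rowP => l; rewrite mxE ord1.
have : (\rank B < \rank (col_mx B e))%N.
  have -> : \rank (col_mx B e) = \rank (B + e)%MS by rewrite addsmxE.
  apply: rank_ltmx; rewrite ltmxE addsmxSl addsmx_sub submx_refl /=.
  exact: neB.
by move: rB; lia.
Qed.

(** A gradient vanishing on the common kernel of the gradients of the equations is a linear
    combination of these; i is the same combination of the equations. So a germ vanishing at 0 and
    constant to first order along the tangent space gets order at least two only after a correction
    in the ideal. *)
Lemma tangent_gradient (X : germ R) (f : 'rV[C]_(edim X) -> C) : hol_at f 0 ->
  (forall v, tangent_space X v -> 'D_v f 0 = 0) ->
  exists2 i, germ_ideal X i & forall v, 'D_v (fun z => f z - i z) 0 = 0.
Proof.
move=> hf fT.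
have /choice[grad gradP] : forall e : hfun R (edim X),
    exists g : 'rV[C]_(edim X), forall v, 'D_v e 0 = (v *m g^T) 0 0.
  by move=> e; exact: gradient (hfun_hol e).
have [k [B [BE EB]]] := spanning_rows [set g | exists2 e, eqs X e & g = grad e].
have [g gP] := gradient hf.
have gB : (g <= B)%MS.
  rewrite submxE; apply/eqP/matrixP => i j; rewrite !ord1 [RHS]mxE.
  (* The columns of the cokernel of B are tangent vectors, because every gradient of an equation
     lies in the row space of B. *)
  pose v := (col j (cokermx B))^T.
  have vE (w : 'rV[C]_(edim X)) : (v *m w^T) 0 0 = (w *m cokermx B) 0 j.
    by rewrite !mxE; apply: eq_bigr => l _; rewrite !mxE mulrC.
  rewrite -vE -gP; apply: fT => e eX; rewrite gradP vE.
  have : (grad e <= B)%MS by apply: EB; exists e.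
  by rewrite submxE => /eqP ->; rewrite mxE.
have [u uB] := submxP gB.
have /choice[e eP] : forall i, exists e, eqs X e /\ row i B = grad e.
  by move=> i; have [e eX ->] := BE i; exists e.
exists (fun z => \sum_i u 0 i * e i z).
  apply: ideal_sum => i _; apply: idealM (hol_cst _ _) _.
  by apply: ideal_eqs; case: (eP i).
have hue i : hol_at (fun z => u 0 i * e i z) 0.
  exact: holMr (hol_cst _ _) (hfun_hol _).
have hue' i : hol_at (fun z => - u 0 i * e i z) 0.
  exact: holMr (hol_cst _ _) (hfun_hol _).
move=> v; rewrite (_ : (fun z => _) = (fun z => f z + \sum_i - u 0 i * e i z)); last first.
  by apply/funext => z; rewrite -sumrN; congr (_ + _); apply: eq_bigr => i _; rewrite mulNr.
rewrite (derive_add v hf (hol_sum _ (fun i _ => hue' i))) (hol_derive_sum v hue').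
rewrite gP uB trmx_mul mulmxA mxE -big_split/= big1// => i _.
have [eX eB] := eP i.
rewrite (derive_mul0 v (hol_cst _ _) (hfun_hol _) (eqs0 _ _ eX)) gradP -eB.
rewrite mulNr [X in X - _]mulrC mxE [X in _ - X * _](_ : _ = u 0 i)//.
have -> : (v *m B^T) 0 i = (v *m (row i B)^T) 0 0.
  by rewrite !mxE; apply: eq_bigr => l _; rewrite !mxE.
by rewrite subrr.
Qed.

(** The inverse is the geometric series evaluated at 1 - f. *)
Lemma hol_inv n (f : 'rV[C]_n -> C) : hol_at f 0 -> f 0 = 1 ->
  exists2 g, hol_at g 0 & \forall z \near (0 : 'rV[C]_n), g z * f z = 1.
Proof.
move=> hf f0; pose one (a : mindex 1) : C := 1.
have one_conv : convs one.
  exists (1 / 2), (1 * 2 ^+ 1); split; first exact: divr_gt0.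
  apply: nrm_of_sup => // a; rewrite /one normr1 mul1r expr1n //.
have [h hone] := ser_fun one_conv.
have h1 : \forall w \near (0 : 'rV[C]_1), h w * (1 - w 0 0) = 1.
  have [r [M [r0 _ hs]]] := hone; apply/near0P; exists r => // w wr.
  have hw := hs w wr.
  have e1 : has_sum (fun a => if a == mi0 then 0 else one a * ps_monomial w a) (w 0 0 * h w).
    apply: (has_sum_reindex (e := fun a => miD a (mi1 0))); first exact: miD_inj.
      move=> a na; case: eqP => // /eqP a0.
      have : mile (mi1 0) a.
        by rewrite mi1_le lt0n; apply: contra a0 => /eqP a0; apply/eqP/ffunP => i; rewrite ord1 a0 ffunE.
      by move/miBK => ab; have := na (miB a (mi1 0)); rewrite ab eqxx.
    apply: eq_has_sum (has_sumZ (w 0 0) hw) => a /=.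
    rewrite ifN; first by rewrite monD mon1 /one !mul1r mulrC.
    apply/eqP => /ffunP/(_ 0); rewrite !ffunE eqxx addn1 //.
  have e2 := has_sumD hw (has_sumN e1).
  have e3 := @has_sum_single _ _ (fun a => if a == mi0 then 1 else 0 : C) (@mi0 1).
  rewrite eqxx in e3.
  rewrite mulrBr mulr1 [h w * _]mulrC; apply: has_sum_unique e2 _.
  apply: eq_has_sum (e3 _) => [a|a /negbTE -> //].
  case: eqP => [->|_]; last by rewrite subrr.
  by rewrite mon0 /one mulr1 subr0.
have hk : hol_map_at (fun z => const_mx (1 - f z) : 'rV[C]_1) 0.
  by move=> j; under eq_fun do rewrite mxE; apply: holB hf; exact: hol_cst.
have k0 : const_mx (1 - f 0) = 0 :> 'rV[C]_1.
  by apply/rowP => j; rewrite !mxE f0 subrr.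
exists (h \o (fun z => const_mx (1 - f z))).
  by apply: hol_comp hk k0; apply/hol0P; exists one.
apply: near0S (near_comp hk k0 h1) => z.
by rewrite /= mxE subKr.
Qed.

Lemma hol_det n m (A : 'rV[C]_n -> 'M[C]_m) :
  (forall i j, hol_at (fun z => A z i j) 0) -> hol_at (fun z => \det (A z)) 0.
Proof.
move=> hA; rewrite /determinant; apply: hol_sum => s _.
by apply: holMr; [exact: hol_cst|apply: hol_prod => i _; exact: hA].
Qed.

(** The matrix 1 - u sends the vector of the e j into the ideal and is the identity at 0.
    Multiplying by its adjugate and by the inverse of its determinant isolates each e j. *)
Lemma ideal_nakayama (X : germ R) m (e : 'I_m -> 'rV[C]_(edim X) -> C)
    (u : 'I_m -> 'I_m -> 'rV[C]_(edim X) -> C) :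
  (forall j k, hol_at (u j k) 0) -> (forall j k, u j k 0 = 0) ->
  (forall j, germ_ideal X (fun z => e j z - \sum_k u j k z * e k z)) ->
  forall j, germ_ideal X (e j).
Proof.
move=> hu u0 eI j0.
pose A z : 'M[C]_m := \matrix_(j, k) ((j == k)%:R - u j k z).
have hA j k : hol_at (fun z => A z j k) 0.
  by under eq_fun do rewrite mxE; apply: holB; [exact: hol_cst|exact: hu].
have A0 : A 0 = 1%:M.
  by apply/matrixP => j k; rewrite !mxE u0 subr0.
have hadj j k : hol_at (fun z => (\adj (A z)) j k) 0.
  under eq_fun do rewrite mxE; rewrite /cofactor.
  apply: holMr; first exact: hol_cst.
  by apply: hol_det => i l; under eq_fun do rewrite !mxE; exact: holB (hol_cst _ _) (hu _ _).
have [|g hg gd] := hol_inv (hol_det hA); first by rewrite A0 det1.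
pose E z : 'cV[C]_m := \col_j e j z.
apply: (@ideal_near _ _ (fun z => \sum_k (g z * (\adj (A z)) j0 k) *
    (e k z - \sum_l u k l z * e l z))); last first.
  apply: ideal_sum => k _; apply: idealM (eI k).
  exact: holMr hg (hadj _ _).
apply: near0S gd => z gd.
have AE k : e k z - \sum_l u k l z * e l z = (A z *m E z) k 0.
  rewrite mxE [RHS](eq_bigr (fun l => (k == l)%:R * e l z - u k l z * e l z)).
    rewrite sumrB; congr (_ - _); rewrite (bigD1 k)//= eqxx mul1r big1 ?addr0// => l.
    by rewrite eq_sym => /negbTE ->; rewrite mul0r.
  by move=> l _; rewrite !mxE mulrBl.
under eq_bigr do rewrite AE -mulrA.
rewrite -mulr_sumr.
have -> : \sum_i (\adj (A z)) j0 i * (A z *m E z) i 0 = (\adj (A z) *m (A z *m E z)) j0 0.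
  by rewrite [RHS]mxE.
by rewrite mulmxA mul_adj_mx mul_scalar_mx mxE mulrA gd mul1r mxE.
Qed.

End Gradients.

Section SmoothSubgerm.
Variable R : realType.
Local Notation C := (Cplx R).

Lemma affine_ideal n (f : 'rV[C]_n -> C) : germ_ideal (affine R n) f ->
  \forall z \near (0 : 'rV[C]_n), f z = 0.
Proof.
move=> [[|k] [a [e [eX fE]]]]; last by case: (eX ord0).
by apply: near0S fE => z ->; rewrite big_ord0.
Qed.

Variables (S : germ R) (E : set (hfun R (edim S))).
Hypothesis E0 : forall e, E e -> e 0 = 0.
Local Notation Y := (@Germ R (edim S) E E0).
Hypothesis SE : eqs S `<=` E.
Hypothesis YT : forall e, E e ->
  forall v, tangent_space S v -> 'D_v (e : 'rV[C]_(edim S) -> C) 0 = 0.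

Lemma ideal_sub_ideal : germ_ideal S `<=` germ_ideal Y.
Proof.
apply: ideal_ind => [f g fg|| f g|a e ha eS].
- exact: (@ideal_near R Y).
- exact: (@ideal0 R Y).
- exact: (@idealD R Y).
- by apply: (@idealM R Y) ha _; apply: (@ideal_eqs R Y); exact: SE.
Qed.

Lemma ideal_derive (v : 'rV[C]_(edim S)) f : tangent_space S v -> germ_ideal Y f ->
  'D_v (f : 'rV[C]_(edim S) -> C) 0 = 0.
Proof.
move=> vT fY; pose J (f : 'rV[C]_(edim Y) -> C) := hol_at f 0 /\ 'D_v f 0 = 0.
suff : J f by case.
have Jsub := @ideal_ind R Y J; apply: Jsub fY.
- move=> g h gh [hg Dg]; split; first exact: hol_near gh hg.
  by rewrite -(derive_near v hg gh).
- split; first exact: hol_cst.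
  rewrite (derive_expand (q := fun _ _ => 0)).
  + by rewrite big1// => i _; rewrite mulr0.
  + by move=> i; exact: hol_cst.
  by apply: near0W => z; rewrite big1 ?addr0// => i _; rewrite mulr0.
- move=> g h [hg Dg] [hh Dh]; split; first exact: holD hg hh.
  by rewrite (derive_add v hg hh) Dg Dh addr0.
move=> a e ha eE; split; first exact: holMr ha (hfun_hol _).
by rewrite (derive_mul0 v ha (hfun_hol _) (E0 eE)) (YT eE vT) mulr0.
Qed.

(** With base point 0, the Hadamard coefficients at the origin are the partial derivatives of f. *)
Lemma hadamard_coef0 m (f : 'rV[C]_m -> C) (q : 'I_m -> 'rV[C]_(m + m) -> C) :
  (forall j, hol_at (q j) 0) ->
  (\forall x \near (0 : 'rV[C]_(m + m)),
      f (lsubmx x + rsubmx x) - f (lsubmx x) = \sum_j rsubmx x 0 j * q j x) ->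
  (forall v, 'D_v f 0 = 0) -> forall j, q j 0 = 0.
Proof.
move=> hq fq Df j.
have hr : hol_map_at (fun u : 'rV[C]_m => row_mx 0 u : 'rV[C]_(m + m)) 0.
  by apply: hol_row_mx; [move=> i; exact: hol_cst|exact: hol_id].
have r0 : row_mx 0 0 = 0 :> 'rV[C]_(m + m) by exact: row_mx0.
have hq' i : hol_at (q i \o (fun u : 'rV[C]_m => row_mx 0 u)) 0.
  exact: hol_comp (hq i) hr r0.
have fq' : \forall u \near (0 : 'rV[C]_m),
    f u = f 0 + \sum_i u 0 i * q i (row_mx 0 u).
  apply: near0S (near_comp hr r0 fq) => u.
  by rewrite row_mxKl row_mxKr add0r => <-; rewrite addrC subrK.
have := derive_expand (delta_mx 0 j) hq' fq'.
rewrite Df (bigD1 j)//= mxE !eqxx mul1r r0 big1 ?addr0// => i /negbTE ij.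
by rewrite mxE ij andbF mul0r.
Qed.

Lemma smooth_subgerm : smooth Y -> germ_ideal Y = germ_ideal S.
Proof.
move=> [n [F [mF [F' [mF' F'F FF']]]]].
have [hF F0 _] := mF; have [hF' F'0 _] := mF'.
pose H z : 'rV[C]_(edim S) := F (F' z).
have hH : hol_map_at H 0 by exact: hol_map_comp hF hF' F'0.
have H0 : H 0 = 0 by rewrite /H F'0 F0.
pose e j (z : 'rV[C]_(edim S)) := z 0 j - H z 0 j.
have eY j : germ_ideal Y (e j) by exact: (eq_mor_coord j (eq_mor_sym FF')).
(* The ideal of [affine R n] contains only germs of zero, so a member of the ideal of Y vanishes
   identically along F, hence along H. *)
have vanish f : germ_ideal Y f -> \forall z \near (0 : 'rV[C]_(edim S)), f (H z) = 0.
  move=> fY; have := affine_ideal (ideal_comp mF fY).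
  exact: (near_comp hF' F'0).
pose K z : 'rV[C]_(edim S + edim S) := row_mx (H z) (z - H z).
have hK : hol_map_at K 0.
  apply: (hol_row_mx hH) => j; under eq_fun do rewrite !mxE.
  by apply: holB; [exact: hol_coord|exact: hH].
have K0 : K 0 = 0 by rewrite /K H0 subrr row_mx0.
(* Hadamard's lemma with base point H z and increment z - H z: the value at the base point is zero,
   and the e j are the coordinates of the increment. *)
have expand f q : germ_ideal Y f ->
    (\forall x \near (0 : 'rV[C]_(edim S + edim S)),
      f (lsubmx x + rsubmx x) - f (lsubmx x) = \sum_j rsubmx x 0 j * q j x) ->
    \forall z \near (0 : 'rV[C]_(edim S)), f z = \sum_j q j (K z) * e j z.
  move=> fY fq; apply: near0S2 (vanish f fY) (near_comp hK K0 fq) => z fH.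
  rewrite row_mxKl row_mxKr [H z + _]addrC subrK fH subr0 => ->.
  by apply: eq_bigr => j _; rewrite !mxE mulrC.
have eS : forall j, germ_ideal S (e j).
  have step j : exists u : 'I_(edim S) -> 'rV[C]_(edim S) -> C,
      [/\ forall k, hol_at (u k) 0, forall k, u k 0 = 0
        & germ_ideal S (fun z => e j z - \sum_k u k z * e k z)].
    (* After subtracting i from the ideal of S, the first derivatives vanish and the Hadamard
       coefficients belong to the maximal ideal, as Nakayama's lemma requires. *)
    have [||i iS Di] := tangent_gradient (X := S) (f := e j).
    - exact: ideal_hol (eY j).
    - by move=> v vT; exact: ideal_derive.
    have qY : germ_ideal Y (fun z => e j z - i z).
      exact: (idealB (X := Y) (eY j) (ideal_sub_ideal iS)).
    have [q [hq qE]] := hadamard (ideal_hol qY).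
    exists (fun k => q k \o K); split=> [k|k|].
    - exact: hol_comp (hq k) hK K0.
    - exact: etrans (congr1 (q k) K0) (hadamard_coef0 hq qE Di k).
    apply: (ideal_near (X := S)) iS; apply: near0S (expand _ q qY qE) => z /= <-.
    by rewrite subKr.
  have /choice[u uP] := step.
  apply: (ideal_nakayama (u := u)).
  - by move=> j k; have [h _ _] := uP j; exact: h.
  - by move=> j k; have [_ h _] := uP j; exact: h.
  - by move=> j; have [_ _ h] := uP j; exact: h.
apply/seteqP; split; last exact: ideal_sub_ideal.
move=> f fY; have [q [hq qE]] := hadamard (ideal_hol fY).
apply: (ideal_near (X := S) (f := fun z => \sum_j q j (K z) * e j z)).
  by apply: near0S (expand _ q fY qE) => z ->.
apply: ideal_sum => j _; apply: idealM (eS j).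
exact: hol_comp (hq j) hK K0.
Qed.

End SmoothSubgerm.

(** * Triviality of the action on the base *)

Section FixedGerm.
Variables (R : realType) (X : germ R) (G : complex_lie_group R).
Variables (a : germ_action G X) (S : germ R) (xi : predeformation X S).
Variables (b : germ_action G (total_space xi)) (c : germ_action G S).
Hypothesis hxi : equivariantly_semi_universal a xi b c.
Hypothesis htriv : trivial_on_T1 a.
Hypothesis hsmooth : smooth (fixed_germ c).

Lemma fixed_germ_ideal : germ_ideal (fixed_germ c) = germ_ideal S.
Proof.
apply: smooth_subgerm hsmooth => [e eS|e [eS v vT|[g [j eE]] v vT]].
- by left.
- exact: vT.
have -> : hval e = fun z => c g z 0 j - z 0 j by apply/funext.
exact: (act_tangent hxi htriv).
Qed.

Lemma act_base_trivial g : eq_mor S (c g) id.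
Proof.
have [hc c0 _] := act_map_mor c g.
apply: (coord_eq_mor hc c0 (@hol_id R _) erefl) => j.
rewrite -fixed_germ_ideal.
have he : hol_at (fun z => c g z 0 j - z 0 j) 0.
  by apply: holB; [exact: hc|exact: hol_coord].
by apply: (ideal_eqs (X := fixed_germ c) (e := mkh he)); right; exists g, j.
Qed.

End FixedGerm.

(** * Division and families of ideal members *)

(** Let s serve the first n coordinates. If no element of s lies below e, then the coordinate n of e
    is smaller than that of some member of s, hence than M; the finitely many slices with that
    coordinate fixed are covered by induction. Coordinates are given by f, so that T stays the same
    in the induction. *)
Lemma dickson (T : eqType) (f : T -> nat -> nat) n : forall E : T -> Prop,
  exists s : seq T, (forall b, b \in s -> E b) /\
    forall e, E e -> exists2 b, b \in s & forall j, (j < n)%N -> (f b j <= f e j)%N.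
Proof.
elim: n => [|n IH] E.
  have [[e Ee]|nE] := pselect (exists e, E e).
    exists [:: e]; split=> [b|e' _]; first by rewrite inE => /eqP ->.
    by exists e; rewrite ?inE.
  by exists [::]; split=> // e Ee; case: nE; exists e.
have [s [sE sP]] := IH E.
have /choice[t tP] := fun l => IH (fun e => E e /\ f e n = l).
pose M := (\sum_(b <- s) f b n)%N.
exists (s ++ flatten [seq t l | l <- iota 0 M]); split=> [b|e Ee].
  rewrite mem_cat => /orP[/sE//|/flatten_mapP[l _ bt]].
  by have [/(_ b bt)[]] := tP l.
have [b bs be] := sP e Ee.
have [ben|ebn] := leqP (f b n) (f e n).
  exists b; first by rewrite mem_cat bs.
  by move=> j; rewrite ltnS leq_eqVlt => /predU1P[->//|]; exact: be.
have [_ /(_ e (conj Ee erefl))[b' b't b'e]] := tP (f e n).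
have eM : (f e n < M)%N.
  apply: leq_trans ebn _; rewrite /M; elim: s bs {sE sP M} => // x s IHs.
  rewrite inE big_cons => /predU1P[->|/IHs h]; first exact: leq_addr.
  exact: leq_trans h (leq_addl _ _).
exists b'.
  by rewrite mem_cat; apply/orP; right; apply/flatten_mapP; exists (f e n); rewrite ?mem_iota.
move=> j; rewrite ltnS leq_eqVlt => /predU1P[->|]; last exact: b'e.
by have [/(_ b' b't)[_ ->]] := tP (f e n).
Qed.

Section MoreSums.
Variable R : realType.
Local Notation C := (Cplx R).

Lemma has_sum_bigsum (I : choiceType) (U : Type) (s : seq U) (F : U -> I -> C) v :
  (forall i, has_sum (F i) (v i)) ->
  has_sum (fun x => \sum_(i <- s) F i x) (\sum_(i <- s) v i).
Proof.
move=> Fv; elim: s => [|i s IH].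
  by rewrite big_nil; under eq_fun do rewrite big_nil; exact: has_sum0.
rewrite big_cons; under eq_fun do rewrite big_cons.
exact: has_sumD (Fv i) IH.
Qed.

Lemma abs_le_bigsum (I : choiceType) (U : Type) (s : seq U) (F : U -> I -> C) M :
  (forall i, abs_le (F i) (M i)) ->
  abs_le (fun x => \sum_(i <- s) F i x) (\sum_(i <- s) M i).
Proof.
move=> Fv; elim: s => [|i s IH].
  rewrite big_nil; under eq_fun do rewrite big_nil.
  by split=> A; rewrite big1// => i _; rewrite normr0.
rewrite big_cons; under eq_fun do rewrite big_cons.
exact: abs_leD (Fv i) IH.
Qed.

Lemma abs_le_geometric : abs_le (fun l : nat => (2^-1 : C) ^+ l) 2.
Proof.
split=> A; have h0 (l : nat) : 0 <= (2^-1 : C) ^+ l by rewrite exprn_ge0// invr_ge0.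
have [N NP] : exists N, forall l, l \in A -> (l < N)%N.
  exists (\sum_(l <- A) l).+1 => l lA; rewrite ltnS.
  by rewrite (big_fsetD1 l)//= leq_addr.
have AN : (A `<=` [fset l in iota 0 N])%fset.
  by apply/fsubsetP => l /NP lN; rewrite in_fset_ /= mem_iota.
rewrite (big_fset_mask _ AN).
apply: (@le_trans _ _ (\sum_(l <- [fset l in iota 0 N]%fset) (2^-1 : C) ^+ l)).
  by apply: ler_sum => l _; case: ifP => // _; rewrite ger0_norm.
rewrite (perm_big (iota 0 N)); last first.
  by apply: uniq_perm; rewrite ?fset_uniq ?iota_uniq// => l; rewrite in_fset_.
rewrite (_ : iota 0 N = index_iota 0 N) ?big_mkord; last by rewrite /index_iota subn0.
have -> : \sum_(k < N) (2^-1 : C) ^+ k = 2 * (1 - 2^-1 ^+ N).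
  elim: {AN NP} N => [|N IH]; first by rewrite big_ord0 expr0 subrr mulr0.
  rewrite big_ord_recr/= IH exprS !mulrBr mulrA mulfV ?pnatr_eq0// mul1r.
  by rewrite [_ * 2^-1 ^+ N]mulr_natl mulr2n opprD -!addrA addNr addr0.
by rewrite ger_pMr// gerDl oppr_le0.
Qed.

End MoreSums.

Section Division.
Variables (R : realType) (n K : nat).
Local Notation C := (Cplx R).
Local Notation mon := (@ps_monomial C n).
Implicit Types (g : mindex n) (h : mindex n -> C).
Variables (al : 'I_K -> mindex n) (c : 'I_K -> mindex n -> C) (w : 'rV[C]_n).

(* Grauert-Hironaka division by the series [c i] of leading exponents [al i]:
   dividing by the leading monomials leaves the error [div_next h], which is at
   most half as large as [h] when the tails of the divisors are small in the
   l^1-norm of polyradius [w]; so the process converges when iterated. *)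

Definition div_lead g := [pick i | mile (al i) g].
Definition div_quo i h g : C := if div_lead (miD g (al i)) == Some i then h (miD g (al i)) else 0.
Definition div_rem h g : C := if div_lead g is None then h g else 0.
Definition div_tail i g : C := if g == al i then 0 else c i g.
Definition div_next h g : C := - \sum_i sconv (div_quo i h) (div_tail i) g.

Hypothesis c1 : forall i, c i (al i) = 1.
Hypothesis w0 : forall g, 0 < mon w g.
(** The K tails together contribute at most K / (2 (K + 1)), hence the factor 1/2 of each step; K +
    1 keeps the constant positive when K = 0. *)
Hypothesis tailP : forall i,
  nrm (div_tail i) w ((2 * K.+1%:R)^-1 * mon w (al i)).

Lemma convDr (q c1' c2' : mindex n -> C) g :
  sconv q (fun a => c1' a + c2' a) g = sconv q c1' g + sconv q c2' g.
Proof. by rewrite /sconv -big_split; apply: eq_bigr => p _; rewrite mulrDr. Qed.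

Lemma conv_delta (q : mindex n -> C) a g :
  sconv q (fun b => (b == a)%:R) g = if mile a g then q (miB g a) else 0.
Proof.
rewrite /sconv; case: ifP => ag.
  rewrite (big_fsetD1 (miB g a, a)) /=; last by rewrite mem_pairs/= miBK.
  rewrite eqxx mulr1 big1_seq ?addr0// => -[b b'] /=.
  rewrite in_fsetD1 mem_pairs/= => /andP[nb /eqP gE].
  case: eqP => [b'a|_]; last by rewrite mulr0.
  by move: nb; rewrite -gE b'a miDK eqxx.
rewrite big1_seq// => -[b b'] /=; rewrite mem_pairs/= => /eqP gE.
case: eqP => [b'a|_]; last by rewrite mulr0.
by rewrite -gE b'a mileD in ag.
Qed.

(** Each monomial of h that some leading monomial divides is assigned to one divisor, and this
    leading monomial is rewritten as the divisor minus its tail. *)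
Lemma division_step h g :
  h g - div_next h g = \sum_i sconv (div_quo i h) (c i) g + div_rem h g.
Proof.
have cE i : c i = fun a => (a == al i)%:R + div_tail i a.
  apply/funext => a; rewrite /div_tail; case: eqP => [->|_]; last by rewrite add0r.
  by rewrite c1 addr0.
under [X in _ = X + _]eq_bigr do rewrite cE convDr conv_delta.
rewrite big_split/= addrAC; congr (_ + _); last by rewrite /div_next opprK.
rewrite /div_rem /div_quo; case E : (div_lead g) => [i|].
  rewrite addr0 (bigD1 i)//=.
  have ig : mile (al i) g by move: E; rewrite /div_lead; case: pickP => // j jg [<-].
  rewrite ig miBK// E eqxx big1 ?addr0// => j ji; case: ifP => // jg.
  by rewrite miBK// E ifN//; apply: contra ji => /eqP[->].
rewrite big1 ?add0r// => i _; case: ifP => // ig.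
by rewrite miBK// E.
Qed.

Lemma nrm_quo i h M : nrm h w M -> nrm (div_quo i h) w (M / mon w (al i)).
Proof.
move=> [hM]; have w1 := w0 (al i).
have [hM'] := abs_leZ (mon w (al i))^-1 (abs_le_reindex (@miD_inj _ (al i)) hM).
split; split=> A; apply: le_trans (_ : _ <= `|(mon w (al i))^-1| * M) _.
  apply: le_trans (hM' A); apply: ler_sum => g _ /=.
  rewrite monD /div_quo; case: ifP => _; last by rewrite mul0r normr0.
  by rewrite [X in _ <= `|X|]mulrC -!mulrA mulfV ?mulr1// gt_eqF.
by rewrite mulrC gtr0_norm// invr_gt0.
Qed.

Lemma nrm_rem h M : nrm h w M -> nrm (div_rem h) w M.
Proof.
by apply: nrm_sub => g; rewrite /div_rem; case: (div_lead g) => [i|//]; rewrite normr0.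
Qed.

Lemma nrm_next h M : nrm h w M -> nrm (div_next h) w (2^-1 * M).
Proof.
move=> hM; have M0 := abs_le_ge0 (nrm_abs hM).
have [sM] := abs_le_bigsum (index_enum 'I_K) (fun i =>
  nrm_abs (nrm_conv (nrm_quo i hM) (tailP i))).
split; split=> A; apply: le_trans (_ : _ <= \sum_(i < K)
  (M / mon w (al i) * ((2 * K.+1%:R)^-1 * mon w (al i)))) _.
  apply: le_trans (sM A); apply: ler_sum => g _.
  by rewrite /div_next mulNr normrN mulr_suml.
rewrite (eq_bigr (fun=> (2 * K.+1%:R)^-1 * M)); last first.
  by move=> i _; rewrite mulrCA divfK// gt_eqF.
rewrite sumr_const card_ord -[leLHS]mulr_natr invfM -!mulrA ler_wpM2l ?invr_ge0//.
rewrite mulrCA ler_piMr// mulrC ler_pdivrMr// mul1r ler_nat //.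
Qed.

Definition iter_next h (l : nat) := iter l div_next h.

Lemma nrm_iter h M l : nrm h w M -> nrm (iter_next h l) w (M * 2^-1 ^+ l).
Proof.
move=> hM; elim: l => [|l IH]; first by rewrite expr0 mulr1.
by rewrite exprS mulrCA; exact: nrm_next.
Qed.

Lemma sum_family (F : nat -> mindex n -> C) M :
  (forall l, nrm (F l) w (M * 2^-1 ^+ l)) ->
  exists q, (forall g, has_sum (fun l => F l g) (q g)) /\ nrm q w (M * 2).
Proof.
move=> FM; have M0 : 0 <= M by have := abs_le_ge0 (nrm_abs (FM 0%N)); rewrite expr0 mulr1.
have fam : abs_le (fun p => F p.1 p.2 * mon w p.2) (M * 2).
  apply: (@abs_le_dep _ _ _ (fun l g => F l g * mon w g) (fun l => M * 2^-1 ^+ l)).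
    by move=> l; exact: nrm_abs (FM l).
  have := abs_leZ M (@abs_le_geometric R); rewrite ger0_norm//; exact.
have /choice[q qP] : forall g, exists v, has_sum (fun l => F l g) v.
  move=> g; have inj : injective (fun l : nat => (l, g)) by move=> l l' [].
  have := abs_leZ (mon w g)^-1 (abs_le_reindex inj fam).
  move=> /has_sum_ex[v]; rewrite (_ : (fun _ => _) = (fun l => F l g)); first by exists v.
  by apply/funext => l /=; rewrite mulrC mulfK// gt_eqF.
exists q; split; first exact: qP.
split; apply: (abs_le_sigma (p := snd) fam) => g.
apply: (@has_sum_snd _ _ _ (fun p => F p.1 p.2 * mon w p.2)) => /=.
rewrite mulrC; have := has_sumZ (mon w g) (qP g).
by apply: eq_has_sum => l; rewrite mulrC.
Qed.

(** Quotients and remainders of all stages are summed coefficientwise; the identities of the single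
    stages telescope. *)
Lemma division h M : nrm h w M ->
  exists (q : 'I_K -> mindex n -> C) (r : mindex n -> C),
  [/\ forall i, exists L, nrm (q i) w L, exists L, nrm r w L,
      forall g, h g = \sum_i sconv (q i) (c i) g + r g
    & forall g i, mile (al i) g -> r g = 0].
Proof.
move=> hM; have itM l := nrm_iter l hM.
have /choice[q qP] : forall i, exists q,
    (forall g, has_sum (fun l => div_quo i (iter_next h l) g) (q g)) /\
    nrm q w (M / mon w (al i) * 2).
  move=> i; apply: sum_family => l; rewrite mulrAC.
  exact: nrm_quo.
have [r [rP rM]] := sum_family (F := fun l => div_rem (iter_next h l)) (fun l => nrm_rem (itM l)).
exists q, r; split.
- by move=> i; eexists; exact: (qP i).2.
- by eexists; exact: rM.
- move=> g; have [v [hv _]] := sum_family (F := iter_next h) itM.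
  (* The iterates from l = 1 on sum to the sum of all iterates minus the initial term, which leaves
     h g. *)
  have hs : has_sum (fun l => iter_next h l g - iter_next h l.+1 g) (h g).
    have e1 : has_sum (fun l => if l == 0%N then 0 else iter_next h l g) (v g - h g).
      have := @has_sum_single _ _ (fun l => if l == 0%N then - h g else 0) 0%N.
      move=> /(_ (fun l l0 => ifN _ _ l0)) e0.
      apply: eq_has_sum (has_sumD (hv g) e0) => l.
      by case: eqP => [->|_]; rewrite ?subrr ?addr0.
    have e2 : has_sum (fun l => iter_next h l.+1 g) (v g - h g).
      have [x ex] : exists x, has_sum (fun l => iter_next h l.+1 g) x.
        have inj : injective (fun l => l.+1) by move=> l l' [].
        have [|x [xP _]] := @sum_family (fun l => iter_next h l.+1) (2^-1 * M).
          move=> l; have := itM l.+1; rewrite exprS [M * _]mulrCA mulrA.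
          exact.
        by exists (x g).
      suff -> : v g - h g = x by [].
      apply: has_sum_unique e1 _.
      apply: (has_sum_reindex (e := fun l => l.+1)); first by move=> l l' [].
        by move=> [|l] // /(_ l); rewrite eqxx.
      exact: ex.
    have := has_sumD (hv g) (has_sumN e2).
    by rewrite opprB addrCA subrr addr0.
  apply: has_sum_unique hs _.
  have h1 i : has_sum (fun l => sconv (div_quo i (iter_next h l)) (c i) g) (sconv (q i) (c i) g).
    apply: has_sum_bigsum => p; rewrite mulrC.
    have := has_sumZ (c i p.2) ((qP i).1 p.1).
    by apply: eq_has_sum => l; rewrite mulrC.
  apply: eq_has_sum (has_sumD (has_sum_bigsum (index_enum 'I_K) h1) (rP g)) => l.
  by rewrite -division_step.
move=> g i ig; apply: has_sum_unique (rP g) _.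
apply: eq_has_sum (@has_sum0 _ _) => l; rewrite /div_rem /div_lead.
by case: pickP => // /(_ i); rewrite ig.
Qed.

End Division.

(** * Division of germs of holomorphic functions *)

Section SeriesAlgebra.
Variables (R : realType) (n : nat).
Local Notation C := (Cplx R).
Implicit Types (f g : 'rV[C]_n -> C) (c d : mindex n -> C) (z : 'rV[C]_n).

Lemma has_ser_common f g c d : has_ser f c -> has_ser g d -> exists r M L : C,
  [/\ 0 < r, nrm c (const_mx r) M, nrm d (const_mx r) L,
    forall z, (forall i, `|z 0 i| < r) ->
        has_sum (fun a => c a * ps_monomial z a) (f z)
    & forall z, (forall i, `|z 0 i| < r) ->
        has_sum (fun a => d a * ps_monomial z a) (g z)].
Proof.
move=> fc [s [L [s0 dL dg]]]; have [r [M [r0 rs cM cf]]] := has_ser_shrink fc s0.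
exists r, M, L; split; [exact: r0|exact: cM| |exact: cf|].
  by apply: nrm_mono dL; apply: const_mx_le => //; exact: ltW.
by move=> z zr; apply: dg => i; exact: lt_le_trans (zr i) rs.
Qed.

Lemma has_ser_add f g c d : has_ser f c -> has_ser g d ->
  has_ser (fun z => f z + g z) (fun a => c a + d a).
Proof.
move=> fc gd; have [r [M [L [r0 [cM] [dL] cf dg]]]] := has_ser_common fc gd.
exists r, (M + L); split; [exact: r0| |].
  split; split=> A; have [h] := abs_leD cM dL; have := h A.
  by under eq_bigr do rewrite -mulrDl.
move=> z zr; apply: eq_has_sum (has_sumD (cf z zr) (dg z zr)) => a.
by rewrite mulrDl.
Qed.

Lemma has_ser_mul f g c d : has_ser f c -> has_ser g d ->
  has_ser (fun z => f z * g z) (sconv c d).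
Proof.
move=> fc gd; have [r [M [L [r0 cM dL cf dg]]]] := has_ser_common fc gd.
exists r, (M * L); split; [exact: r0|exact: nrm_conv|].
move=> z zr; exact: has_sum_convM (lt_const_mx zr) cM dL (cf z zr) (dg z zr).
Qed.

Lemma has_ser_zero : has_ser (fun=> 0 : C) (fun=> 0) (n := n).
Proof.
exists 1, 0; split; first exact: ltr01.
  by split; split=> A; rewrite big1// => a _; rewrite mul0r normr0.
by move=> z _; apply: eq_has_sum (@has_sum0 _ _) => a; rewrite mul0r.
Qed.

Lemma has_ser_sum (I : Type) (s : seq I) (F : I -> 'rV[C]_n -> C)
    (c : I -> mindex n -> C) :
  (forall i, has_ser (F i) (c i)) ->
  has_ser (fun z => \sum_(i <- s) F i z) (fun a => \sum_(i <- s) c i a).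
Proof.
move=> Fc; elim: s => [|i s IH].
  under eq_fun do rewrite big_nil; under [X in has_ser _ X]eq_fun do rewrite big_nil.
  exact: has_ser_zero.
under eq_fun do rewrite big_cons; under [X in has_ser _ X]eq_fun do rewrite big_cons.
exact: has_ser_add (Fc i) IH.
Qed.

Lemma has_ser_eq f g c : has_ser f c -> has_ser g c ->
  \forall z \near (0 : 'rV[C]_n), f z = g z.
Proof.
move=> fc gc; have [r [M [L [r0 _ _ cf cg]]]] := has_ser_common fc gc.
apply/near0P; exists r => // z zr; exact: has_sum_unique (cf z zr) (cg z zr).
Qed.

Lemma nrm_gpt_convs c k M : nrm c (gpt R n k) M -> convs c.
Proof.
move=> cM; have [s s0 sP] : exists2 s : C, 0 < s & forall j, s <= gpt R n k 0 j.
  apply: common_radius_fin => [j r s _ sr|j]; first exact: le_trans.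
  exists (gpt R n k 0 j); split=> //.
  by rewrite mxE invr_gt0 exprn_gt0// ltr0n prime_gt0// prime_seqP.
exists s, M; split=> //; apply: nrm_mono cM => i.
have g0 : 0 <= gpt R n k 0 i := le_trans (ltW s0) (sP i).
rewrite [X in `|X| <= _]mxE (ger0_norm (ltW s0)) (ger0_norm g0).
exact: sP.
Qed.

(** [goedel_tail] holds for all large k, so one k suits all divisors and also brings [gpt k] into
    the polydisc of convergence of h; it is the polyradius of the division. *)
Lemma hol_division K (F : 'I_K -> 'rV[C]_n -> C) (al : 'I_K -> mindex n)
    (c : 'I_K -> mindex n -> C) (h : 'rV[C]_n -> C) :
  (forall i, has_ser (F i) (c i)) -> (forall i, c i (al i) = 1) ->
  (forall i b, (goedel b < goedel (al i))%N -> c i b = 0) -> hol_at h 0 ->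
  exists q r rho, [/\ forall i, hol_at (q i) 0, has_ser r rho,
    \forall z \near (0 : 'rV[C]_n), h z = \sum_i q i z * F i z + r z
  & forall b i, mile (al i) b -> rho b = 0].
Proof.
move=> Fc c1 c0 /hol0P[d hd]; have [r0 [M [r00 dM _]]] := hd.
have e0 : 0 < (2 * K.+1%:R)^-1 :> C by rewrite invr_gt0.
have /choice[k0 k0P] := fun i => goedel_tail (has_ser_convs (Fc i)) (c0 i) e0.
have [k1 k1P] := gpt_lt n r00.
pose k := maxn k1 (\max_i k0 i).
have kk1 : (k1 <= k)%N by rewrite leq_maxl.
have kk0 i : (k0 i <= k)%N by rewrite (leq_trans _ (leq_maxr _ _))// leq_bigmax.
have w0 (b : mindex n) : 0 < ps_monomial (gpt R n k) b.
  by rewrite mon_gpt invr_gt0 exprn_gt0// ltr0n goedel_gt0.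
have dw : nrm d (gpt R n k) M.
  by apply: nrm_mono dM; apply: lt_const_mx; exact: k1P.
have [q [r [qL [L rL] dE rho]]] := division c1 w0 (fun i => k0P i k (kk0 i)) dw.
have /choice[qf qfP] : forall i, exists f, has_ser f (q i).
  by move=> i; have [Li qi] := qL i; exact: ser_fun (nrm_gpt_convs qi).
have [rf rfP] := ser_fun (nrm_gpt_convs rL).
exists qf, rf, r; split; [|exact: rfP| |exact: rho].
  by move=> i; apply/hol0P; exists (q i); exact: qfP.
have := has_ser_add (has_ser_sum (index_enum 'I_K)
  (fun i => has_ser_mul (qfP i) (Fc i))) rfP.
rewrite (_ : (fun a => _) = d); last by apply/funext => a; rewrite dE.
exact: has_ser_eq.
Qed.

End SeriesAlgebra.

(** * Restriction of power series to slices *)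

Section Slices.
Variables (R : realType) (d n : nat).
Local Notation C := (Cplx R).

Definition mcat (a : mindex d) (b : mindex n) : mindex (d + n) :=
  [ffun i => match fintype.split i with inl j => a j | inr j => b j end].
Definition mleft (g : mindex (d + n)) : mindex d := [ffun j => g (lshift n j)].
Definition mright (g : mindex (d + n)) : mindex n := [ffun j => g (rshift d j)].

Lemma mcatK g : mcat (mleft g) (mright g) = g.
Proof.
by apply/ffunP => i; rewrite ffunE; case: (split_ordP i) => j ->;
  rewrite ?(unsplitK (inl j)) ?(unsplitK (inr j)) ffunE.
Qed.

Lemma mleft_cat a b : mleft (mcat a b) = a.
Proof. by apply/ffunP => i; rewrite !ffunE (unsplitK (inl i)). Qed.

Lemma mright_cat a b : mright (mcat a b) = b.
Proof. by apply/ffunP => i; rewrite !ffunE (unsplitK (inr i)). Qed.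

Lemma mon_cat (s : 'rV[C]_d) (x : 'rV[C]_n) a b :
  ps_monomial (row_mx s x) (mcat a b) = ps_monomial s a * ps_monomial x b.
Proof.
rewrite /ps_monomial big_split_ord/=; congr (_ * _); apply: eq_bigr => i _.
  by rewrite row_mxEl ffunE (unsplitK (inl i)).
by rewrite row_mxEr ffunE (unsplitK (inr i)).
Qed.

Lemma mcat_inj : injective (fun p : mindex d * mindex n => mcat p.1 p.2).
Proof.
move=> [a b] [a' b'] /= e; have := congr1 mleft e; have := congr1 mright e.
by rewrite !mleft_cat !mright_cat => -> ->.
Qed.

Lemma row_lt (s : 'rV[C]_d) (x : 'rV[C]_n) (r : C) :
  (forall i, `|s 0 i| < r) -> (forall i, `|x 0 i| < r) ->
  forall i, `|row_mx s x 0 i| < r.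
Proof.
move=> sr xr i; case: (split_ordP i) => j ->; first by rewrite row_mxEl.
by rewrite row_mxEr.
Qed.

(** The radius r is independent of s. Thanks to this, the vanishing of the coefficients of all
    slices, each of which alone is only a germ, implies vanishing on a neighbourhood of 0 in all
    variables. *)
Lemma has_ser_slice (h : 'rV[C]_(d + n) -> C) c : has_ser h c ->
  exists2 r : C, 0 < r & forall s : 'rV[C]_d, (forall i, `|s 0 i| < r) ->
  exists e, [/\ has_ser (fun x => h (row_mx s x)) e,
    forall b, has_sum (fun a => c (mcat a b) * ps_monomial s a) (e b)
  & forall x : 'rV[C]_n, (forall i, `|x 0 i| < r) ->
     has_sum (fun b => e b * ps_monomial x b) (h (row_mx s x))].
Proof.
move=> [r [M [r0 cM ch]]]; exists r => // s sr.
pose G (x : 'rV[C]_n) p := c (mcat p.1 p.2) * ps_monomial s p.1 * ps_monomial x p.2.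
have GE x p : c (mcat p.1 p.2) * ps_monomial (row_mx s x) (mcat p.1 p.2) = G x p.
  by rewrite mon_cat mulrA.
have fam (x : 'rV[C]_n) : (forall i, `|x 0 i| <= `|(const_mx r : 'rV[C]_n) 0 i|) -> abs_le (G x) M.
  move=> xr; have [cx] : nrm c (row_mx s x) M.
    apply: nrm_mono cM => i; case: (split_ordP i) => j ->.
      by rewrite row_mxEl [X in _ <= X](_ : _ = `|(const_mx r : 'rV[C]_d) 0 j|);
        [exact: lt_const_mx|rewrite !mxE].
    rewrite row_mxEr [X in _ <= X](_ : _ = `|(const_mx r : 'rV[C]_n) 0 j|);
      by [exact: xr|rewrite !mxE].
  have := abs_le_reindex mcat_inj cx.
  by rewrite (_ : _ \o _ = G x)//; apply/funext => p /=; rewrite GE.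
have fam_r := fam _ (fun i => lexx _).
have /choice[e eP] : forall b, exists v, has_sum (fun a => c (mcat a b) * ps_monomial s a) v.
  move=> b; have rb0 : r ^+ deg b != 0 by rewrite expf_neq0// gt_eqF.
  have inj : injective (fun a : mindex d => (a, b)) by move=> a a' [].
  have := abs_leZ (r ^+ deg b)^-1 (abs_le_reindex inj fam_r).
  move=> /has_sum_ex[v]; rewrite (_ : (fun _ => _) = (fun a => c (mcat a b) * ps_monomial s a)).
    by exists v.
  by apply/funext => a /=; rewrite /G/= mon_const mulrC mulfK.
have fib x b : has_sum (fun p => if p.2 == b then G x p else 0) (e b * ps_monomial x b).
  apply: (@has_sum_snd _ _ _ (G x)); rewrite mulrC.
  have := has_sumZ (ps_monomial x b) (eP b).
  by apply: eq_has_sum => a; rewrite /G/= mulrC.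
have val (x : 'rV[C]_n) : (forall i, `|x 0 i| < r) ->
    has_sum (fun b => e b * ps_monomial x b) (h (row_mx s x)).
  move=> xr; have [v Gv] := has_sum_ex (fam x (lt_const_mx xr)).
  have -> : h (row_mx s x) = v; last exact: has_sum_sigma Gv (fib x).
  apply: has_sum_unique (ch _ (row_lt sr xr)) _.
  apply: (has_sum_reindex mcat_inj).
    by move=> g /(_ (mleft g, mright g)); rewrite /= mcatK eqxx.
  by apply: eq_has_sum Gv => p /=; rewrite GE.
exists e; split; [|exact: eP|exact: val].
exists r, M; split; [exact: r0| |exact: val].
by split; exact: abs_le_sigma fam_r (fib _).
Qed.

Lemma has_ser_lift (f : 'rV[C]_n -> C) c : has_ser f c ->
  has_ser (fun w : 'rV[C]_(d + n) => f (rsubmx w))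
    (fun g => if mleft g == mi0 then c (mright g) else 0).
Proof.
move=> [r [M [r0 [cM] cf]]].
pose e (b : mindex n) := mcat mi0 b.
have e_inj : injective e by move=> b b' /(congr1 mright); rewrite !mright_cat.
pose ch g := if mleft g == mi0 then c (mright g) else 0.
have off w g : (forall b, e b != g) -> ch g * ps_monomial w g = 0.
  move=> ne; rewrite /ch; case: eqP => [g0|_]; last by rewrite mul0r.
  by have := ne (mright g); rewrite /e -g0 mcatK eqxx.
have on w b : ch (e b) * ps_monomial w (e b) = c b * ps_monomial (rsubmx w) b.
  by rewrite /ch /e mleft_cat eqxx mright_cat -{1}[w]hsubmxK mon_cat mon0 mul1r.
exists r, M; split; first exact: r0.
  split; apply: (abs_le_extend e_inj (off _)).
  apply: abs_le_sub cM => b; rewrite /= on (_ : rsubmx _ = const_mx r)//.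
  by apply/rowP => i; rewrite !mxE.
move=> w wr; apply: (has_sum_reindex e_inj (off _)).
have wr' i : `|rsubmx w 0 i| < r by rewrite mxE.
by apply: eq_has_sum (cf _ wr') => b; rewrite /= on.
Qed.

End Slices.

Section SliceLemma.
Variables (R : realType) (d : nat) (X : germ R).
Local Notation C := (Cplx R).
Local Notation n := (edim X).

(* The Goedel numbers are those of the exponents in d + n variables, as the
   division takes place there. *)
Definition lead_exp (al : mindex n) := exists f c, [/\ germ_ideal X f, has_ser f c,
  c al = 1 & forall b, (goedel (mcat (@mi0 d) b) < goedel (mcat (@mi0 d) al))%N -> c b = 0].

(** A nonzero coefficient of least Goedel number, normalized to 1, would make its exponent a leading
    exponent. *)
Lemma lead_exp_ex f c : germ_ideal X f -> has_ser f c ->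
  (forall al, lead_exp al -> c al = 0) -> forall b, c b = 0.
Proof.
move=> fI fc cal b; have [m] := ubnP (goedel (mcat (@mi0 d) b)).
elim: m b => // m IH b; rewrite ltnS => bm.
apply: contrapT => /eqP cb0; case/eqP: (cb0); apply: cal.
exists (fun z => (c b)^-1 * f z), (fun a => (c b)^-1 * c a); split.
- by apply: idealM fI; exact: hol_cst.
- exact: has_serZ.
- exact: mulVf.
by move=> b' b'b; rewrite (IH b' (leq_trans b'b bm)) mulr0.
Qed.

Lemma cylinder_proj_mor : is_mor (cylinder d X) X (fun w => rsubmx w).
Proof.
split; [exact: hol_rsubmx|exact: linear0|].
move=> e eX; have hr := @hol_rsubmx R d n.
have r0 : rsubmx (0 : 'rV[C]_(d + n)) = 0 by rewrite linear0.
apply: (ideal_eqs (X := cylinder d X) (e := mkh (hol_comp (hfun_hol e) hr r0))).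
by exists e.
Qed.

Lemma ideal_slices (h : 'rV[C]_(d + n) -> C) : hol_at h 0 ->
  (\forall s \near (0 : 'rV[C]_d), germ_ideal X (fun x => h (row_mx s x))) ->
  germ_ideal (cylinder d X) h.
Proof.
move=> hh slI.
(* Finitely many leading exponents suffice to divide all the others. Exponents are extended by 0 to
   indices outside ['I_n]. *)
have [sq [sqE sqP]] := dickson (fun (b : mindex n) j =>
  if insub j is Some i then b (i : 'I_n) else 0%N) n lead_exp.
pose K := size sq; pose al (i : 'I_K) := nth mi0 sq i.
have /choice[F /choice[c Fc]] : forall i, lead_exp (al i).
  by move=> i; apply: sqE; exact: mem_nth.
have alP b : lead_exp b -> exists i, mile (al i) b.
  move=> /sqP[b' b's le]; have b'i : (index b' sq < K)%N by rewrite index_mem.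
  exists (Ordinal b'i); apply/forallP => j; rewrite /al/= nth_index//.
  by have := le j (ltn_ord j); rewrite valK.
have [||q [r [rho [hq rr hE rho0]]]] := hol_division (K := K)
  (F := fun i (w : 'rV[C]_(d + n)) => F i (rsubmx w)) (al := fun i => mcat mi0 (al i))
  (fun i => has_ser_lift d (let: And4 _ h _ _ := Fc i in h)) _ _ hh.
- by move=> i; rewrite mleft_cat eqxx mright_cat; have [_ _ ->] := Fc i.
- move=> i b bal; case: eqP => // b0; have [_ _ _ ->] := Fc i => //.
  by rewrite -[X in mcat X (mright b)]b0 mcatK.
(* The divisors do not involve s, so each slice of the remainder differs from that of h by a member
   of the ideal of X. *)
have rI : \forall s \near (0 : 'rV[C]_d), germ_ideal X (fun x => r (row_mx s x)).
  have [t1 t10 t1P] := (near0P _).1 hE.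
  have [t2 t20 t2P] := (near0P _).1 slI.
  have [t3 t30 t3P] : exists2 t : C, 0 < t & forall i, forall s : 'rV[C]_d,
      (forall j, `|s 0 j| < t) -> hol_at (fun x => q i (row_mx s x)) 0.
    apply: (@common_radius_fin _ _ (fun i t => forall s : 'rV[C]_d,
      (forall j, `|s 0 j| < t) -> hol_at (fun x => q i (row_mx s x)) 0)).
      by move=> i u u' u'0 u'u uP s su; apply: uP => j; exact: lt_le_trans (su j) u'u.
    move=> i; have /hol0P[e qe] := hq i; have [u u0 uP] := has_ser_slice qe.
    exists u; split=> // s su; have [e' [qe' _ _]] := uP s su.
    by apply/hol0P; exists e'.
  have [t [t0 tt1 tt2]] := common_radius t10 t20.
  have [u [u0 ut ut3]] := common_radius t0 t30.
  apply/near0P; exists u => // s su.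
  have su1 i : `|s 0 i| < t1 by exact: lt_le_trans (su i) (le_trans ut tt1).
  have hI := t2P s (fun i => lt_le_trans (su i) (le_trans ut tt2)).
  have sumI : germ_ideal X (fun x => \sum_i q i (row_mx s x) * F i x).
    apply: ideal_sum => i _; apply: idealM; last by have [] := Fc i.
    exact: t3P (fun j => lt_le_trans (su j) ut3).
  apply: ideal_near (idealB hI sumI); apply/near0P; exists t1 => // x x1.
  rewrite (t1P _ (row_lt su1 x1)) [X in X - _]addrC.
  by under eq_bigr do rewrite row_mxKr; rewrite addrK.
have r_near0 : \forall w \near (0 : 'rV[C]_(d + n)), r w = 0.
  have [t t0 tP] := has_ser_slice rr.
  have [t' t'0 t'P] := (near0P _).1 rI.
  have [u [u0 ut ut']] := common_radius t0 t'0.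
  apply/near0P; exists u => // w wu.
  have su i : `|lsubmx w 0 i| < u by rewrite mxE.
  have xu i : `|rsubmx w 0 i| < u by rewrite mxE.
  have [e [re eb ev]] := tP (lsubmx w) (fun i => lt_le_trans (su i) ut).
  (* The condition on rho involves only the exponents in x, so it passes to every slice: its
     coefficients vanish at all leading exponents, while the slice lies in the ideal. *)
  have e0 : forall b, e b = 0.
    apply: (lead_exp_ex _ re); first exact: t'P _ (fun i => lt_le_trans (su i) ut').
    move=> b /alP[i ib]; apply: has_sum_unique (eb b) _.
    apply: eq_has_sum (@has_sum0 _ _) => a; rewrite (rho0 _ i) ?mul0r//.
    apply/forallP => j; rewrite !ffunE; case: (fintype.split j) => l; first by rewrite ffunE.
    exact: (forallP ib).
  have := ev (rsubmx w) (fun i => lt_le_trans (xu i) ut); rewrite hsubmxK => rw.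
  apply: has_sum_unique rw _; apply: eq_has_sum (@has_sum0 _ _) => b.
  by rewrite e0 mul0r.
apply: (ideal_near (X := cylinder d X)
  (f := fun w : 'rV[C]_(d + n) => \sum_i q i w * F i (rsubmx w))).
  by apply: near0S2 hE r_near0 => w -> ->; rewrite addr0.
apply: (ideal_sum (X := cylinder d X)) => i _; apply: (idealM (X := cylinder d X)) (hq i) _.
have [FI _ _ _] := Fc i; exact: (ideal_comp cylinder_proj_mor FI).
Qed.

End SliceLemma.

(** * Lifting the action to a pullback *)

Section FibreProduct.
Variables (R : realType).
Local Notation C := (Cplx R).
Variables (Y X T S : germ R).
Variables (p : 'rV[C]_(edim Y) -> 'rV[C]_(edim X)).
Variables (q : 'rV[C]_(edim Y) -> 'rV[C]_(edim T)).
Variables (f : 'rV[C]_(edim X) -> 'rV[C]_(edim S)).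
Variables (g : 'rV[C]_(edim T) -> 'rV[C]_(edim S)).
Hypotheses (mf : is_mor X S f) (mg : is_mor T S g).
Hypothesis pb : is_pullback Y X T S p q f g.

Lemma pullback_uniq Z (w w' : 'rV[C]_(edim Z) -> 'rV[C]_(edim Y)) :
  is_mor Z Y w -> is_mor Z Y w' -> eq_mor Z (p \o w) (p \o w') ->
  eq_mor Z (q \o w) (q \o w') -> eq_mor Z w w'.
Proof.
move=> mw mw' e1 e2; have [mp mq sq univ] := pb.
have [_ u] := univ Z _ _ (is_mor_comp mw mp) (is_mor_comp mw mq) (eq_mor_pre mw sq).
exact: u.
Qed.

(** The pullback Y is known only through its universal property, which gives a lift for each cone
    separately. A concrete fibre product has one morphism [al] to Y through which every cone is
    lifted by composition, so that the lifted action is given by a formula. *)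
Definition fibre_eqs : set (hfun R (edim X + edim T)) :=
  [set h | exists2 e, eqs X e & forall w, h w = e (lsubmx w)] `|`
  [set h | exists2 e, eqs T e & forall w, h w = e (rsubmx w)] `|`
  [set h | exists j, forall w, h w = f (lsubmx w) 0 j - g (rsubmx w) 0 j].

Lemma fibre_eqs0 h : fibre_eqs h -> h 0 = 0.
Proof.
move=> [[[e eX ->]|[e eT ->]]|[j ->]]; rewrite ?linear0.
- exact: eqs0 eX.
- exact: eqs0 eT.
by have [_ -> _] := mf; have [_ -> _] := mg; rewrite subrr.
Qed.

Definition fibre_germ : germ R := @Germ R (edim X + edim T) fibre_eqs fibre_eqs0.
Local Notation P := fibre_germ.

Lemma fibre_pair_mor Z (u : 'rV[C]_(edim Z) -> 'rV[C]_(edim X))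
    (v : 'rV[C]_(edim Z) -> 'rV[C]_(edim T)) :
  is_mor Z X u -> is_mor Z T v -> eq_mor Z (f \o u) (g \o v) ->
  is_mor Z P (fun z => row_mx (u z) (v z)).
Proof.
move=> [hu u0 uI] [hv v0 vI] uv; split.
- exact: hol_row_mx hu hv.
- by rewrite u0 v0 row_mx0.
move=> e [[[e' eX eE]|[e' eT eE]]|[j eE]].
- by apply: ideal_near (uI e' eX); apply: near0W => z /=; rewrite eE row_mxKl.
- by apply: ideal_near (vI e' eT); apply: near0W => z /=; rewrite eE row_mxKr.
apply: ideal_near (eq_mor_coord j uv); apply: near0W => z /=.
by rewrite eE row_mxKl row_mxKr.
Qed.

Lemma fibre_left_mor : is_mor P X (fun w => lsubmx w).
Proof.
split; [exact: hol_lsubmx|exact: linear0|].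
move=> e eX; have hl := @hol_lsubmx R (edim X) (edim T).
have l0 : lsubmx (0 : 'rV[C]_(edim X + edim T)) = 0 by rewrite linear0.
apply: (ideal_eqs (X := P) (e := mkh (hol_comp (hfun_hol e) hl l0))).
by left; left; exists e.
Qed.

Lemma fibre_right_mor : is_mor P T (fun w => rsubmx w).
Proof.
split; [exact: hol_rsubmx|exact: linear0|].
move=> e eT; have hr := @hol_rsubmx R (edim X) (edim T).
have r0 : rsubmx (0 : 'rV[C]_(edim X + edim T)) = 0 by rewrite linear0.
apply: (ideal_eqs (X := P) (e := mkh (hol_comp (hfun_hol e) hr r0))).
by left; right; exists e.
Qed.

Lemma fibre_square : eq_mor P (f \o (fun w => lsubmx w)) (g \o (fun w => rsubmx w)).
Proof.
have [h1 z1 _] := is_mor_comp fibre_left_mor mf.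
have [h2 z2 _] := is_mor_comp fibre_right_mor mg.
apply: (coord_eq_mor h1 z1 h2 z2) => j.
have he : hol_at (fun w : 'rV[C]_(edim X + edim T) =>
    f (lsubmx w) 0 j - g (rsubmx w) 0 j) 0 by apply: holB; [exact: h1|exact: h2].
by apply: (ideal_eqs (X := P) (e := mkh he)); right; exists j.
Qed.

Lemma fibre_universal : exists al : 'rV[C]_(edim P) -> 'rV[C]_(edim Y),
  [/\ is_mor P Y al, eq_mor P (p \o al) (fun w => lsubmx w)
    & eq_mor P (q \o al) (fun w => rsubmx w)].
Proof.
have [_ _ _ univ] := pb.
by have [] := univ P _ _ fibre_left_mor fibre_right_mor fibre_square.
Qed.

End FibreProduct.

Section Charts.
Variables (R : realType) (G : complex_lie_group R).
Local Notation C := (Cplx R).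

(** The image of a chart is open, so every small s is the coordinate of some group element near g0;
    a property of such elements thus reaches all slices over small s. *)
Lemma chart_near (k : chart R G (lie_dim G)) g0 (P : G -> Prop) : chart_dom k g0 ->
  (\forall g \near g0, P g) ->
  \forall s \near (0 : 'rV[C]_(lie_dim G)),
     exists2 g, P g & chart_map k g - chart_map k g0 = s.
Proof.
move=> kg0 Pg.
have im : \forall y \near chart_map k g0, exists2 g, chart_dom k g & chart_map k g = y.
  apply: open_nbhs_nbhs; split; first exact: chart_map_open.
  by exists g0.
have inv : \forall y \near chart_map k g0, P (chart_inv k y).
  have := @chart_inv_continuous _ _ _ k g0 kg0; rewrite /prop_for /continuous_at chart_mapK//.
  exact.
have [e/= e0 eP] := (nbhs_ballP _ _).1 (filterI im inv).
apply/near0P; exists e => // s se.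
have [|[g kg gE] Pg'] := eP (chart_map k g0 + s).
  split=> // i j; rewrite -ball_normE/= ord1 mxE opprD addNKr normrN.
  exact: se.
exists g; last by rewrite gE addrC addKr.
by have := Pg'; rewrite -gE chart_mapK.
Qed.

End Charts.

Section LiftAction.
Variables (R : realType) (G : complex_lie_group R).
Local Notation C := (Cplx R).
Variables (Y X T S : germ R).
Variables (p : 'rV[C]_(edim Y) -> 'rV[C]_(edim X)).
Variables (q : 'rV[C]_(edim Y) -> 'rV[C]_(edim T)).
Variables (f : 'rV[C]_(edim X) -> 'rV[C]_(edim S)).
Variables (g : 'rV[C]_(edim T) -> 'rV[C]_(edim S)).
Hypotheses (mf : is_mor X S f) (mg : is_mor T S g).
Hypothesis pb : is_pullback Y X T S p q f g.
Variable b : germ_action G X.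
Hypothesis bf : forall k, eq_mor X (f \o b k) f.

Lemma lift_action : exists b' : germ_action G Y,
  (forall k, eq_mor Y (p \o b' k) (b k \o p)) /\
  (forall k, eq_mor Y (q \o b' k) q).
Proof.
have [mp mq sq _] := pb.
have [hp p0 _] := mp; have [hq q0 _] := mq.
have [hf f0 _] := mf; have [hg g0 _] := mg.
have [al [mal pal qal]] := fibre_universal mf mg pb.
have [hal al0 _] := mal.
pose b' k z := al (row_mx (b k (p z)) (q z)).
have pair_mor k : is_mor Y (fibre_germ mf mg) (fun z => row_mx (b k (p z)) (q z)).
  apply: fibre_pair_mor; [exact: is_mor_comp mp (act_map_mor b k)|exact: mq|].
  have e1 : eq_mor Y (f \o b k \o p) (f \o p) := eq_mor_pre mp (bf k).
  exact: eq_mor_trans e1 sq.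
have b'_mor k : is_mor Y Y (b' k) by exact: is_mor_comp (pair_mor k) mal.
have pb' k : eq_mor Y (p \o b' k) (b k \o p).
  have := eq_mor_pre (pair_mor k) pal.
  by rewrite (_ : (fun w => lsubmx w) \o _ = b k \o p)//; apply/funext => z /=; rewrite row_mxKl.
have qb' k : eq_mor Y (q \o b' k) q.
  have := eq_mor_pre (pair_mor k) qal.
  by rewrite (_ : (fun w => rsubmx w) \o _ = q)//; apply/funext => z /=; rewrite row_mxKr.
have b'1 : eq_mor Y (b' 1%g) id.
  apply: (pullback_uniq pb (b'_mor _) (is_mor_id Y)).
    exact: eq_mor_trans (pb' _) (eq_mor_pre mp (act_map1 b)).
  exact: qb'.
have b'M k l : eq_mor Y (b' (k * l)%g) (b' k \o b' l).
  apply: (pullback_uniq pb (b'_mor _) (is_mor_comp (b'_mor l) (b'_mor k))).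
    apply: (eq_mor_trans (pb' _)).
    have e1 := eq_mor_pre mp (act_mapM b k l).
    apply: (eq_mor_trans e1); apply: eq_mor_sym.
    have e2 := eq_mor_pre (b'_mor l) (pb' k).
    apply: (eq_mor_trans e2).
    have [hb b0 _] := act_map_mor b k.
    exact: (eq_mor_post hb b0 (pb' l)).
  apply: (eq_mor_trans (qb' _)); apply: eq_mor_sym.
  have e2 := eq_mor_pre (b'_mor l) (qb' k).
  exact: eq_mor_trans e2 (qb' l).
have b'_hol k k0 : atlas G k -> chart_dom k k0 ->
    exists Phi : 'rV[C]_(lie_dim G + edim Y) -> 'rV[C]_(edim Y),
      is_mor (cylinder (lie_dim G) Y) Y Phi /\
      \forall l \near k0, eq_mor Y (b' l)
          (fun z => Phi (row_mx (chart_map k l - chart_map k k0) z)).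
  move=> ak kk0; have [Phi [mPhi Phi_b]] := act_map_hol b k k0 ak kk0.
  have [hPhi Phi0 _] := mPhi.
  (* The product of the identity of the group chart with p, through which the holomorphic family Phi
     on X is pulled back to Y. *)
  pose ka (w : 'rV[C]_(lie_dim G + edim Y)) : 'rV[C]_(lie_dim G + edim X) :=
    row_mx (lsubmx w) (p (rsubmx w)).
  have mr := @cylinder_proj_mor R (lie_dim G) Y.
  have [hr r0 _] := mr.
  have mpr := is_mor_comp mr mp; have [hpr pr0 prI] := mpr.
  have mka : is_mor (cylinder (lie_dim G) Y) (cylinder (lie_dim G) X) ka.
    split; [exact: hol_row_mx (@hol_lsubmx R _ _) hpr| |].
      by rewrite /ka !linear0 p0 row_mx0.
    move=> e [e' eX eE]; apply: (ideal_near (X := cylinder (lie_dim G) Y)) (prI e' eX).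
    by apply: near0W => w /=; rewrite eE row_mxKr.
  have mu := is_mor_comp mka mPhi; have mv := is_mor_comp mr mq.
  have slice l : eq_mor X (b l) (fun z => Phi (row_mx (chart_map k l - chart_map k k0) z)) ->
      eq_mor Y (b l \o p) (fun y => Phi (row_mx (chart_map k l - chart_map k k0) (p y))).
    exact: eq_mor_pre mp.
  (* On the slice over s the family is the action of a single group element, which preserves the
     fibres of f; [ideal_slices] makes the square commute on the whole cylinder. *)
  have sqw : eq_mor (cylinder (lie_dim G) Y) (f \o (Phi \o ka)) (g \o (q \o (fun w => rsubmx w))).
    move=> h.
    have [hu u0 _] := is_mor_comp mu mf; have [hv v0 _] := is_mor_comp mv mg.
    apply: ideal_slices.
      apply: holB; first exact: hol_comp (hfun_hol h) hu u0.
      exact: hol_comp (hfun_hol h) hv v0.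
    apply: near0S (chart_near kk0 Phi_b) => s [l Phil <-].
    have e1 := eq_mor_post hf f0 (slice l Phil).
    have e2 : eq_mor Y (f \o b l \o p) (f \o p) := eq_mor_pre mp (bf l).
    have e3 := eq_mor_trans (eq_mor_sym e1) (eq_mor_trans e2 sq).
    apply: ideal_near (e3 h); apply: near0W => z /=.
    by rewrite /ka row_mxKl row_mxKr.
  have mpair := fibre_pair_mor mf mg mu mv sqw.
  exists (al \o (fun w => row_mx ((Phi \o ka) w) ((q \o (fun w => rsubmx w)) w))).
  split; first exact: is_mor_comp mpair mal.
  apply: filterS Phi_b => l /slice Phil.
  have [hbp bp0 _] := is_mor_comp mp (act_map_mor b l).
  have [hPl Pl0] := eq_mor_hol Phil hbp bp0.
  have e1 : eq_mor Y (fun y => row_mx (b l (p y)) (q y))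
      (fun y => row_mx (Phi (row_mx (chart_map k l - chart_map k k0) (p y))) (q y)).
    apply: coord_eq_mor.
    - exact: hol_row_mx hbp hq.
    - by rewrite [b l (p 0)]bp0 q0 row_mx0.
    - exact: hol_row_mx hPl hq.
    - by rewrite [Phi _]Pl0 q0 row_mx0.
    move=> j; case: (split_ordP j) => i ->.
      by apply: ideal_near (eq_mor_coord i Phil); apply: near0W => z; rewrite !row_mxEl.
    by apply: ideal_near (ideal0 Y); apply: near0W => z; rewrite !row_mxEr subrr.
  have e2 := eq_mor_post hal al0 e1.
  rewrite (_ : (fun z => _) = al \o (fun y =>
    row_mx (Phi (row_mx (chart_map k l - chart_map k k0) (p y))) (q y))); first exact: e2.
  by apply/funext => z /=; rewrite /ka !row_mxKl !row_mxKr.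
exists (@Action R G Y b' b'_mor b'1 b'M b'_hol); split; [exact: pb'|exact: qb'].
Qed.

End LiftAction.

Theorem corollary2p9 (R : realType) (X : germ R) (hT1 : T1_finite_dim X)
  (G : complex_lie_group R) (hG : compact [set: G]) (a : germ_action G X)
  (S : germ R) (xi : predeformation X S) (b : germ_action G (total_space xi)) (c : germ_action G S)
  (hxi : equivariantly_semi_universal a xi b c)
  (htriv : trivial_on_T1 a) (hsmooth : smooth (fixed_germ c)) :
  germ_ideal (fixed_germ c) = germ_ideal S /\
  (forall (T : germ R) (eta : predeformation X T), is_deformation eta ->
     exists b' : germ_action G (total_space eta),
       extends_action a eta b' /\ fibrewise_action eta b').
Proof.
split; first exact: fixed_germ_ideal hxi htriv hsmooth.
move=> T eta def_eta; have [[def_xi univ] [_ ext equi] _] := hxi.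
have [phi [[psi [mphi pb inc]] _]] := univ T eta def_eta.
have [mpi _ _] := def_xi; have [mq _ [minc mz inc0 _]] := def_eta.
(* The action on the base is trivial by the first part, so the action on the total space of xi is
   fibrewise and can be lifted. *)
have bf k : eq_mor (total_space xi) (def_proj xi \o b k) (def_proj xi).
  exact: eq_mor_trans (equi k) (eq_mor_pre mpi (act_base_trivial hxi htriv hsmooth k)).
have [b' [pb' qb']] := lift_action mpi mphi pb bf.
exists b'; split; last exact: qb'.
move=> k; have [mpsi _ _ _] := pb; have [hpsi psi0 _] := mpsi.
(* Two morphisms from X to the total space of eta agree once they do after psi and after the
   projection to T. The former reduces to the extension property of b, and the latter to X being the
   fibre over 0. *)
apply: (pullback_uniq pb (is_mor_comp minc (act_map_mor b' k))
  (is_mor_comp (act_map_mor a k) minc)).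
  have e1 := eq_mor_pre minc (pb' k); apply: (eq_mor_trans e1).
  have [hb b0 _] := act_map_mor b k.
  have e2 := eq_mor_post hb b0 inc; apply: (eq_mor_trans e2).
  apply: (eq_mor_trans (ext k)); apply: eq_mor_sym.
  exact: (eq_mor_pre (act_map_mor a k) inc).
have e1 := eq_mor_pre minc (qb' k); apply: (eq_mor_trans e1).
apply: (eq_mor_trans inc0); apply: eq_mor_sym.
exact: (eq_mor_pre (act_map_mor a k) inc0).
Qed.
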